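(* For all integers $s\ge 2$ and $n\ge 0$, $$\mathscr A_{s,n}\in \mathfrak Z_{n+s}(3).$$ (For $n=0$, $\mathscr A_{s,0}=\mathscr A_s:=\sum_{k=1}^\infty \frac{1}{k^s\binom{2k}{k}}$.)
   Context: For real $x>0$ put $\binom{2x}{x}:=\frac{\Gamma(2x+1)}{[\Gamma(x+1)]^2}$. For integers $s\ge1$, $n\ge0$ define $$\mathscr A_{s,n}:=\sum_{k=1}^\infty\left.\frac{\partial^n}{\partial x^n}\frac{1}{x^s\binom{2x}{x}}\right|_{x=k}.$$ For positive integers $w,N$, let $\mathfrak Z_w(N)\subset\mathbb C$ be the $\mathbb Q$-linear span of all cyclotomic multiple zeta values of weight $w$ and level $N$, i.e. of all numbers $$\operatorname{Li}_{a_1,\dots,a_m}(z_1,\dots,z_m):=\sum_{\ell_1>\dots>\ell_m>0}\prod_{j=1}^m\frac{z_j^{\ell_j}}{\ell_j^{a_j}}$$ with $m\ge1$, $a_1,\dots,a_m$ positive integers, $\sum_j a_j=w$, $z_1^N=\dots=z_m^N=1$ and $(a_1,z_1)\ne(1,1)$ (the series being understood as the limit as $L\to\infty$ of the partial sums over $\ell_1\le L$). *)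

(* Defs.v *)
From HB Require Import structures.
From mathcomp Require Import all_boot all_order all_algebra.
From mathcomp Require Import all_classical all_reals all_analysis.
From mathcomp Require Import complex.

Set Implicit Arguments.
Unset Strict Implicit.
Unset Printing Implicit Defensive.

Import Order.TTheory GRing.Theory Num.Theory.
Import numFieldNormedType.Exports.

Local Open Scope classical_set_scope.
Local Open Scope ring_scope.
Local Open Scope complex_scope.

(* Meaningful only for 0 < x, where the integral is finite. *)
Definition Gamma (R : realType) (x : R) : R :=
  \int[@lebesgue_measure R]_(t in `]0, +oo[) (t `^ (x - 1) * expR (- t)).

Definition central_binom (R : realType) (x : R) : R :=
  Gamma (2 * x + 1) / Gamma (x + 1) ^+ 2.

(* The indices k >= 1 of the sum are written k.+1 with k : nat. *)
Definition scrA_term (R : realType) (s n k : nat) : R :=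
  derive1n n (fun x : R => 1 / (x ^+ s * central_binom x)) k.+1%:R.

Definition scrA (R : realType) (s n : nat) : R :=
  limn (series (scrA_term R s n)).

Definition scrA_binom (R : realType) (s : nat) : R :=
  limn (series (fun k : nat =>
    1 / (k.+1%:R ^+ s * 'C(2 * k.+1, k.+1)%:R) : R)).

(* Depth m.+1, so that the leading index is ord0. *)
Definition Li_partial (R : realType) (m : nat) (a : 'I_m.+1 -> nat)
    (z : 'I_m.+1 -> R[i]) (L : nat) : R[i] :=
  \sum_(l : {ffun 'I_m.+1 -> 'I_L.+1} |
        [forall j : 'I_m.+1, (0 < l j)%N] &&
        [forall i : 'I_m.+1, forall j : 'I_m.+1, (i < j)%N ==> (l j < l i)%N])
    \prod_(j < m.+1) (z j ^+ l j / (l j)%:R ^+ a j).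

(* The library puts the topology of the modulus on R[i]^o, not on R[i]. *)
Definition Li (R : realType) (m : nat) (a : 'I_m.+1 -> nat)
    (z : 'I_m.+1 -> R[i]) : R[i] :=
  limn (Li_partial a z : nat -> R[i]^o).

Definition CMZV (R : realType) (w N : nat) : set R[i] :=
  [set v | exists (m : nat) (a : 'I_m.+1 -> nat) (z : 'I_m.+1 -> R[i]),
    [/\ forall j, (0 < a j)%N,
        (\sum_j a j)%N = w,
        forall j, z j ^+ N = 1,
        ~ (a ord0 = 1%N /\ z ord0 = 1) &
        v = Li a z]].

Arguments CMZV R w N : clear implicits.

Definition Qspan (R : realType) (S : set R[i]) : set R[i] :=
  [set x | exists (r : nat) (c : 'I_r -> rat) (v : 'I_r -> R[i]),
    (forall j, S (v j)) /\ x = \sum_(j < r) ratr (c j) * v j].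

Definition frakZ (R : realType) (w N : nat) : set R[i] := Qspan (CMZV R w N).
Arguments frakZ R w N : clear implicits.

(* Main.v *)
(* Put [zeta = e^(2 i pi / 3)] and [f x = Gamma(x)^2 / (2 Gamma(2 x))], so that
   [1 / (x^s central_binom x) = x^(1 - s) f x]. The Beta integral reads
   [f x = int_0^oo e^(x z) (1 + e^z)^(- 2 x) dz], and its integrand is real on the
   imaginary axis; hence the real part of the integral does not change when the
   path starts at [2 i pi / 3] instead of [0]. Along the path
   [e^z = zeta (1 - r) / (1 - zeta^2 r)], [0 < r < 1], the integrand becomes
   [e^(x ell r) dlogv r dr], where [ell] and the primitive of [dlogv] are
   combinations of [log (1 - zeta^j r)]. Differentiating in [x] and summing over the
   positive integers writes A_(s,n) as an integral combination of real parts of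
   [int_0^1 Li_p(e^ell) ell^i dlogv dr]. Since [1 - e^ell] equals
   [- 3 zeta r / (1 - zeta r)^2], [Li_p(e^ell)] is a combination of iterated
   integrals in [dr / r] and [zeta^j dr / (1 - zeta^j r)], and so is, by shuffling
   and integrating by parts, a primitive of the integrand. Extracting the letter
   [dr / (1 - r)] by shuffles expands such a primitive at [r = 1] as a polynomial in
   [log (1 - r)] with coefficients in the span of level 3 values; as the integral
   converges, only the constant term is left. *)
Require Import Defs.
From HB Require Import structures.
From mathcomp Require Import all_boot all_order all_algebra.
From mathcomp Require Import all_classical all_reals all_analysis.
From mathcomp Require Import measurable_realfun.
From mathcomp Require Import complex ring lra zify.
Set Implicit Arguments.
Unset Strict Implicit.
Unset Printing Implicit Defensive.
Import Order.TTheory GRing.Theory Num.Theory.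
Import numFieldNormedType.Exports.
Local Open Scope classical_set_scope.
Local Open Scope ring_scope.
Local Open Scope complex_scope.
Import ComplexField.Normc.
Local Arguments normc : simpl never.
Local Notation Re := complex.Re.
Local Notation Im := complex.Im.

(** * Complex functions of a real variable *)

(** The coordinate [r] explains the level. With [q = e^z] and [y = q / (1 + q)^2] the integrand is
    [y^x dz], and summation produces polylogarithms of [y]. The special points are 0, -1 and
    infinity, where [y] is 0 or infinite, and the zeros [zeta], [zeta^2] of
    [1 - y = (1 + q + q^2) / (1 + q)^2]. The Moebius coordinate [r] sends 0, -1, infinity to the
    cube roots of unity 1, [zeta^2], [zeta], and it sends [zeta], [zeta^2] to 0 and infinity.
    Starting at [2 i pi / 3] thus puts [y = 1], [ell = 0] at the base point of the iterated
    integrals. The weight is homogeneous: a differentiation either brings down a factor [ell] or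
    raises the exponent of [1 / x], hence the index of [Li_p]; the form [dlogv] adds the last unit.
    The obstacle at [r = 1] is that words beginning with [dr / (1 - r)] diverge although the whole
    integral converges. No cancellation is exhibited: a polynomial in [log (1 - r)] with a finite
    limit is constant. This requires remainders bounded by a power of [1 - r], since they get
    multiplied by logarithms. *)

Section complex_limits.
Context {R : realType}.
Implicit Types (z w : R[i]) (x y : R).

Lemma ler_normc_Re z : `|Re z| <= normc z.
Proof.
case: z => a b /=; rewrite -sqrtr_sqr ler_wsqrtr// lerDl sqr_ge0 //.
Qed.

Lemma ler_normc_Im z : `|Im z| <= normc z.
Proof.
case: z => a b /=; rewrite -sqrtr_sqr ler_wsqrtr// lerDr sqr_ge0 //.
Qed.

Lemma normc_ge0 z : 0 <= normc z.
Proof. by case: z => a b; exact: sqrtr_ge0. Qed.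

Lemma normc_le_ReIm z : normc z <= `|Re z| + `|Im z|.
Proof.
case: z => a b /=.
rewrite -(@ler_pXn2r _ 2) ?nnegrE ?sqrtr_ge0 ?addr_ge0//.
rewrite sqr_sqrtr ?addr_ge0 ?sqr_ge0// sqrrD !real_normK ?num_real//.
by rewrite addrAC lerDl mulrn_wge0// mulr_ge0.
Qed.

Lemma normc_real x : normc x%:C = `|x|.
Proof. by rewrite /normc /= expr0n addr0 sqrtr_sqr. Qed.

Lemma normcB z w : normc (z - w) = normc (w - z).
Proof. by rewrite -normcN opprB. Qed.

Lemma normc_eq0 z : (normc z == 0) = (z == 0).
Proof.
by apply/eqP/eqP => [/eq0_normc//|->]; rewrite normc0.
Qed.

Lemma normcX z n : normc (z ^+ n) = normc z ^+ n.
Proof. by elim: n => [|n IH]; rewrite ?normc1// !exprS normcM IH. Qed.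

Lemma normc_conj z : normc (conjc z) = normc z.
Proof. by case: z => a b; rewrite /normc /= sqrrN. Qed.

Lemma ler_normc_sum I (s : seq I) (P : pred I) (F : I -> R[i]) :
  normc (\sum_(i <- s | P i) F i) <= \sum_(i <- s | P i) normc (F i).
Proof.
elim/big_ind2 : _ => [|a b c d ab cd|//]; first by rewrite normc0.
by apply: le_trans (le_normcD _ _) _; exact: lerD.
Qed.

Lemma ReD z w : Re (z + w) = Re z + Re w.
Proof. by case: z w => [a b] [c d]. Qed.

Lemma ImD z w : Im (z + w) = Im z + Im w.
Proof. by case: z w => [a b] [c d]. Qed.

Lemma ReM z w : Re (z * w) =
  Re z * Re w - Im z * Im w.
Proof. by case: z w => [a b] [c d]. Qed.

Lemma ImM z w : Im (z * w) =
  Re z * Im w + Im z * Re w.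
Proof. by case: z w => [a b] [c d]. Qed.

Lemma complexP z w : Re z = Re w ->
  Im z = Im w -> z = w.
Proof. by case: z w => [a b] [c d] /= -> ->. Qed.

Lemma conjcM z w : conjc (z * w) = conjc z * conjc w.
Proof. by case: z w => [a b] [c d]; apply: complexP; rewrite /=; ring. Qed.

Lemma conjcD z w : conjc (z + w) = conjc z + conjc w.
Proof. by case: z w => [a b] [c d]; apply: complexP; rewrite /=; ring. Qed.

Lemma Re_sum I (s : seq I) (P : pred I) (F : I -> R[i]) :
  Re (\sum_(i <- s | P i) F i) = \sum_(i <- s | P i) Re (F i).
Proof. by elim/big_ind2 : _ => // a b c d <- <-; rewrite ReD. Qed.

Lemma Im_sum I (s : seq I) (P : pred I) (F : I -> R[i]) :
  Im (\sum_(i <- s | P i) F i) = \sum_(i <- s | P i) Im (F i).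
Proof. by elim/big_ind2 : _ => // a b c d <- <-; rewrite ImD. Qed.

(** Taken componentwise, so that limits and derivatives of real functions can be reused;
    [cvgc_normc] turns it into a statement on moduli for estimates. *)
Definition cvgc {T : Type} (F : set_system T) (f : T -> R[i]) z :=
  (Re (f t) @[t --> F] --> Re z) /\
  (Im (f t) @[t --> F] --> Im z).

Context {T : Type} {F : set_system T} {FF : ProperFilter F}.
Implicit Types f g : T -> R[i].

Lemma cvgc_normc f z : cvgc F f z <-> normc (f t - z) @[t --> F] --> (0 : R).
Proof.
split=> [[h1 h2]|h].
  apply: (@squeeze_cvgr _ _ _ R (cst 0)
    (fun t => `|Re (f t) - Re z| +
              `|Im (f t) - Im z|)).
  - near=> t; rewrite normc_ge0 /= (le_trans (normc_le_ReIm _))//.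
    by case: (f t) z {h1 h2} => [a b] [c d].
  - exact: cvg_cst.
  - rewrite -[0]addr0; apply: cvgD.
    + by rewrite -(@normr0 _ R); apply: cvg_norm; apply/subr_cvg0.
    + by rewrite -(@normr0 _ R); apply: cvg_norm; apply/subr_cvg0.
split; apply/subr_cvg0; apply: norm_cvg0.
- apply: (@squeeze_cvgr _ _ _ _ (cst 0) _ _ _ _ _ h); last exact: cvg_cst.
  near=> t; rewrite normr_ge0 /= (le_trans _ (ler_normc_Re _))//.
  by case: (f t) z {h} => [a b] [c d].
- apply: (@squeeze_cvgr _ _ _ _ (cst 0) _ _ _ _ _ h); last exact: cvg_cst.
  near=> t; rewrite normr_ge0 /= (le_trans _ (ler_normc_Im _))//.
  by case: (f t) z {h} => [a b] [c d].
Unshelve. all: by end_near. Qed.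

Lemma cvgc_le f z (e : T -> R) : (\forall t \near F, normc (f t - z) <= e t) ->
  e t @[t --> F] --> (0 : R) -> cvgc F f z.
Proof.
move=> h1 h2; apply/cvgc_normc.
apply: (@squeeze_cvgr _ _ _ _ (cst 0) _ _ _ _ _ h2); last exact: cvg_cst.
by apply: filterS h1 => t; rewrite normc_ge0.
Qed.

Lemma cvgc_cst z : cvgc F (fun=> z) z.
Proof. by split; exact: cvg_cst. Qed.

Lemma cvgcD f g z w : cvgc F f z -> cvgc F g w -> cvgc F (fun t => f t + g t) (z + w).
Proof.
move=> [a b] [c d]; split.
- by rewrite ReD; under eq_fun do rewrite ReD; exact: cvgD.
- by rewrite ImD; under eq_fun do rewrite ImD; exact: cvgD.
Qed.

Lemma cvgcM f g z w : cvgc F f z -> cvgc F g w -> cvgc F (fun t => f t * g t) (z * w).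
Proof.
move=> [a b] [c d]; split.
- rewrite ReM; under eq_fun do rewrite ReM.
  by apply: cvgB; exact: cvgM.
- rewrite ImM; under eq_fun do rewrite ImM.
  by apply: cvgD; exact: cvgM.
Qed.

Lemma cvgcZ f c z : cvgc F f z -> cvgc F (fun t => c * f t) (c * z).
Proof. by move=> h; apply: cvgcM => //; exact: cvgc_cst. Qed.

Lemma cvgcN f z : cvgc F f z -> cvgc F (fun t => - f t) (- z).
Proof.
move=> /(@cvgcZ _ (-1)); rewrite mulN1r.
by under eq_fun do rewrite mulN1r.
Qed.

Lemma cvgcB f g z w : cvgc F f z -> cvgc F g w -> cvgc F (fun t => f t - g t) (z - w).
Proof. by move=> h k; apply: cvgcD => //; exact: cvgcN. Qed.

Lemma cvgc_conj f z : cvgc F f z -> cvgc F (fun t => conjc (f t)) (conjc z).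
Proof.
move=> [a b]; split.
- suff -> : (fun t => Re (conjc (f t))) = (fun t => Re (f t)).
    by case: z {b} a.
  by apply/funext => t; case: (f t).
- suff -> : (fun t => Im (conjc (f t))) = (fun t => - Im (f t)).
    by case: z {a} b => /= x y /cvgN.
  by apply/funext => t; case: (f t).
Qed.

Lemma cvgc_unique f z w : cvgc F f z -> cvgc F f w -> z = w.
Proof.
move=> [a b] [c d]; apply: complexP.
- exact: (cvg_unique _ a c).
- exact: (cvg_unique _ b d).
Qed.

Lemma cvgc_sum I (s : seq I) (P : pred I) (G : I -> T -> R[i]) (L : I -> R[i]) :
  (forall i, P i -> cvgc F (G i) (L i)) ->
  cvgc F (fun t => \sum_(i <- s | P i) G i t) (\sum_(i <- s | P i) L i).
Proof.
move=> h; elim: s => [|i s IH].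
  under eq_fun do rewrite big_nil.
  by rewrite big_nil; exact: cvgc_cst.
rewrite big_cons; under eq_fun do rewrite big_cons.
by case: ifPn => // Pi; apply: cvgcD => //; exact: h.
Qed.

Lemma near_eq_cvgc f g z : (\forall t \near F, f t = g t) ->
  cvgc F f z -> cvgc F g z.
Proof.
move=> fg [a b]; split.
- apply: cvg_trans a; apply: near_eq_cvg.
  by apply: filterS fg => t ->.
- apply: cvg_trans b; apply: near_eq_cvg.
  by apply: filterS fg => t ->.
Qed.

End complex_limits.

(** * Derivatives along real curves, exponential and logarithm *)

Section complex_derivatives.
Context {R : realType}.
Implicit Types (f g : R -> R[i]) (x : R) (d e : R[i]).

(* Complex functions are only differentiated along real curves. *)
Definition derc f x d :=
  is_derive x 1 (fun t => Re (f t)) (Re d) /\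
  is_derive x 1 (fun t => Im (f t)) (Im d).

Lemma is_derive_near (f g : R -> R) x (d : R) : (\forall t \near x, f t = g t) ->
  is_derive x 1 f d -> is_derive x 1 g d.
Proof. by move=> fg h; apply: near_eq_is_derive h. Qed.

Lemma derc_eq f x d e : d = e -> derc f x d -> derc f x e.
Proof. by move=> ->. Qed.

Lemma derc_cst d x : derc (fun=> d) x 0.
Proof. by split; exact: is_derive_cst. Qed.

Lemma dercD f g x d e : derc f x d -> derc g x e ->
  derc (fun t => f t + g t) x (d + e).
Proof.
move=> [a b] [a' b']; split.
- by rewrite ReD; under eq_fun do rewrite ReD; exact: is_deriveD.
- by rewrite ImD; under eq_fun do rewrite ImD; exact: is_deriveD.
Qed.

Lemma dercM f g x d e : derc f x d -> derc g x e ->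
  derc (fun t => f t * g t) x (d * g x + f x * e).
Proof.
move=> [a b] [a' b']; split.
- rewrite ReD !ReM; under eq_fun do rewrite ReM.
  apply: (is_derive_eq (is_deriveB (is_deriveM a a') (is_deriveM b b'))).
  by rewrite /GRing.scale /=; ring.
- rewrite ImD !ImM; under eq_fun do rewrite ImM.
  apply: (is_derive_eq (is_deriveD (is_deriveM a b') (is_deriveM b a'))).
  by rewrite /GRing.scale /=; ring.
Qed.

Lemma dercZ f x d e : derc f x d -> derc (fun t => e * f t) x (e * d).
Proof.
move=> h; apply: derc_eq; last exact: dercM (derc_cst e x) h.
by rewrite mul0r add0r.
Qed.

Lemma dercN f x d : derc f x d -> derc (fun t => - f t) x (- d).
Proof.
move=> /(@dercZ _ _ _ (-1)); rewrite mulN1r.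
by under eq_fun do rewrite mulN1r.
Qed.

Lemma dercB f g x d e : derc f x d -> derc g x e ->
  derc (fun t => f t - g t) x (d - e).
Proof. by move=> h k; apply: dercD => //; exact: dercN. Qed.

Lemma dercX f x d n : derc f x d ->
  derc (fun t => f t ^+ n) x (n%:R * f x ^+ n.-1 * d).
Proof.
move=> h; elim: n => [|n IH].
  by under eq_fun do rewrite expr0; rewrite mul0r mul0r; exact: derc_cst.
under eq_fun do rewrite exprS.
apply: derc_eq; last exact: (dercM h IH).
by case: n {IH} => [|n] /=; rewrite ?expr0 ?exprS -?natr1; ring.
Qed.

Lemma derc_real (f : R -> R) x (d : R) : is_derive x 1 f d ->
  derc (fun t => (f t)%:C) x d%:C.
Proof. by move=> h; split => //=; exact: is_derive_cst. Qed.

Lemma derc_sum I (s : seq I) (P : pred I) (G : I -> R -> R[i]) (D : I -> R[i]) x :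
  (forall i, P i -> derc (G i) x (D i)) ->
  derc (fun t => \sum_(i <- s | P i) G i t) x (\sum_(i <- s | P i) D i).
Proof.
move=> h; elim: s => [|i s IH].
  under eq_fun do rewrite big_nil.
  by rewrite big_nil; exact: derc_cst.
rewrite big_cons; under eq_fun do rewrite big_cons.
by case: ifPn => // Pi; apply: dercD => //; exact: h.
Qed.

Lemma derc_continuous f x d : derc f x d -> cvgc (nbhs x) f (f x).
Proof.
move=> [[a _] [b _]]; split.
- by have /differentiable_continuous := iffLR (derivable1_diffP _ _) a; apply.
- by have /differentiable_continuous := iffLR (derivable1_diffP _ _) b; apply.
Qed.

Lemma dercV f x d : f x != 0 -> derc f x d ->
  derc (fun t => (f t)^-1) x (- d / f x ^+ 2).
Proof.
move=> fx0 [a b].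
have N0 : Re (f x) ^+ 2 + Im (f x) ^+ 2 != 0.
  apply: contra fx0; rewrite -normc_eq0; case: (f x) => u v; rewrite /normc /= => /eqP ->.
  by rewrite sqrtr0.
have eV t : (f t)^-1 = (Re (f t) / (Re (f t) ^+ 2 + Im (f t) ^+ 2))
   -i* (Im (f t) / (Re (f t) ^+ 2 + Im (f t) ^+ 2)).
  by case: (f t).
pose N t := Re (f t) ^+ 2 + Im (f t) ^+ 2.
have dN : is_derive x 1 N (2 * (Re (f x) * Re d + Im (f x) * Im d)).
  rewrite /N; under eq_fun do rewrite !expr2.
  apply: (is_derive_eq (is_deriveD (is_deriveM a a) (is_deriveM b b))).
  by rewrite /GRing.scale /=; ring.
have dNV := @is_deriveV _ N _ _ _ N0 dN.
rewrite (_ : - d / f x ^+ 2 = - (d * ((f x)^-1 * (f x)^-1))); last first.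
  by rewrite mulNr expr2 invfM.
split.
- under eq_fun do rewrite eV /=.
  apply: (is_derive_eq (is_deriveM a dNV)).
  rewrite eV /GRing.scale /= /N; case: (f x) d N0 {a b dN dNV fx0} => u v [c e] /= N0.
  by field.
- under eq_fun do rewrite eV /=.
  apply: (is_derive_eq (is_deriveN (is_deriveM b dNV))).
  rewrite eV /GRing.scale /= /N; case: (f x) d N0 {a b dN dNV fx0} => u v [c e] /= N0.
  by field.
Qed.

Definition cexp (z : R[i]) : R[i] :=
  (expR (Re z) * cos (Im z)) +i*
  (expR (Re z) * sin (Im z)).

Lemma derc_cexp f x d : derc f x d -> derc (fun t => cexp (f t)) x (cexp (f x) * d).
Proof.
move=> [a b].
have dE := is_derive1_comp (is_derive_expR (Re (f x))) a.
have dC := is_derive1_comp (is_derive_cos (Im (f x))) b.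
have dS := is_derive1_comp (is_derive_sin (Im (f x))) b.
split => /=.
- apply: (is_derive_eq (is_deriveM dE dC)).
  by case: d {a b dE dC dS} => p q; rewrite /GRing.scale /=; ring.
- apply: (is_derive_eq (is_deriveM dE dS)).
  by case: d {a b dE dC dS} => p q; rewrite /GRing.scale /=; ring.
Qed.

Lemma cexpD (z w : R[i]) : cexp (z + w) = cexp z * cexp w.
Proof.
case: z w => [a b] [c d]; rewrite /cexp /=.
by apply: complexP; rewrite /= expRD (cosD, sinD); ring.
Qed.

Lemma cexp0 : cexp 0 = 1.
Proof. by apply: complexP; rewrite /= expR0 (cos0, sin0) ?mulr1 ?mulr0. Qed.

Lemma cexpN (z : R[i]) : cexp (- z) = (cexp z)^-1.
Proof.
have h : cexp z * cexp (- z) = 1 by rewrite -cexpD subrr cexp0.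
have nz : cexp z != 0.
  by apply/eqP => e; move: h; rewrite e mul0r => /eqP; rewrite eq_sym oner_eq0.
by apply: (mulfI nz); rewrite h divff.
Qed.

Lemma normc_cexp (z : R[i]) : normc (cexp z) = expR (Re z).
Proof.
rewrite /cexp /normc /= !exprMn -mulrDr cos2Dsin2 mulr1 sqrtr_sqr ger0_norm// expR_ge0.
Qed.

Lemma cexp_neq0 (z : R[i]) : cexp z != 0.
Proof. by rewrite -normc_eq0 normc_cexp gt_eqF// expR_gt0. Qed.

Lemma cexpMn n (z : R[i]) : cexp (n%:R * z) = cexp z ^+ n.
Proof.
elim: n => [|n IH]; first by rewrite mul0r cexp0.
by rewrite -natr1 mulrDl mul1r cexpD IH exprSr.
Qed.

(* The principal logarithm, but only for [0 < Re z]. *)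
Definition clog (z : R[i]) : R[i] :=
  (ln (Re z ^+ 2 + Im z ^+ 2) / 2) +i*
  atan (Im z / Re z).

Lemma derc_clog f x d : 0 < Re (f x) -> derc f x d ->
  derc (fun t => clog (f t)) x (d / f x).
Proof.
move=> fx0 [a b].
have N0 : 0 < Re (f x) ^+ 2 + Im (f x) ^+ 2.
  by rewrite ltr_pwDl ?sqr_ge0// exprn_gt0.
pose N t := Re (f t) ^+ 2 + Im (f t) ^+ 2.
have dN : is_derive x 1 N (2 * (Re (f x) * Re d + Im (f x) * Im d)).
  rewrite /N; under eq_fun do rewrite !expr2.
  apply: (is_derive_eq (is_deriveD (is_deriveM a a) (is_deriveM b b))).
  by rewrite /GRing.scale /=; ring.
have Re0 : Re (f x) != 0 by rewrite gt_eqF.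
have dQ := is_deriveM b (is_deriveV Re0 a).
have dL := @is_derive1_comp _ (@ln R) N _ _ _ (is_derive1_ln N0) dN.
have dA := @is_derive1_comp _ (@atan R) (fun t => Im (f t) / Re (f t))
  _ _ _ (is_derive1_atan _) dQ.
split.
- apply: (is_derive_eq (is_deriveM dL (is_derive_cst (2^-1 : R) x 1))).
  move: N0; case: (f x) d {a b dN Re0 dQ dL dA fx0} => u v [c e] /= N0.
  have N1 : u ^+ 2 + v ^+ 2 != 0 by rewrite gt_eqF.
  by rewrite /GRing.scale /=; field.
- apply: (is_derive_eq dA).
  move: N0 Re0; case: (f x) d {a b dN dQ dL dA fx0} => u v [c e] /= N0 Re0.
  have N1 : u ^+ 2 + v ^+ 2 != 0 by rewrite gt_eqF.
  rewrite /GRing.scale /=. by field; rewrite Re0 N1.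
Qed.

Lemma clogK (z : R[i]) : 0 < Re z -> cexp (clog z) = z.
Proof.
case: z => a b /= a0.
have N0 : 0 < a ^+ 2 + b ^+ 2 by rewrite ltr_pwDl ?sqr_ge0// exprn_gt0.
have s0 : 0 < Num.sqrt (a ^+ 2 + b ^+ 2) by rewrite sqrtr_gt0.
have hE : expR (ln (a ^+ 2 + b ^+ 2) / 2) = Num.sqrt (a ^+ 2 + b ^+ 2).
  apply/eqP; rewrite -(@eqrXn2 _ 2) ?expR_ge0 ?sqrtr_ge0//.
  rewrite sqr_sqrtr ?ltW// -expRM_natl mulrCA divff ?mulr1 ?lnK ?posrE//.
have hC : cos (atan (b / a)) = a / Num.sqrt (a ^+ 2 + b ^+ 2).
  rewrite cos_atan.
  have -> : 1 + (b / a) ^+ 2 = (a ^+ 2 + b ^+ 2) / a ^+ 2 by field; rewrite gt_eqF.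
  by rewrite sqrtrM ?(ltW N0)// sqrtrV ?sqr_ge0// sqrtr_sqr gtr0_norm// invfM invrK mulrC.
have hS : sin (atan (b / a)) = b / Num.sqrt (a ^+ 2 + b ^+ 2).
  have c0 : cos (atan (b / a)) != 0.
    by rewrite hC mulf_neq0 ?invr_neq0 ?gt_eqF.
  have := atanK (b / a); rewrite /tan => /(congr1 (fun t => t * cos (atan (b / a)))).
  rewrite divfK// => ->; rewrite hC; field.
  by rewrite !gt_eqF.
apply: complexP => /=.
- by rewrite hE hC mulrCA divff ?mulr1// gt_eqF.
- by rewrite hE hS mulrCA divff ?mulr1// gt_eqF.
Qed.

End complex_derivatives.

(** * Power series *)

Section mean_value.
Context {R : realType}.
Implicit Types (F : R -> R[i]) (a b : R).

(* Projecting onto the direction of [F b - F a] reduces to the real case. *)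
Lemma derc_mean_value F (d : R -> R[i]) (G g : R -> R) a b : a <= b ->
  (forall t, a <= t <= b -> derc F t (d t)) ->
  (forall t, a <= t <= b -> is_derive t 1 G (g t)) ->
  (forall t, a <= t <= b -> normc (d t) <= g t) ->
  normc (F b - F a) <= G b - G a.
Proof.
rewrite le_eqVlt => /predU1P[->|ab] dF dG dg; first by rewrite !subrr normc0.
move Ew : (F b - F a) => w; pose n := normc w.
(* The unit vector conjugate to [w], so that [Re (c * w) = normc w]. For [w = 0] the inverse of 0 is
   0, and [c = 0] still satisfies this. *)
pose c := conjc w * (n^-1)%:C.
have cw : Re (c * w) = n.
  rewrite /c /n; case: w {Ew n c} => u v; rewrite /normc /=.
  set s := Num.sqrt _.
  have ss : s ^+ 2 = u ^+ 2 + v ^+ 2 by rewrite sqr_sqrtr// addr_ge0 ?sqr_ge0.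
  have [s0|s0] := eqVneq s 0.
    have := ss; rewrite s0 expr0n/= => /esym/eqP; rewrite paddr_eq0 ?sqr_ge0//.
    by rewrite !sqrf_eq0 => /andP[/eqP -> /eqP ->]; ring.
  by apply: (mulfI s0); rewrite -expr2 ss; field.
have c1 : normc c <= 1.
  rewrite normcM normc_conj -/n normc_real ger0_norm ?invr_ge0 ?normc_ge0//.
  by have [->|n0] := eqVneq n 0; rewrite ?mul0r// divff.
pose phi t := Re (c * F t) - G t.
have dphi t : t \in `]a, b[ -> is_derive t 1 phi (Re (c * d t) - g t).
  rewrite in_itv /= => /andP[at_ tb].
  have tab : a <= t <= b by rewrite !ltW.
  by have [h _] := dercZ c (dF _ tab); exact: (is_deriveB h (dG _ tab)).
have cphi : {within `[a, b], continuous phi}.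
  apply: derivable_within_continuous => t; rewrite in_itv /= => tab.
  have [h _] := dercZ c (dF _ tab).
  by have [] := is_deriveB h (dG _ tab).
have [t tab e] := MVT ab dphi cphi.
have : phi b - phi a <= 0.
  rewrite e mulr_le0_ge0 ?subr_ge0 ?(ltW ab)// subr_le0.
  move: tab; rewrite in_itv/= => /andP[at_ tb].
  apply: le_trans (dg t _); last by rewrite !ltW.
  apply: le_trans (ler_norm _) _; apply: le_trans (ler_normc_Re _) _.
  by rewrite normcM ler_piMl ?normc_ge0.
rewrite -/n -cw -Ew /phi mulrDr ReD mulrN.
by case: (c * F b) (c * F a) => p q [p' q'] /=; lra.
Qed.

Lemma derc0_cst F a b : (forall t, a < t < b -> derc F t 0) ->
  forall s t, a < s < b -> a < t < b -> F s = F t.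
Proof.
move=> dF.
suff H s t : a < s < b -> a < t < b -> s <= t -> F s = F t.
  move=> s t hs ht; have [st|ts] := leP s t; first exact: H.
  by symmetry; apply: H => //; exact: ltW.
move=> /andP[as_ sb] /andP[at_ tb] st; apply/eqP; rewrite eq_sym -subr_eq0 -normc_eq0.
rewrite eq_le normc_ge0 andbT -[0](subrr (0 : R)).
apply: (@derc_mean_value F (fun=> 0) (cst 0) (cst 0)) => // r /andP[sr rt].
- by apply: dF; rewrite (lt_le_trans as_ sr) (le_lt_trans rt tb).
- by rewrite normc0.
Qed.

Lemma near_oo (a b x : R) : a < x < b -> \forall t \near x, a < t < b.
Proof.
move=> /andP[ax xb]; near=> t; apply/andP; split.
- by near: t; exact: lt_nbhsr.
- by near: t; exact: lt_nbhsl.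
Unshelve. all: by end_near. Qed.

End mean_value.

(** * Complex power series on the unit interval and Abel's theorem *)

Section complex_power_series.
Context {R : realType}.
Implicit Types (a b : nat -> R[i]) (r : R).

(* The radius of convergence is at least 1. *)
Definition tempered a := forall r, 0 < r < 1 ->
  exists M, forall l, normc (a l) * r ^+ l <= M.

Definition cps a r : R[i] :=
  limn (pseries (fun l => Re (a l)) r) +i*
  limn (pseries (fun l => Im (a l)) r).

Lemma bounded_tempered a M : (forall l, normc (a l) <= M) -> tempered a.
Proof.
move=> h r /andP[r0 r1]; exists M => l.
apply: le_trans (h l); rewrite ler_piMr ?normc_ge0//.
by rewrite exprn_ile1// ltW.
Qed.

Lemma bernoulli (h : R) n : 0 <= h -> 1 + n%:R * h <= (1 + h) ^+ n.
Proof.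
move=> h0; elim: n => [|n IH]; first by rewrite mul0r addr0 expr0.
rewrite exprS; apply: le_trans (_ : (1 + h) * (1 + n%:R * h) <= _).
  rewrite -natr1; have : 0 <= n%:R * h * h by rewrite !mulr_ge0.
  by lra.
by rewrite ler_wpM2l// addr_ge0.
Qed.

(** Writing [q = 1 / (1 + h)], Bernoulli's inequality bounds [q^l] by [1 / (1 + l h)], and
    [(1 + 1 / h) (1 + l h)] exceeds [l + 1]. *)
Lemma natr_geometric_bounded (q : R) : 0 < q < 1 ->
  exists M, forall l, l.+1%:R * q ^+ l <= M.
Proof.
move=> /andP[q0 q1]; pose h := q^-1 - 1.
have h0 : 0 < h by rewrite subr_gt0 invf_gt1.
have q1h : q = (1 + h)^-1 by rewrite /h addrC subrK invrK.
exists (1 + h^-1) => l; rewrite q1h exprVn ler_pdivrMr; last first.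
  by rewrite exprn_gt0// ltr_wpDr// ltW.
have := @bernoulli h l (ltW h0) => B.
apply: le_trans (_ : (1 + h^-1) * (1 + l%:R * h) <= _); last first.
  by rewrite ler_wpM2l// addr_ge0// invr_ge0 ltW.
have -> : (1 + h^-1) * (1 + l%:R * h) = 1 + l%:R * h + h^-1 + l%:R.
  by field; rewrite gt_eqF.
rewrite -natr1.
have : 0 <= l%:R * h by rewrite mulr_ge0// ltW.
have : 0 <= h^-1 by rewrite invr_ge0 ltW.
by lra.
Qed.

Lemma tempered_shift a : tempered a -> tempered (fun l => a l.+1).
Proof.
move=> h r r01; have [M hM] := h r r01; exists (M / r) => l.
case/andP: r01 => r0 r1.
by rewrite ler_pdivlMr// -mulrA -exprSr.
Qed.

(** Temperedness at a radius [s] strictly between [r] and 1 leaves a factor [(r / s)^l], which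
    absorbs [l + 1]. Hence formal derivatives stay tempered. *)
Lemma temperedM_nat a : tempered a -> tempered (fun l => l.+1%:R * a l).
Proof.
move=> h r /andP[r0 r1]; pose s := (r + 1) / 2.
have [s0 rs s1] : [/\ 0 < s, r < s & s < 1] by rewrite /s; split; lra.
have [|M hM] := h s; first by rewrite s0.
have [|N hN] := @natr_geometric_bounded (r / s).
  by rewrite divr_gt0//= ltr_pdivrMr// mul1r.
exists (N * M) => l.
rewrite normcM -(rmorph_nat (real_complex R)) normc_real normr_nat.
have -> : l.+1%:R * normc (a l) * r ^+ l =
    (l.+1%:R * (r / s) ^+ l) * (normc (a l) * s ^+ l).
  by rewrite expr_div_n; field; rewrite expf_neq0// gt_eqF.
apply: ler_pM => //.
- by rewrite mulr_ge0// exprn_ge0// divr_ge0// ltW.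
- by rewrite mulr_ge0 ?normc_ge0// exprn_ge0// ltW.
Qed.

Lemma tempered_diffs a : tempered a -> tempered (fun l => l.+1%:R * a l.+1).
Proof. by move=> /tempered_shift /temperedM_nat. Qed.

Lemma real_tempered_cvg (u : nat -> R) a r : tempered a ->
  (forall l, `|u l| <= normc (a l)) -> 0 < r < 1 -> cvgn (pseries u r).
Proof.
move=> h ua /andP[r0 r1]; pose s := (r + 1) / 2.
have [s0 rs s1] : [/\ 0 < s, r < s & s < 1] by rewrite /s; split; lra.
have [|M hM] := h s; first by rewrite s0.
apply: normed_cvg.
have M0 : 0 <= M by apply: le_trans (hM 0); rewrite expr0 mulr1 normc_ge0.
apply: (@series_le_cvg _ _ (geometric M (r / s))) => [l|l|l|].
- exact: normr_ge0.
- by rewrite /geometric /= mulr_ge0// exprn_ge0// divr_ge0// ltW.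
- rewrite /geometric /= normrM normrX (gtr0_norm r0).
  apply: le_trans (_ : normc (a l) * r ^+ l <= _).
    by rewrite ler_wpM2r// exprn_ge0// ltW.
  have -> : normc (a l) * r ^+ l = (normc (a l) * s ^+ l) * (r / s) ^+ l.
    by rewrite -mulrA -exprMn mulrCA divff ?mulr1// gt_eqF.
  by rewrite ler_wpM2r// exprn_ge0// divr_ge0// ltW.
- apply: is_cvg_geometric_series.
  by rewrite ger0_norm ?ltr_pdivrMr ?mul1r// divr_ge0// ltW.
Qed.

Lemma cvg_cps a r : tempered a -> 0 < r < 1 ->
  cvgc \oo (fun n => \sum_(0 <= l < n) a l * r%:C ^+ l) (cps a r).
Proof.
move=> ta r01; split => /=.
- suff -> : (fun n => Re (\sum_(0 <= l < n) a l * r%:C ^+ l)) =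
            pseries (fun l => Re (a l)) r.
    by apply: (real_tempered_cvg ta) => // l; exact: ler_normc_Re.
  apply/funext => n; rewrite Re_sum; apply: eq_bigr => l _.
  by rewrite -rmorphXn ReM /= mulr0 subr0.
- suff -> : (fun n => Im (\sum_(0 <= l < n) a l * r%:C ^+ l)) =
            pseries (fun l => Im (a l)) r.
    by apply: (real_tempered_cvg ta) => // l; exact: ler_normc_Im.
  apply/funext => n; rewrite Im_sum; apply: eq_bigr => l _.
  by rewrite -rmorphXn ImM /= mulr0 add0r.
Qed.

(** Termwise differentiation rests on the convergence, at some radius [s > r], of the series and of
    its first two formal derivatives, all of which are tempered. *)
Lemma derc_cps a r : tempered a -> 0 < r < 1 ->
  derc (cps a) r (cps (fun l => l.+1%:R * a l.+1) r).
Proof.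
move=> ta /andP[r0 r1]; pose s := (r + 1) / 2.
have [s0 rs s1] : [/\ 0 < s, r < s & s < 1] by rewrite /s; split; lra.
have s01 : 0 < s < 1 by rewrite s0.
have rs' : `|r| < `|s| by rewrite !gtr0_norm.
have hRe l (z : R[i]) : Re (l%:R * z) = l%:R * Re z.
  by rewrite -(rmorph_nat (real_complex R)) ReM /= mul0r subr0.
have hIm l (z : R[i]) : Im (l%:R * z) = l%:R * Im z.
  by rewrite -(rmorph_nat (real_complex R)) ImM /= mul0r addr0.
have ta1 := tempered_diffs ta; have ta2 := tempered_diffs ta1.
split => /=.
- under [X in pseries X _]eq_fun do rewrite hRe.
  apply: (@pseries_snd_diffs _ _ s) => //.
  + by apply: (real_tempered_cvg ta) => // l; exact: ler_normc_Re.
  + by apply: (real_tempered_cvg ta1) => // l; rewrite /pseries_diffs -hRe ler_normc_Re.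
  + by apply: (real_tempered_cvg ta2) => // l; rewrite /pseries_diffs -!hRe ler_normc_Re.
- under [X in pseries X _]eq_fun do rewrite hIm.
  apply: (@pseries_snd_diffs _ _ s) => //.
  + by apply: (real_tempered_cvg ta) => // l; exact: ler_normc_Im.
  + by apply: (real_tempered_cvg ta1) => // l; rewrite /pseries_diffs -hIm ler_normc_Im.
  + by apply: (real_tempered_cvg ta2) => // l; rewrite /pseries_diffs -!hIm ler_normc_Im.
Qed.

Lemma cvgc_normc_le (f : nat -> R[i]) z M : cvgc \oo f z ->
  (forall n, normc (f n) <= M) -> normc z <= M.
Proof.
move=> /cvgc_normc h fM; apply/ler_addgt0Pl => e e0.
have /cvgrPdist_lt/(_ e e0)[N _ hN] := h.
have := hN N (leqnn N); rewrite /= sub0r normrN ger0_norm ?normc_ge0// => hlt.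
apply: le_trans (_ : normc (z - f N) + normc (f N) <= _).
  by rewrite -{1}(subrK (f N) z) le_normcD.
by rewrite lerD// normcB ltW.
Qed.

Lemma sum_geometric_le r n : 0 <= r < 1 -> \sum_(0 <= l < n) r ^+ l <= (1 - r)^-1.
Proof.
move=> /andP[r0 r1]; have h : 0 < 1 - r by rewrite subr_gt0.
rewrite -[leRHS]mul1r ler_pdivlMr// mulrC.
suff -> : (1 - r) * \sum_(0 <= l < n) r ^+ l = 1 - r ^+ n.
  by rewrite gerBl exprn_ge0.
by rewrite big_mkord -opprB mulNr -subrX1 opprB.
Qed.

Lemma normc_cps_le a r M : (forall l, normc (a l) <= M) -> 0 < r < 1 ->
  normc (cps a r) <= M / (1 - r).
Proof.
move=> aM /andP[r0 r1].
have M0 : 0 <= M by apply: le_trans (aM 0); exact: normc_ge0.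
apply: cvgc_normc_le (cvg_cps (bounded_tempered aM) _) _ => [|n]; first by rewrite r0.
apply: le_trans (ler_normc_sum _ _ _) _.
apply: le_trans (_ : \sum_(0 <= l < n) M * r ^+ l <= _).
  apply: ler_sum => l _; rewrite normcM -rmorphXn normc_real.
  by rewrite ger0_norm ?exprn_ge0 ?(ltW r0)// ler_wpM2r ?exprn_ge0 ?(ltW r0).
by rewrite -mulr_sumr ler_wpM2l// sum_geometric_le// ltW.
Qed.

Lemma cvgc_shiftS (f : nat -> R[i]) z : cvgc \oo f z ->
  cvgc \oo (fun n => f n.+1) z.
Proof.
move=> [h1 h2]; split.
- by have := cvg_shiftS (fun n => Re (f n)) (nbhs (Re z)); rewrite /mk_sequence => ->.
- by have := cvg_shiftS (fun n => Im (f n)) (nbhs (Im z)); rewrite /mk_sequence => ->.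
Qed.

Lemma cps_shift a r : tempered a -> 0 < r < 1 ->
  cps a r = a 0%N + r%:C * cps (fun l => a l.+1) r.
Proof.
move=> ta r01; have h := cvg_cps ta r01.
have h' : cvgc \oo (fun n => \sum_(0 <= l < n.+1) a l * r%:C ^+ l) (cps a r).
  exact: cvgc_shiftS h.
apply: (cvgc_unique h'); apply: near_eq_cvgc; last first.
  by apply: cvgcD; [exact: cvgc_cst|apply: cvgcZ; exact: cvg_cps (tempered_shift ta) r01].
apply: nearW => n; rewrite big_nat_recl//= expr0 mulr1 mulr_sumr; congr (_ + _).
by apply: eq_bigr => l _; rewrite exprS mulrCA.
Qed.

Lemma temperedZ a c : tempered a -> tempered (fun l => c * a l).
Proof.
move=> ta r r01; have [M hM] := ta r r01; exists (normc c * M) => l.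
by rewrite normcM -mulrA ler_wpM2l ?normc_ge0.
Qed.

Lemma temperedD a b : tempered a -> tempered b -> tempered (fun l => a l + b l).
Proof.
move=> ta tb r r01; have [M hM] := ta r r01; have [N hN] := tb r r01.
exists (M + N) => l; apply: le_trans (lerD (hM l) (hN l)).
by rewrite -mulrDl ler_wpM2r ?le_normcD// exprn_ge0//; case/andP: r01 => /ltW.
Qed.

Lemma cpsZ c a r : tempered a -> 0 < r < 1 -> cps (fun l => c * a l) r = c * cps a r.
Proof.
move=> ta r01; apply: (cvgc_unique (cvg_cps (temperedZ c ta) r01)).
apply: near_eq_cvgc (cvgcZ c (cvg_cps ta r01)).
by apply: nearW => n; rewrite mulr_sumr; apply: eq_bigr => l _; rewrite mulrA.
Qed.

Lemma cpsD a b r : tempered a -> tempered b -> 0 < r < 1 ->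
  cps (fun l => a l + b l) r = cps a r + cps b r.
Proof.
move=> ta tb r01; apply: (cvgc_unique (cvg_cps (temperedD ta tb) r01)).
apply: near_eq_cvgc (cvgcD (cvg_cps ta r01) (cvg_cps tb r01)).
by apply: nearW => n; rewrite -big_split; apply: eq_bigr => l _; rewrite mulrDl.
Qed.

Lemma sum_if_ltn_le (M : R) N n : 0 <= M ->
  \sum_(0 <= l < n) (if (l < N)%N then M else 0) <= N%:R * M.
Proof.
move=> M0; have -> : \sum_(0 <= l < n) (if (l < N)%N then M else 0) = (minn n N)%:R * M.
  elim: n => [|n IH]; first by rewrite big_nil min0n mul0r.
  rewrite big_nat_recr //= IH; case: ltnP => h; rewrite ?(minn_idPl (ltnW h)).
    by rewrite (minn_idPl h) -natr1 mulrDl mul1r.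
  by rewrite (minn_idPr (leqW h)) addr0.
by rewrite ler_wpM2r// ler_nat geq_minr.
Qed.

(* Abel's theorem, from [f r - S = (1 - r) * sum_l (s_(l+1) - S) r^l]. *)
Lemma abel a S : tempered a -> cvgc \oo (fun n => \sum_(0 <= l < n) a l) S ->
  cvgc (1 : R)^'- (cps a) S.
Proof.
move=> ta sS; pose s l := \sum_(0 <= j < l.+1) a j; pose b l := s l - S.
have [M hM] : exists M, forall l, normc (b l) <= M.
  have /cvgc_shiftS/cvgc_normc h := sS.
  have /cvg_seq_bounded[M [_ hM]] : cvgn (fun n => normc (b n)) by apply/cvg_ex; exists 0.
  exists (M + 1) => l; have := hM (M + 1) _ l I.
  by rewrite /= ger0_norm ?normc_ge0 //; apply; rewrite ltrDl.
have tb : tempered b by exact: bounded_tempered hM.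
have key r : 0 < r < 1 -> cps a r - S = (1 - r)%:C * cps b r.
  move=> r01; have bS l : b l.+1 - b l = a l.+1.
    by rewrite /b /s [in X in X - _]big_nat_recr //=; ring.
  have e1 := cps_shift tb r01; have e2 := cps_shift ta r01.
  have e3 : cps (fun l => a l.+1) r = cps (fun l => b l.+1) r - cps b r.
    have := @cpsD (fun l => b l.+1) (fun l => (-1) * b l) r (tempered_shift tb)
       (temperedZ (-1) tb) r01.
    rewrite cpsZ// mulN1r => <-; congr (cps _ r); apply/funext => l.
    by rewrite mulN1r bS.
  have b0 : b 0%N = a 0%N - S by rewrite /b /s big_nat1.
  rewrite rmorphB rmorph1 mulrBl mul1r {1}e1 b0 e2 e3; ring.
apply/cvgc_normc/cvgrPdist_lt => e e0.
have e2 : 0 < e / 2 by rewrite divr_gt0.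
have /cvgc_shiftS/cvgc_normc/cvgrPdist_lt/(_ _ e2)[N _ hN] := sS.
have M0 : 0 <= M by apply: le_trans (hM 0); exact: normc_ge0.
(* The first [N] terms are bounded by [M] and contribute [O(1 - r)]; the others are at most [e / 2]
   times a geometric series, whose sum the factor [1 - r] cancels. *)
have bound r : 0 < r < 1 -> normc (cps a r - S) <= (1 - r) * (N%:R * M) + e / 2.
  move=> r01; have /andP[r0 r1] := r01.
  rewrite key// normcM normc_real gtr0_norm ?subr_gt0//.
  rewrite -ler_pdivlMl ?subr_gt0// mulrDr mulrA mulVf ?gt_eqF ?subr_gt0// mul1r.
  apply: cvgc_normc_le (cvg_cps tb r01) _ => n.
  apply: le_trans (ler_normc_sum _ _ _) _.
  apply: le_trans (_ : \sum_(0 <= l < n) ((if (l < N)%N then M else 0) + e / 2 * r ^+ l) <= _).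
    apply: ler_sum => l _; rewrite normcM -rmorphXn normc_real.
    have rl0 : 0 <= r ^+ l by rewrite exprn_ge0// ltW.
    rewrite ger0_norm//; case: ltnP => lN.
      apply: le_trans (_ : M + 0 <= _); last by rewrite lerD2l mulr_ge0// ltW.
      rewrite addr0 -[leRHS]mulr1; apply: ler_pM => //; first exact: normc_ge0.
      by rewrite exprn_ile1// ltW.
    rewrite add0r ler_wpM2r//; apply: ltW; have := hN l lN.
    by rewrite /= sub0r normrN ger0_norm ?normc_ge0.
  rewrite big_split /=; apply: lerD; last first.
    by rewrite -mulr_sumr mulrC ler_wpM2r ?(ltW e2)// sum_geometric_le// ltW.
  exact: sum_if_ltn_le.
have NM : 0 < N%:R * M + 1 by rewrite ltr_wpDl// mulr_ge0.
near=> r.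
have r01 : 0 < r < 1 by apply/andP; split; near: r; [exact: nbhs_left_gt|exact: nbhs_left_lt].
rewrite sub0r normrN ger0_norm ?normc_ge0//.
apply: le_lt_trans (bound r r01) _.
suff h : (1 - r) * (N%:R * M) < e / 2 by rewrite {2}(splitr e) ltrD2r.
apply: le_lt_trans (_ : (1 - r) * (N%:R * M + 1) < _).
  by rewrite ler_wpM2l ?lerDl// subr_ge0 ltW//; case/andP: r01.
rewrite -ltr_pdivlMr// ltrBlDr -ltrBlDl.
near: r; apply: nbhs_left_gt.
by rewrite gtrBl !divr_gt0.
Unshelve. all: by end_near. Qed.

End complex_power_series.

(** * Iterated integrals *)

Section words.
Context {R : realType}.
Implicit Types (r t : R) (l m n j : nat) (W : seq (option nat)).

Definition zeta : R[i] := (- (1 / 2)) +i* (Num.sqrt 3 / 2).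

Lemma zeta_quad : zeta ^+ 2 + zeta + 1 = 0.
Proof.
have h : Num.sqrt 3 ^+ 2 = 3 :> R by rewrite sqr_sqrtr.
apply: complexP; rewrite /zeta expr2 /=.
- have -> : - (1 / 2) * - (1 / 2) - Num.sqrt 3 / 2 * (Num.sqrt 3 / 2) + - (1 / 2) + 1 =
    3 / 4 - Num.sqrt 3 ^+ 2 / 4 :> R by field.
  by rewrite h subrr.
- by field.
Qed.

Lemma zeta3 : zeta ^+ 3 = 1.
Proof.
have h := zeta_quad.
have -> : zeta ^+ 3 = (zeta - 1) * (zeta ^+ 2 + zeta + 1) + 1 by ring.
by rewrite h mulr0 add0r.
Qed.

Lemma zeta_sqr : zeta ^+ 2 = - zeta - 1.
Proof.
have h := zeta_quad; rewrite -[LHS]subr0 -h; ring.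
Qed.

Lemma zeta_conj : conjc zeta = zeta ^+ 2.
Proof.
by rewrite zeta_sqr; apply: complexP; rewrite /zeta /=; field.
Qed.

Lemma normc_zeta : normc zeta = 1.
Proof.
apply/eqP; rewrite -(@eqrXn2 _ 3) ?normc_ge0 ?ler01//.
by rewrite -normcX zeta3 normc1 expr1n.
Qed.

Lemma normc_zetaX j : normc (zeta ^+ j) = 1.
Proof. by rewrite normcX normc_zeta expr1n. Qed.

Lemma zetaX_mod j : zeta ^+ j = zeta ^+ (j %% 3).
Proof. by rewrite {1}(divn_eq j 3) exprD mulnC exprM zeta3 expr1n mul1r. Qed.

Lemma zetaX_dvd j : (3 %| j)%N -> zeta ^+ j = 1.
Proof. by rewrite zetaX_mod => /eqP ->; rewrite expr0. Qed.

Lemma Re_zetaX j : ~~ (3 %| j)%N -> Re (zeta ^+ j) = - (1 / 2).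
Proof.
rewrite zetaX_mod /dvdn; have := ltn_pmod j (isT : 0 < 3)%N.
case: (j %% 3)%N => [|[|[|]]]// _ _.
by rewrite -zeta_conj.
Qed.

Lemma zetaX_neq1 j : ~~ (3 %| j)%N -> zeta ^+ j != 1.
Proof.
move=> /Re_zetaX h; apply/eqP => e; move: h; rewrite e /= => h.
suff : (1 : R) = 0 by move/eqP; rewrite oner_eq0.
by lra.
Qed.

Lemma zetaX_conj j : conjc (zeta ^+ j) = zeta ^+ (2 * j).
Proof.
elim: j => [|j IH]; first by rewrite muln0 !expr0 rmorph1.
by rewrite exprS conjcM zeta_conj IH mulnS exprD.
Qed.

Lemma one_sub_zetaX_neq0 j r : 0 <= r < 1 -> 1 - zeta ^+ j * r%:C != 0.
Proof.
move=> /andP[r0 r1]; rewrite subr_eq0; apply/eqP => e.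
have : normc (zeta ^+ j * r%:C) = 1 by rewrite -e normc1.
rewrite normcM normc_zetaX mul1r normc_real ger0_norm// => h.
by move: r1; rewrite h ltxx.
Qed.

Definition letter_form (a : option nat) r : R[i] :=
  if a is Some j then zeta ^+ j / (1 - zeta ^+ j * r%:C) else (r%:C)^-1.

(* [None] encodes the form [dr/r], [Some j] the form [zeta^j dr/(1 - zeta^j r)];
   [coef W] are the Taylor coefficients of the iterated integral of [W]
   (outermost letter first), which is meaningful when [W] does not end in [None]. *)
Fixpoint coef W l : R[i] :=
  if W is a :: W' then
    if l == 0%N then 0 else
    match a with
    | None => coef W' l
    | Some j => \sum_(0 <= m < l) zeta ^+ (j * (l - m)) * coef W' m
    end / l%:R
  else (l == 0%N)%:R.

Definition iint W r : R[i] := cps (coef W) r.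

(** Integration starts at [r = 0], where [dr/r] must not be the innermost form. The default [Some 0]
    of [last] makes the empty word convergent. *)
Definition conv_word W := last (Some 0%N) W != None.

(** Convergence at [r = 1] as well: the outermost form must not be [dr/(1 - r)], which every index
    divisible by 3 encodes. The empty word, of value 1 and weight 0, is left to [wvals1]. *)
Definition adm W := conv_word W &&
  match W with
  | [::] => false
  | Some j :: _ => ~~ (3 %| j)%N
  | None :: _ => true
  end.

Lemma conv_word_tail a W : conv_word (a :: W) -> conv_word W.
Proof. by case: W. Qed.

Lemma coef_cons0 a W : coef (a :: W) 0 = 0. Proof. by []. Qed.

Lemma normc_natr l : normc (l%:R : R[i]) = l%:R.
Proof. by rewrite -(rmorph_nat (real_complex R)) normc_real normr_nat. Qed.

(** By induction: a coefficient is [1 / l] times a sum of at most [l] terms of modulus at most 1. *)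
Lemma coef_le1 W l : normc (coef W l) <= 1.
Proof.
elim: W l => [l|a W IH l] /=; first by case: eqP => _; rewrite ?normc1// normc0.
case: eqP => [|/eqP l0]; first by rewrite normc0.
rewrite normcM normcV normc_natr ler_pdivrMr ?mul1r ?ltr0n ?lt0n//.
case: a => [j|]; last by apply: le_trans (IH l) _; rewrite ler1n lt0n.
apply: le_trans (ler_normc_sum _ _ _) _.
apply: le_trans (_ : \sum_(0 <= m < l) 1 <= _).
  by apply: ler_sum => m _; rewrite normcM normc_zetaX mul1r.
by rewrite sumr_const_nat subn0.
Qed.

Lemma tempered_coef W : tempered (coef W).
Proof. exact: bounded_tempered (coef_le1 W). Qed.

Lemma cps0 r : 0 < r < 1 -> cps (fun=> 0 : R[i]) r = 0.
Proof.
move=> r01; apply/eqP; rewrite -normc_eq0 eq_le normc_ge0 andbT.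
rewrite -[leRHS](mul0r ((1 - r)^-1)).
by apply: normc_cps_le => // _; rewrite normc0.
Qed.

Lemma iint_nil r : 0 < r < 1 -> iint [::] r = 1.
Proof.
move=> r01; rewrite /iint cps_shift//; last exact: tempered_coef.
by rewrite /= (cps0 r01) mulr0 addr0.
Qed.

(** For a letter [Some j] the coefficients [d l] of the derivative satisfy [d (l + 1) = zeta^j (d l
    + coef W (l + 1))], which is the equation [(1 - zeta^j r) D = zeta^j iint W] read on
    coefficients. For [None], division by [r] is possible because the remaining word is not empty
    and so has constant term 0. *)
Lemma derc_iint a W r : conv_word (a :: W) -> 0 < r < 1 ->
  derc (iint (a :: W)) r (letter_form a r * iint W r).
Proof.
move=> aW r01; apply: derc_eq (derc_cps (tempered_coef _) r01).
have /andP[r0 r1] := r01.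
have rC0 : r%:C != 0 by rewrite (inj_eq (@complexI R)) gt_eqF.
case: a aW => [j|] aW; last first.
  have -> : (fun l => l.+1%:R * coef (None :: W) l.+1) = (fun l => coef W l.+1).
    by apply/funext => l /=; rewrite mulrCA divff ?mulr1// pnatr_eq0.
  rewrite /letter_form /iint [in RHS]cps_shift//; last exact: tempered_coef.
  by case: W aW => // b W _; rewrite coef_cons0 add0r mulKf.
pose d l := l.+1%:R * coef (Some j :: W) l.+1.
have dE l : d l = \sum_(0 <= m < l.+1) zeta ^+ (j * (l.+1 - m)) * coef W m.
  by rewrite /d /= mulrCA divff ?mulr1// pnatr_eq0.
have d0 : d 0%N = zeta ^+ j * coef W 0 by rewrite dE big_nat1 subn0 muln1.
have dS l : d l.+1 = zeta ^+ j * (d l + coef W l.+1).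
  rewrite !dE big_nat_recr //= subSnn muln1 mulrDr; congr (_ + _).
  rewrite big_distrr /= big_nat_cond [RHS]big_nat_cond; apply: eq_bigr => m /andP[/andP[_ ml] _].
  by rewrite mulrA -exprD -mulnS -subSn// ltnW.
have td : tempered d by exact: tempered_diffs (tempered_coef _).
have tW := tempered_coef W; have tW1 := tempered_shift tW.
have e : cps d r = zeta ^+ j * (coef W 0 + r%:C * (cps d r + cps (fun l => coef W l.+1) r)).
  rewrite {1}(cps_shift td r01) d0 mulrDr; congr (_ + _).
  have -> : (fun l => d l.+1) = (fun l => zeta ^+ j * (d l + coef W l.+1)).
    by apply/funext => l; rewrite dS.
  by rewrite (cpsZ _ (temperedD td tW1) r01) (cpsD td tW1 r01) mulrCA.
have nz := @one_sub_zetaX_neq0 j r; rewrite ltW//= in nz.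
rewrite /letter_form /iint (cps_shift tW r01) -/d.
set x := cps d r in e *; set y := cps _ r in e *.
apply: (mulfI (nz r1)); rewrite mulrA mulrCA divff ?mulr1 ?(nz r1)//.
by rewrite mulrBl mul1r {1}e; ring.
Qed.

Lemma iint_le a W r : 0 < r < 1 -> normc (iint (a :: W) r) <= r / (1 - r).
Proof.
move=> r01; have /andP[r0 r1] := r01.
rewrite /iint (cps_shift (tempered_coef _) r01) coef_cons0 add0r normcM normc_real gtr0_norm//.
rewrite ler_wpM2l// ?(ltW r0)//.
by rewrite -[leRHS]mul1r; apply: normc_cps_le => // l; exact: coef_le1.
Qed.

Lemma iint_cvg0 a W : cvgc (0 : R)^'+ (iint (a :: W)) 0.
Proof.
apply: (@cvgc_le _ _ _ _ _ _ (fun r => 2 * r)).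
  near=> r; rewrite subr0; apply: le_trans (iint_le _ _ _) _.
    by apply/andP; split; near: r; [exact: nbhs_right_gt|exact: nbhs_right_lt].
  have r0 : 0 < r by near: r; exact: nbhs_right_gt.
  have r2 : r < 2^-1 by near: r; apply: nbhs_right_lt; rewrite invr_gt0.
  rewrite mulrC ler_pdivrMl; last by lra.
  have : 0 <= r * (1 - 2 * r) by rewrite mulr_ge0//; lra.
  by lra.
apply: cvg_at_right_filter.
by rewrite -[X in _ --> X](mulr0 2); apply: cvgM; [exact: cvg_cst|exact: cvg_id].
Unshelve. all: by end_near. Qed.

(** Nonnegative on [[0, 1[]. Real powers [(1 - r)^(- d)] are written [expR (d * mlog r)] in the
    estimates at 1. *)
Definition mlog r : R := - ln (1 - r).

Lemma is_derive_mlog t : t < 1 -> is_derive t 1 mlog (1 - t)^-1.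
Proof.
move=> t1; have h : 0 < 1 - t by rewrite subr_gt0.
have d1 : is_derive t 1 (fun s : R => 1 - s) (-1).
  have := is_deriveB (is_derive_cst (1 : R) t 1) (is_derive_id t (1 : R)).
  by rewrite sub0r.
have := is_deriveN (@is_derive1_comp _ (@ln R) (fun s => 1 - s) _ _ _ (is_derive1_ln h) d1).
by rewrite mulrN1 opprK.
Qed.

Lemma expR_mlog r : r < 1 -> expR (mlog r) = (1 - r)^-1.
Proof. by move=> r1; rewrite /mlog expRN lnK// posrE subr_gt0. Qed.

Lemma mlog_ge0 r : 0 <= r < 1 -> 0 <= mlog r.
Proof.
move=> /andP[r0 r1]; rewrite /mlog oppr_ge0 ln_le0//.
by rewrite gerBl.
Qed.

Lemma is_derive_expmlog (c : R) t : t < 1 ->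
  is_derive t 1 (fun s => expR (c * mlog s)) (c * expR (c * mlog t) / (1 - t)).
Proof.
move=> t1; have d := is_deriveZ c (is_derive_mlog t1).
apply: (is_derive_eq (@is_derive1_comp _ (@expR R) (fun s => c * mlog s) _ _ _
  (is_derive_expR _) d)).
by rewrite /GRing.scale /=; ring.
Qed.

Lemma letter_form_le a t : 1 / 2 <= t < 1 -> normc (letter_form a t) <= 2 / (1 - t).
Proof.
move=> /andP[t2 t1]; have h : 0 < 1 - t by rewrite subr_gt0.
case: a => [j|] /=.
  rewrite normcM normc_zetaX mul1r normcV.
  apply: le_trans (_ : (1 - t)^-1 <= _).
    rewrite lef_pV2 ?posrE//; last first.
      by rewrite lt_def normc_ge0 normc_eq0 one_sub_zetaX_neq0 ?andbT//; lra.
    have : normc (1 : R[i]) <= normc (1 - zeta ^+ j * t%:C) + normc (zeta ^+ j * t%:C).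
      by rewrite -{1}(subrK (zeta ^+ j * t%:C) 1) le_normcD.
    rewrite normc1 normcM normc_zetaX mul1r normc_real ger0_norm; last by lra.
    by lra.
  by rewrite ler_peMl ?invr_ge0 ?(ltW h)// ler1n.
rewrite normcV normc_real gtr0_norm; last by lra.
rewrite -[t^-1]mul1r ler_pdivrMr; last by lra.
rewrite mulrAC ler_pdivlMr; last by lra.
by lra.
Qed.

(** A root [zeta^j] other than 1 has real part [- 1/2], so [1 - zeta^j t] keeps real part at least
    1: only the letter [dr/(1 - r)] is singular at 1. *)
Lemma letter_form_bounded a t : 1 / 2 <= t < 1 ->
  (if a is Some j then ~~ (3 %| j)%N else true) -> normc (letter_form a t) <= 2.
Proof.
move=> /andP[t2 t1]; case: a => [j hj|_] /=.
  rewrite normcM normc_zetaX mul1r normcV.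
  apply: le_trans (_ : 1 <= _); last by lra.
  have h : 1 <= normc (1 - zeta ^+ j * t%:C).
    apply: le_trans (ler_normc_Re _); apply: le_trans (ler_norm _).
    have -> : Re (1 - zeta ^+ j * t%:C) = 1 - Re (zeta ^+ j) * t.
      by case: (zeta ^+ j) => u v /=; ring.
    by rewrite Re_zetaX//; lra.
  by rewrite invf_le1// (lt_le_trans _ h).
rewrite normcV normc_real gtr0_norm; last by lra.
by rewrite invf_ple ?posrE//; lra.
Qed.

(** A letter costs [1 / (1 - t)], but integrating [(1 - t)^(- 1 - d)] gives back
    [(1 - t)^(- d) / d]. The arbitrarily small exponent [d] thus survives the induction, and it
    takes the place of powers of the logarithm. *)
Lemma iint_growth W (d : R) : conv_word W -> 0 < d ->
  exists2 C, 0 <= C & forall r, 1 / 2 <= r < 1 -> normc (iint W r) <= C * expR (d * mlog r).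
Proof.
move=> + d0; elim: W => [_|a W IH aW].
  exists 1 => // r r01; rewrite iint_nil; last by lra.
  rewrite normc1 mul1r -[leLHS]expR0 ler_expR mulr_ge0 ?(ltW d0)//.
  by rewrite mlog_ge0//; lra.
have [C C0 hC] := IH (conv_word_tail aW).
exists (normc (iint (a :: W) (1 / 2)) + 2 * C / d).
  by rewrite addr_ge0 ?normc_ge0// divr_ge0 ?mulr_ge0// ltW.
move=> r /andP[r2 r1].
have e1 : 1 <= expR (d * mlog r).
  rewrite -[leLHS]expR0 ler_expR mulr_ge0 ?(ltW d0)// mlog_ge0//; lra.
have : normc (iint (a :: W) r - iint (a :: W) (1 / 2)) <=
    2 * C / d * expR (d * mlog r) - 2 * C / d * expR (d * mlog (1 / 2)).
  apply: (@derc_mean_value R (iint (a :: W)) (fun t => letter_form a t * iint W t)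
    (fun t => 2 * C / d * expR (d * mlog t)) (fun t => 2 * C * expR (d * mlog t) / (1 - t))
    (1 / 2) r r2) => t /andP[t2 t1].
  - by apply: derc_iint => //; lra.
  - have h := is_deriveZ (2 * C / d) (@is_derive_expmlog d t (le_lt_trans t1 r1)).
    by apply: (is_derive_eq h); rewrite /GRing.scale /=; field; rewrite !gt_eqF//; lra.
  - have t1' : 1 / 2 <= t < 1 by rewrite t2 (le_lt_trans t1 r1).
    rewrite normcM mulrAC; have -> : 2 * C / (1 - t) * expR (d * mlog t) =
      (2 / (1 - t)) * (C * expR (d * mlog t)) by ring.
    by apply: ler_pM; rewrite ?normc_ge0 ?letter_form_le ?hC.
move=> h; have := le_normcD (iint (a :: W) r - iint (a :: W) (1 / 2)) (iint (a :: W) (1 / 2)).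
rewrite subrK => /le_trans; apply.
apply: le_trans (lerD h (lexx _)) _.
have h1 : 0 <= 2 * C / d * expR (d * mlog (1 / 2)).
  by rewrite mulr_ge0 ?expR_ge0// divr_ge0 ?mulr_ge0// ltW.
have h2 : normc (iint (a :: W) (1 / 2)) <= normc (iint (a :: W) (1 / 2)) * expR (d * mlog r).
  by rewrite ler_peMr ?normc_ge0.
by lra.
Qed.

End words.

(** * Values of iterated integrals at 1 *)

Section word_values.
Context {R : realType}.
Implicit Types (r t : R) (l m n j : nat) (W : seq (option nat)).

Let sq l : R := Num.sqrt l%:R.

Let sq_gt0 l : 0 < sq l.+1. Proof. by rewrite sqrtr_gt0 ltr0n. Qed.

Let sq_sqr l : sq l ^+ 2 = l%:R. Proof. by rewrite sqr_sqrtr. Qed.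

Let sq_le l m : (l <= m)%N -> sq l <= sq m.
Proof. by move=> lm; rewrite ler_wsqrtr// ler_nat. Qed.

Lemma inv_sqrt_le l : (sq l.+1)^-1 <= 2 * (sq l.+1 - sq l).
Proof.
have s0 := sq_gt0 l; have sl : sq l <= sq l.+1 by exact: sq_le.
have l0 : 0 <= sq l by exact: sqrtr_ge0.
have e : (sq l.+1 - sq l) * (sq l.+1 + sq l) = 1.
  have -> : (sq l.+1 - sq l) * (sq l.+1 + sq l) = sq l.+1 ^+ 2 - sq l ^+ 2 by ring.
  by rewrite !sq_sqr -natr1; ring.
rewrite -[leLHS]mul1r ler_pdivrMr// -[leLHS]e.
have : 0 <= (sq l.+1 - sq l) * (sq l.+1 - sq l) by rewrite mulr_ge0 ?subr_ge0.
by lra.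
Qed.

Lemma sum_inv_sqrt_le n : \sum_(0 <= l < n) (sq l.+1)^-1 <= 2 * sq n.
Proof.
elim: n => [|n IH]; first by rewrite big_nil mulr_ge0// sqrtr_ge0.
rewrite big_nat_recr//=; apply: le_trans (lerD IH (inv_sqrt_le n)) _.
by lra.
Qed.

(** Coefficients are of the size of a power of [log l] over [l]. The weaker bound [C / sqrt l]
    suffices and is easier to propagate, because the sum of [1 / sqrt m] over [m <= l] is at most
    [2 sqrt l]. *)
Lemma coef_sqrt_bound W : exists2 C, 0 <= C & forall l, l%:R * normc (coef W l : R[i]) <= C * sq l.
Proof.
elim: W => [|a W [C C0 hC]].
  exists 0 => // l; rewrite mul0r /=; case: eqP => [->|_]; first by rewrite mul0r.
  by rewrite normc0 mulr0.
have key l : l.+1%:R * normc (coef (a :: W) l.+1 : R[i]) = normc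
    (match a with None => coef W l.+1
     | Some j => \sum_(0 <= m < l.+1) zeta ^+ (j * (l.+1 - m)) * coef W m end : R[i]).
  by rewrite /= normcM normcV normc_natr mulrCA divff ?mulr1// pnatr_eq0.
have s1 l : 1 <= sq l.+1 by rewrite -[leLHS]sqrtr1 ler_wsqrtr// ler1n.
case: a key => [j|] key.
  exists (1 + 2 * C) => [|[|l]]; first by rewrite addr_ge0// mulr_ge0.
    by rewrite mul0r mulr_ge0 ?sqrtr_ge0// addr_ge0// mulr_ge0.
  rewrite key; apply: le_trans (ler_normc_sum _ _ _) _.
  rewrite big_nat_recl//= mulrDl mul1r; apply: lerD.
    by rewrite normcM normc_zetaX mul1r (le_trans (coef_le1 _ _))// s1.
  apply: le_trans (_ : \sum_(0 <= i < l) C * (sq i.+1)^-1 <= _).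
    apply: ler_sum => i _; rewrite normcM normc_zetaX mul1r.
    rewrite -(@ler_pM2l _ i.+1%:R) ?ltr0n//; apply: le_trans (hC _) _.
    rewrite -(sq_sqr i.+1) expr2 mulrCA -mulrA divff ?mulr1// gt_eqF//.
  rewrite -mulr_sumr -mulrA mulrCA ler_wpM2l//.
  by apply: le_trans (sum_inv_sqrt_le l) _; rewrite ler_wpM2l// sq_le.
exists 1 => // -[|l]; first by rewrite !mul0r mul1r sqrtr_ge0.
by rewrite key mul1r (le_trans (coef_le1 _ _))// s1.
Qed.

(** Comparison with [l^(- 3/2)], whose terms are bounded by twice the telescoping differences of
    [1 / sqrt l]; this is where the total [3 C] comes from. *)
Lemma summable_sqrt (u : nat -> R[i]) C :
  (forall l, normc (u l) <= C / (l.+1%:R * sq l.+1)) ->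
  exists S, cvgc \oo (fun n => \sum_(0 <= l < n) u l) S.
Proof.
move=> hu.
have C0 : 0 <= C.
  have := le_trans (normc_ge0 _) (hu 0%N).
  by rewrite /sq sqrtr1 mulr1 divr1.
pose v l := C / (l.+1%:R * sq l.+1).
have v0 l : 0 <= v l by rewrite divr_ge0// mulr_ge0// sqrtr_ge0.
have vS l : v l.+1 <= C * 2 * ((sq l.+1)^-1 - (sq l.+2)^-1).
  rewrite /v -mulrA ler_wpM2l//.
  have a0 := sq_gt0 l; have b0 := sq_gt0 l.+1.
  have ab : sq l.+1 <= sq l.+2 by exact: sq_le.
  have e : (sq l.+2 - sq l.+1) * (sq l.+2 + sq l.+1) = 1.
    have -> : (sq l.+2 - sq l.+1) * (sq l.+2 + sq l.+1) = sq l.+2 ^+ 2 - sq l.+1 ^+ 2 by ring.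
    by rewrite !sq_sqr -[l.+2%:R]natr1; ring.
  rewrite -(sq_sqr l.+2); set a := sq l.+1 in a0 ab e *; set b := sq l.+2 in b0 ab e *.
  have -> : 2 * (a^-1 - b^-1) = 2 / (a * b * (b + a)).
    have -> : 2 * (a^-1 - b^-1) = 2 * ((b - a) * (b + a)) / (a * b * (b + a)).
      by field; rewrite !gt_eqF//; lra.
    by rewrite e mulr1.
  rewrite -[X in _ <= X](mulKf (_ : b ^+ 2 * b != 0)); last first.
    by rewrite mulf_neq0// ?expf_neq0// gt_eqF.
  rewrite ler_pMr ?invr_gt0 ?mulr_gt0 ?exprn_gt0//.
  rewrite mulrA ler_pdivlMr ?mulr_gt0 ?addr_gt0// mul1r.
  have : 0 <= b * ((b - a) * (2 * b + a)).
    by rewrite mulr_ge0 ?(ltW b0)// mulr_ge0 ?subr_ge0//; lra.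
  by lra.
have bv n : \sum_(0 <= l < n) v l <= C * 3.
  have [|n0] := posnP n; first by move=> ->; rewrite big_nil mulr_ge0.
  rewrite -(prednK n0) big_nat_recl//=.
  have v0E : v 0%N = C by rewrite /v /sq sqrtr1 mulr1 divr1.
  apply: le_trans (_ : C + \sum_(0 <= i < n.-1) C * 2 * ((sq i.+1)^-1 - (sq i.+2)^-1) <= _).
    by rewrite v0E lerD2l; apply: ler_sum.
  have -> : \sum_(0 <= i < n.-1) C * 2 * ((sq i.+1)^-1 - (sq i.+2)^-1) =
     C * 2 * (1 - (sq n.-1.+1)^-1).
    elim: n.-1 => [|k IH]; first by rewrite big_nil /sq sqrtr1 invr1 subrr mulr0.
    by rewrite big_nat_recr//= IH; ring.
  have : 0 <= C * 2 * (sq n.-1.+1)^-1 by rewrite !mulr_ge0// invr_ge0 sqrtr_ge0.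
  by lra.
have cv : cvgn (series v).
  apply: nondecreasing_is_cvgn.
    by apply: nondecreasing_series => l _ _; exact: v0.
  by exists (C * 3) => _ [n _ <-]; exact: bv.
have cR (p : R[i] -> R) : (forall z, `|p z| <= normc z) -> cvgn (series (fun l => p (u l))).
  move=> hp; apply: normed_cvg.
  apply: (@series_le_cvg _ _ v) => // [l|l]; first exact: normr_ge0.
  exact: le_trans (hp _) (hu l).
exists (limn (series (fun l => Re (u l))) +i* limn (series (fun l => Im (u l)))).
split => /=.
- under eq_fun do rewrite Re_sum.
  exact: cR _ (@ler_normc_Re _).
- under eq_fun do rewrite Im_sum.
  exact: cR _ (@ler_normc_Im _).
Qed.

Lemma cvgc_shiftS_inv (f : nat -> R[i]) z : cvgc \oo (fun n => f n.+1) z -> cvgc \oo f z.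
Proof.
move=> [h1 h2]; split.
- by have := cvg_shiftS (fun n => Re (f n)) (nbhs (Re z)); rewrite /mk_sequence => <-.
- by have := cvg_shiftS (fun n => Im (f n)) (nbhs (Im z)); rewrite /mk_sequence => <-.
Qed.

(** After a letter [None] the terms are [O(l^(- 3/2))]. After [Some j] with [zeta^j != 1] absolute
    convergence can fail, and the sum is obtained by parts from the recurrence [rec]. *)
Lemma adm_summable W : adm W ->
  exists S : R[i], cvgc \oo (fun n => \sum_(0 <= l < n) coef W l) S.
Proof.
move=> /andP[]; case: W => // a W aW ha.
have [C C0 hC] := coef_sqrt_bound W.
have hb l : normc (coef W l.+1 / l.+1%:R : R[i]) <= C / (l.+1%:R * sq l.+1).
  rewrite normcM normcV normc_natr.
  have -> : C / (l.+1%:R * sq l.+1) = C * sq l.+1 / l.+1%:R / l.+1%:R.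
    have s0 := gt_eqF (sq_gt0 l); rewrite -{3}(sq_sqr l.+1); field.
    by rewrite s0 addrC natr1 pnatr_eq0.
  rewrite ler_wpM2r ?invr_ge0// ler_pdivlMr ?ltr0n// mulrC; exact: hC.
suff [S hS] : exists S : R[i], cvgc \oo (fun n => \sum_(0 <= l < n) coef (a :: W) l.+1) S.
  exists S; apply: cvgc_shiftS_inv; apply: near_eq_cvgc hS; apply: nearW => n.
  by rewrite [RHS]big_nat_recl//= add0r.
case: a aW ha => [j|] aW ha; last first.
  exact: summable_sqrt hb.
have z1 := @zetaX_neq1 R j ha.
pose A l : R[i] := coef (Some j :: W) l.
have [C' C'0 hC'] := coef_sqrt_bound (Some j :: W).
have rec l : l.+2%:R * A l.+2 = zeta ^+ j * (l.+1%:R * A l.+1 + coef W l.+1).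
  rewrite /A /= mulrCA divff ?mulr1 ?pnatr_eq0// mulrCA divff ?mulr1 ?pnatr_eq0//.
  rewrite big_nat_recr //= subSnn muln1 mulrDr; congr (_ + _).
  rewrite big_distrr /= big_nat_cond [RHS]big_nat_cond.
  apply: eq_bigr => m /andP[/andP[_ ml] _].
  by rewrite mulrA -exprD -mulnS -subSn// ltnW.
have [S1 h1] := summable_sqrt hb.
have [S2 h2] : exists S, cvgc \oo (fun n => \sum_(0 <= l < n) (A l.+2 / l.+1%:R)) S.
  apply: (@summable_sqrt _ C') => l; rewrite normcM normcV normc_natr.
  have := hC' l.+2; rewrite -/(A _) => h.
  have a0 := sq_gt0 l; have b0 := sq_gt0 l.+1.
  have ab : sq l.+1 <= sq l.+2 by exact: sq_le.
  rewrite ler_pdivrMr ?ltr0n//.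
  have -> : C' / (l.+1%:R * sq l.+1) * l.+1%:R = C' / sq l.+1.
    by field; rewrite addrC natr1 pnatr_eq0 gt_eqF.
  apply: le_trans (_ : C' / sq l.+2 <= _); last first.
    by rewrite ler_wpM2l// lef_pV2 ?posrE.
  rewrite ler_pdivlMr// -(@ler_pM2r _ (sq l.+2))// -mulrA -expr2 sq_sqr mulrC.
  exact: h.
have h3 : cvgc \oo (fun n => A n.+1) 0.
  apply: (@cvgc_le _ _ _ _ _ _ (fun n => C' * (sq n.+1)^-1)).
    near=> n; rewrite subr0 ler_pdivlMr// -(@ler_pM2r _ (sq n.+1))//.
    by rewrite -mulrA -expr2 sq_sqr mulrC hC'.
  rewrite -[X in _ --> X](mulr0 C'); apply: cvgM; first exact: cvg_cst.
  apply/cvgrPdist_lt => e e0.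
  near=> n; rewrite sub0r normrN gtr0_norm ?invr_gt0//.
  rewrite invf_plt ?posrE//.
  rewrite -(@ltr_pXn2r _ 2) ?nnegrE ?invr_ge0 ?(ltW e0) ?sqrtr_ge0// sq_sqr.
  apply: lt_le_trans (_ : n%:R <= _); last by rewrite ler_nat.
  by near: n; exact: nbhs_infty_gtr.
(* Dividing [rec] by [l + 1] and summing gives [P - A 1 + S2 = zeta^j (P + S1)] for the sum [P] of
   the [A (l + 1)], and this is solved for [P]. The subtracted 0 is the limit of [A (n + 1)]. *)
exists ((1 - zeta ^+ j)^-1 * ((A 1%N - 0) - S2 + zeta ^+ j * S1)).
have nz : 1 - zeta ^+ j != 0 :> R[i] by rewrite subr_eq0 eq_sym.
apply: near_eq_cvgc; last first.
  apply: cvgcZ; apply: cvgcD; last exact: cvgcZ h1.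
  by apply: cvgcB h2; apply: cvgcB h3; exact: cvgc_cst.
apply: nearW => n; apply: (mulfI nz); rewrite mulVKf//.
elim: n => [|n IH]; first by rewrite !big_nil; ring.
rewrite !big_nat_recr// [RHS]mulrDr -IH -/(A n.+1).
have n0 : n.+1%:R != 0 :> R[i] by rewrite pnatr_eq0.
have n0' : 1 + n%:R != 0 :> R[i] by rewrite addrC natr1.
apply: (mulfI n0).
have e := rec n; rewrite -[n.+2%:R]natr1 in e.
set T1 := \sum_(0 <= l < n) _; set T2 := \sum_(0 <= l < n) _.
have -> : coef W n.+1 / n.+1%:R = (zeta ^+ j)^-1 * ((n.+1%:R + 1) * A n.+2 / n.+1%:R) - A n.+1.
  rewrite e; field; rewrite n0' ?andbT.
  by rewrite expf_neq0// -normc_eq0 normc_zeta oner_eq0.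
rewrite /=; field.
by rewrite n0' expf_neq0// -normc_eq0 normc_zeta oner_eq0.
Unshelve. all: by end_near. Qed.

Definition word_val W : R[i] :=
  xget 0 [set S | cvgc \oo (fun n => \sum_(0 <= l < n) coef W l) S].

Lemma cvg_word_val W : adm W ->
  cvgc \oo (fun n => \sum_(0 <= l < n) coef W l) (word_val W).
Proof.
move=> /adm_summable[S hS]; rewrite /word_val; case: xgetP => // h.
by have := h S.
Qed.

Lemma iint_cvg1 W : adm W -> cvgc (1 : R)^'- (iint W) (word_val W).
Proof. by move=> /cvg_word_val; exact: abel (tempered_coef W). Qed.

(** Abel's theorem gives no rate, and the regularization needs one. The outermost letter is bounded
    near 1 and the rest grows at most like [(1 - r)^(- 1/2)], so the integral from [r] to 1 is
    [O((1 - r)^(1/2))]. *)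
Lemma iint_rate W : adm W -> exists2 C : R, 0 <= C & forall r, 1 / 2 <= r < 1 ->
  normc (iint W r - word_val W) <= C * expR (- (1 / 2) * mlog r).
Proof.
move=> aW; have h1 := iint_cvg1 aW; move: (aW) h1 => /andP[].
case: W aW => // a W aW caW ha h1.
have [C C0 hC] := @iint_growth R W (1 / 2) (conv_word_tail caW) (ltac:(lra)).
exists (4 * C) => [|r /andP[r2 r1]]; first by rewrite mulr_ge0.
have step s : r <= s < 1 -> normc (iint (a :: W) s - iint (a :: W) r) <=
    4 * C * expR (- (1 / 2) * mlog r).
  move=> /andP[rs s1].
  apply: le_trans (_ : - (4 * C) * expR (- (1 / 2) * mlog s) -
     - (4 * C) * expR (- (1 / 2) * mlog r) <= _); last first.
    have : 0 <= C * expR (- (1 / 2) * mlog s) by rewrite mulr_ge0 ?expR_ge0.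
    by lra.
  apply: (@derc_mean_value R (iint (a :: W)) (fun t => letter_form a t * iint W t)
    (fun t => - (4 * C) * expR (- (1 / 2) * mlog t))
    (fun t => 2 * C * expR (- (1 / 2) * mlog t) / (1 - t)) r s rs) => t /andP[rt ts].
  - by apply: derc_iint => //; lra.
  - have h := is_deriveZ (- (4 * C)) (@is_derive_expmlog _ (- (1 / 2)) t (le_lt_trans ts s1)).
    by apply: (is_derive_eq h); rewrite /GRing.scale /=; field; rewrite gt_eqF//; lra.
  - have t1 : t < 1 by exact: le_lt_trans ts s1.
    have t01 : 1 / 2 <= t < 1 by rewrite t1 andbT; exact: le_trans r2 rt.
    rewrite normcM.
    have -> : 2 * C * expR (- (1 / 2) * mlog t) / (1 - t) = 2 * (C * expR (1 / 2 * mlog t)).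
      rewrite -(expR_mlog t1) -!mulrA -expRD; congr (2 * (C * expR _)); by field.
    by apply: ler_pM; rewrite ?normc_ge0 ?letter_form_bounded ?hC.
have h2 : cvgc (1 : R)^'- (fun s => iint (a :: W) s - iint (a :: W) r)
    (word_val (a :: W) - iint (a :: W) r) by apply: cvgcB h1 _; exact: cvgc_cst.
rewrite normcB; apply/ler_addgt0Pl => e e0.
have /cvgc_normc/cvgrPdist_lt/(_ e e0) hn := h2.
near (1 : R)^'- => s.
have rs : r <= s < 1.
  apply/andP; split; last by near: s; exact: nbhs_left_lt.
  by apply: ltW; near: s; exact: nbhs_left_gt.
have : `|0 - normc (iint (a :: W) s - iint (a :: W) r - (word_val (a :: W) - iint (a :: W) r))| < e.
  by near: s.
rewrite sub0r normrN ger0_norm ?normc_ge0// => hlt.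
have := step s rs; set x := iint _ s - _ in hlt *; set y := word_val _ - _ in hlt *.
move=> hx; have := le_normcD (y - x) x; rewrite subrK normcB => /le_trans; apply.
by apply: lerD => //; exact: ltW.
Unshelve. all: by end_near. Qed.

End word_values.

(** * Shuffle products *)

Section shuffles.
Context {R : realType}.
Implicit Types (r t : R) (U V W : seq (option nat)) (a b : option nat).

(** Functional identities such as the shuffle product, [cexp_ell] and [zpath_ell] are proved in this
    way: derivative zero on []0, 1[] and the right limit at 0. *)
Lemma derc0_cvg_right (F : R -> R[i]) c : (forall r, 0 < r < 1 -> derc F r 0) ->
  cvgc (0 : R)^'+ F c -> forall r, 0 < r < 1 -> F r = c.
Proof.
move=> dF Fc r r01; apply: (cvgc_unique (F := (0 : R)^'+) (cvgc_cst (F r))).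
apply: near_eq_cvgc Fc; near=> t.
apply: (derc0_cst dF) => //; apply/andP; split; near: t.
- exact: nbhs_right_gt.
- exact: nbhs_right_lt.
Unshelve. all: by end_near. Qed.

(** A list, so that coinciding interleavings are counted with multiplicity. *)
Fixpoint shuffle U V : seq (seq (option nat)) :=
  if U is a :: U' then
    (fix aux V := if V is b :: V' then
       map (cons a) (shuffle U' V) ++ map (cons b) (aux V') else [:: U]) V
  else [:: V].

Lemma shuffle_nil U : shuffle U [::] = [:: U].
Proof. by case: U. Qed.

Lemma shuffle_cons a U b V : shuffle (a :: U) (b :: V) =
  map (cons a) (shuffle U (b :: V)) ++ map (cons b) (shuffle (a :: U) V).
Proof. by []. Qed.

Lemma shuffle_ind (P : seq (option nat) -> seq (option nat) -> Prop) :
  (forall V, P [::] V) -> (forall U, P U [::]) ->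
  (forall a U b V, P U (b :: V) -> P (a :: U) V -> P (a :: U) (b :: V)) ->
  forall U V, P U V.
Proof.
move=> h1 h2 h3; elim=> [//|a U IH]; elim=> [//|b V IH2].
by apply: h3.
Qed.

Lemma size_shuffle U V W : W \in shuffle U V -> size W = (size U + size V)%N.
Proof.
move: U V W; apply: shuffle_ind => [V W|U W|a U b V h1 h2 W].
- by rewrite inE => /eqP ->.
- by rewrite shuffle_nil inE addn0 => /eqP ->.
- rewrite shuffle_cons mem_cat => /orP[] /mapP[W' hW' ->] /=.
  + by rewrite (h1 _ hW').
  + by rewrite (h2 _ hW') addnS.
Qed.

Lemma conv_cons a W : (0 < size W)%N -> conv_word W -> conv_word (a :: W).
Proof. by case: W. Qed.

Lemma conv_shuffle U V W : conv_word U -> conv_word V -> W \in shuffle U V -> conv_word W.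
Proof.
move: U V W; apply: shuffle_ind => [V W|U W|a U b V h1 h2 W].
- by move=> _ h; rewrite inE => /eqP ->.
- by move=> h _; rewrite shuffle_nil inE => /eqP ->.
- move=> hU hV; rewrite shuffle_cons mem_cat => /orP[] /mapP[W' hW' ->].
  + apply: conv_cons; first by rewrite (size_shuffle hW') addnS.
    exact: h1 (conv_word_tail hU) hV hW'.
  + apply: conv_cons; first by rewrite (size_shuffle hW').
    exact: h2 hU (conv_word_tail hV) hW'.
Qed.

Lemma adm_shuffle U V W : adm U -> adm V -> W \in shuffle U V -> adm W.
Proof.
move=> /andP[cU aU] /andP[cV aV] hW; apply/andP; split.
  exact: conv_shuffle hW.
move: cU aU cV aV hW; case: U V => [|a U] [|b V]// cU aU cV aV.
by rewrite shuffle_cons mem_cat => /orP[] /mapP[W' hW' ->].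
Qed.

Lemma cvgc_sum0 (T : Type) (F : set_system T) {FF : ProperFilter F} (I : Type)
    (s : seq I) (P : pred I) (G : I -> T -> R[i]) :
  (forall i, P i -> cvgc F (G i) 0) -> cvgc F (fun x : T => \sum_(i <- s | P i) G i x) 0.
Proof.
move=> /(@cvgc_sum _ _ _ _ _ s P G (fun=> 0)); by rewrite big1.
Qed.

(** Both sides tend to 0 at 0, and by the Leibniz rule the derivative of the product strips the
    first letter of [U] or of [V], which is the recursion of [shuffle]. *)
Lemma iintM U V r : conv_word U -> conv_word V -> 0 < r < 1 ->
  iint U r * iint V r = \sum_(W <- shuffle U V) iint W r.
Proof.
move: U V r; apply: shuffle_ind => [V r|U r|a U b V h1 h2 r] cU cV r01.
- by rewrite big_seq1 iint_nil// mul1r.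
- by rewrite shuffle_nil big_seq1 iint_nil// mulr1.
pose S1 t := \sum_(W <- shuffle U (b :: V) | W \in shuffle U (b :: V)) iint (a :: W) t : R[i].
pose S2 t := \sum_(W <- shuffle (a :: U) V | W \in shuffle (a :: U) V) iint (b :: W) t : R[i].
pose G t := iint (a :: U) t * iint (b :: V) t - (S1 t + S2 t).
have c1 W : W \in shuffle U (b :: V) -> conv_word (a :: W).
  move=> hW; apply: conv_cons; first by rewrite (size_shuffle hW) addnS.
  exact: conv_shuffle (conv_word_tail cU) cV hW.
have c2 W : W \in shuffle (a :: U) V -> conv_word (b :: W).
  move=> hW; apply: conv_cons; first by rewrite (size_shuffle hW).
  exact: conv_shuffle cU (conv_word_tail cV) hW.
suff G0 : forall t, 0 < t < 1 -> G t = 0.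
  rewrite shuffle_cons big_cat !big_map big_seq [X in _ = _ + X]big_seq.
  by apply/eqP; rewrite -subr_eq0; apply/eqP; exact: G0.
apply: derc0_cvg_right => [t t01|].
  apply: derc_eq; last first.
    apply: dercB (dercM (derc_iint cU t01) (derc_iint cV t01)) _.
    by apply: dercD; apply: derc_sum => W hW; apply: derc_iint => //; [exact: c1|exact: c2].
  rewrite -!mulr_sumr -!big_seq -h1 ?(conv_word_tail cU)// -h2 ?(conv_word_tail cV)//.
  by ring.
rewrite -[X in cvgc _ _ X](_ : 0 * 0 - (0 + 0) = 0 :> R[i]); last by ring.
apply: cvgcB; first by apply: cvgcM; exact: iint_cvg0.
apply: cvgcD.
- by apply: cvgc_sum0 => W _; exact: iint_cvg0.
- by apply: cvgc_sum0 => W _; exact: iint_cvg0.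
Qed.

Lemma word_valM U V : adm U -> adm V ->
  word_val U * word_val V = \sum_(W <- shuffle U V) word_val W :> R[i].
Proof.
move=> aU aV; have [cU _] := andP aU; have [cV _] := andP aV.
apply: (@cvgc_unique R R (1 : R)^'- _ (fun r => \sum_(W <- shuffle U V | W \in shuffle U V) iint W r)).
  apply: near_eq_cvgc (cvgcM (iint_cvg1 aU) (iint_cvg1 aV)).
  near=> r; rewrite -big_seq -iintM//.
  by apply/andP; split; near: r; [exact: nbhs_left_gt|exact: nbhs_left_lt].
rewrite big_seq; apply: cvgc_sum => W hW; apply: iint_cvg1.
exact: adm_shuffle hW.
Unshelve. all: by end_near. Qed.

(** The conjugate of [zeta^j] is [zeta^(2 j)]. Admissibility is preserved because 2 is prime to
    3. *)
Definition conj_word W := map (omap (muln 2)) W.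

Lemma coef_conj W l : conjc (coef W l : R[i]) = coef (conj_word W) l.
Proof.
have cn n : conjc (n%:R : R[i]) = n%:R by exact: conjc_nat.
elim: W l => [|a W IH] l; first by rewrite /= cn.
rewrite /=; case: eqP => [_|/eqP l0]; first by rewrite conjc0.
rewrite conjcM conjc_inv cn; case: a => [j|] /=; last by rewrite IH.
congr (_ / _).
have H k : conjc (\sum_(0 <= m < k) zeta ^+ (j * (l - m)) * coef W m : R[i]) =
    \sum_(0 <= m < k) zeta ^+ (2 * j * (l - m)) * coef (conj_word W) m.
  elim: k => [|k IHk]; first by rewrite !big_nil conjc0.
  rewrite !big_nat_recr//= conjcD IHk conjcM IH zetaX_conj; congr (_ + _ * _).
  by rewrite mulnA.
exact: H.
Qed.

Lemma iint_conj W r : 0 < r < 1 -> conjc (iint W r) = iint (conj_word W) r.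
Proof.
move=> r01; have h : cvgc \oo (fun n => conjc (\sum_(0 <= l < n) coef W l * r%:C ^+ l)) (conjc (iint W r)).
  by apply: cvgc_conj; exact: cvg_cps (@tempered_coef R W) r01.
apply: (cvgc_unique h); apply: near_eq_cvgc (cvg_cps (@tempered_coef R _) r01).
apply: nearW => n; elim: n => [|n IH]; first by rewrite !big_nil conjc0.
rewrite !big_nat_recr//= conjcD IH conjcM coef_conj; congr (_ + _ * _).
by rewrite -rmorphXn conjc_real.
Qed.

Lemma conv_conj W : conv_word (conj_word W) = conv_word W.
Proof.
rewrite /conv_word /conj_word; case/lastP: W => // W a.
by rewrite map_rcons !last_rcons; case: a.
Qed.

Lemma adm_conj W : adm (conj_word W) = adm W.
Proof.
by rewrite /adm conv_conj; case: W => // -[j|]//= W; rewrite Euclid_dvdM.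
Qed.

Lemma word_val_conj W : adm W -> conjc (word_val W : R[i]) = word_val (conj_word W).
Proof.
move=> aW; have aW' : adm (conj_word W) by rewrite adm_conj.
apply: (cvgc_unique (cvgc_conj (@iint_cvg1 R _ aW))).
apply: near_eq_cvgc (@iint_cvg1 R _ aW'); near=> r.
rewrite iint_conj//.
by apply/andP; split; near: r; [exact: nbhs_left_gt|exact: nbhs_left_lt].
Unshelve. all: by end_near. Qed.

(** The weight is an index of the derivation, so no independence between weights is asserted. Weight
    0 holds the rational numbers, and the family is closed under products by [wvalsM]. *)
Inductive wvals : nat -> R[i] -> Prop :=
| wvals0 w : wvals w 0
| wvalsD w x y : wvals w x -> wvals w y -> wvals w (x + y)
| wvalsZ w (q : rat) x : wvals w x -> wvals w (ratr q * x)
| wvals1 : wvals 0 1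
| wvals_word W : adm W -> wvals (size W) (word_val W).

Lemma wvals_sum w (I : eqType) (s : seq I) (x : I -> R[i]) :
  (forall i, i \in s -> wvals w (x i)) -> wvals w (\sum_(i <- s) x i).
Proof.
rewrite big_seq => h; elim/big_rec : _ => [|i y /h hi hy]; first exact: wvals0.
exact: wvalsD.
Qed.

Lemma wvalsM v w x y : wvals v x -> wvals w y -> wvals (v + w) (x * y).
Proof.
elim=> {v x} [v|v x x' _ h _ h'|v q x _ h||U aU] hy.
- by rewrite mul0r; exact: wvals0.
- by rewrite mulrDl; apply: wvalsD; [exact: h|exact: h'].
- by rewrite -mulrA; apply: wvalsZ; exact: h.
- by rewrite mul1r.
elim: hy => {w y} [w|w y y' _ h _ h'|w q y _ h||V aV].
- by rewrite mulr0; exact: wvals0.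
- by rewrite mulrDr; exact: wvalsD.
- by rewrite mulrCA; exact: wvalsZ.
- by rewrite mulr1 addn0; exact: wvals_word.
rewrite word_valM//; apply: wvals_sum => W hW.
by rewrite -(size_shuffle hW); apply: wvals_word; exact: adm_shuffle hW.
Qed.

Lemma wvals_rat (q : rat) : wvals 0 (ratr q).
Proof. by rewrite -[ratr q]mulr1; apply: wvalsZ; exact: wvals1. Qed.

Lemma wvals_nat n : wvals 0 n%:R.
Proof. by rewrite -(ratr_nat _ n); exact: wvals_rat. Qed.

Lemma wvalsN w x : wvals w x -> wvals w (- x).
Proof.
move=> /(wvalsZ (-1)); suff -> : ratr (-1) = -1 :> R[i] by rewrite mulN1r.
by rewrite rmorphN rmorph1.
Qed.

Lemma wvals_conj w x : wvals w x -> wvals w (conjc x).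
Proof.
elim=> {w x} [w|w x x' _ h _ h'|w q x _ h||W aW].
- by rewrite conjc0; exact: wvals0.
- by rewrite conjcD; exact: wvalsD.
- rewrite conjcM; have -> : conjc (ratr q : R[i]) = ratr q.
    exact: (fmorph_rat (@conjc R)).
  exact: wvalsZ.
- by rewrite conjc1; exact: wvals1.
- rewrite word_val_conj// -(size_map (omap (muln 2)) W).
  by apply: wvals_word; rewrite adm_conj.
Qed.

(** Powers of [ln r] stand in for words ending in [None], whose integrals from 0 diverge; the
    constants carry a weight of their own. By [polylogs_eq] only the values on []0, 1[] count. *)
Inductive polylogs : nat -> (R -> R[i]) -> Prop :=
| polylogs0 w : polylogs w (fun=> 0)
| polylogsD w F G : polylogs w F -> polylogs w G -> polylogs w (fun r => F r + G r)
| polylogs_word v (b : nat) c W : wvals v c -> conv_word W ->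
    polylogs (v + b + size W) (fun r => c * (ln r)%:C ^+ b * iint W r)
| polylogs_eq w F G : (forall r, 0 < r < 1 -> F r = G r) -> polylogs w F -> polylogs w G.

Lemma polylogs_weight v w F : v = w -> polylogs v F -> polylogs w F.
Proof. by move=> ->. Qed.

Lemma polylogsZ v w c F : wvals v c -> polylogs w F -> polylogs (v + w) (fun r => c * F r).
Proof.
move=> hc; elim=> {w F} [w|w F G _ h _ h'|w b d W hd hW|w F G FG _ h].
- by apply: polylogs_eq (polylogs0 _) => r _; rewrite mulr0.
- by apply: polylogs_eq (polylogsD h h') => r _; rewrite mulrDr.
- apply: polylogs_eq (polylogs_weight _ (polylogs_word b (wvalsM hc hd) hW)).
    by move=> r _; rewrite !mulrA.
  by rewrite !addnA.
- by apply: polylogs_eq h => r r01; rewrite FG.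
Qed.

Lemma polylogs_sum w (I : eqType) (s : seq I) (F : I -> R -> R[i]) :
  (forall i, i \in s -> polylogs w (F i)) -> polylogs w (fun r => \sum_(i <- s) F i r).
Proof.
elim: s => [|i s IH] h.
  by apply: polylogs_eq (polylogs0 _) => r _; rewrite big_nil.
apply: polylogs_eq (polylogsD (h i _) (IH _)) => [r _||j js].
- by rewrite big_cons.
- exact: mem_head.
- by apply: h; rewrite inE js orbT.
Qed.

Lemma polylogsM v w F G : polylogs v F -> polylogs w G ->
  polylogs (v + w) (fun r => F r * G r).
Proof.
elim=> {v F} [v|v F F' _ h _ h'|v b c U hc hU|v F F' FF' _ h] hG.
- by apply: polylogs_eq (polylogs0 _) => r _; rewrite mul0r.
- by apply: polylogs_eq (polylogsD (h hG) (h' hG)) => r _; rewrite mulrDl.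
- elim: hG => {w G} [w|w G G' _ h _ h'|w b' d V hd hV|w G G' GG' _ h].
  + by apply: polylogs_eq (polylogs0 _) => r _; rewrite mulr0.
  + by apply: polylogs_eq (polylogsD h h') => r _; rewrite mulrDr.
  + apply: (@polylogs_eq _ (fun r => \sum_(W <- shuffle U V)
        (c * d) * (ln r)%:C ^+ (b + b') * iint W r)).
      move=> r r01; rewrite -mulr_sumr -iintM// exprD; ring.
    apply: polylogs_sum => W hW.
    apply: polylogs_weight (polylogs_word _ (wvalsM hc hd) _).
      by rewrite (size_shuffle hW); lia.
    exact: conv_shuffle hW.
  + by apply: polylogs_eq h => r r01; rewrite GG'.
- by apply: polylogs_eq (h hG) => r r01; rewrite FF'.
Qed.

Lemma polylogs_cst w c : wvals w c -> polylogs w (fun=> c).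
Proof.
move=> hc; apply: polylogs_eq (polylogs_weight _ (polylogs_word 0 hc (W := [::]) isT)).
  by move=> r r01; rewrite expr0 iint_nil// !mulr1.
by rewrite !addn0.
Qed.

Lemma polylogs_iint W : conv_word W -> polylogs (size W) (iint W).
Proof.
move=> hW; apply: polylogs_eq (polylogs_word 0 wvals1 hW).
by move=> r _; rewrite expr0 !mul1r.
Qed.

Lemma polylogsN w F : polylogs w F -> polylogs w (fun r => - F r).
Proof.
move=> /(polylogsZ (wvalsN wvals1)); apply: polylogs_eq => r _.
by rewrite mulN1r.
Qed.

Lemma polylogsX w F n : polylogs w F -> polylogs (n * w) (fun r => F r ^+ n).
Proof.
move=> h; elim: n => [|n IH].
  by apply: polylogs_eq (polylogs_cst wvals1) => r _; rewrite expr0.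
by rewrite mulSn; apply: polylogs_eq (polylogsM h IH) => r _; rewrite exprS.
Qed.

Lemma derc_ln r : 0 < r -> derc (fun t => (ln t)%:C : R[i]) r (r%:C)^-1.
Proof.
move=> r0; apply: derc_eq (derc_real (is_derive1_ln r0)).
by rewrite -fmorphV.
Qed.

(** For a positive exponent [n], apply [u <= expR u] to [u = d x / n] and raise it to the power [n]:
    the constant is [(n / d)^n]. *)
Lemma exprn_le_expR n (d : R) : 0 < d ->
  exists2 C, 0 <= C & forall x, 0 <= x -> x ^+ n <= C * expR (d * x).
Proof.
move=> d0; case: n => [|n].
  exists 1 => // x x0; rewrite expr0 mul1r -[leLHS]expR0 ler_expR mulr_ge0//.
  exact: ltW.
exists ((n.+1%:R / d) ^+ n.+1) => [|x x0]; first by rewrite exprn_ge0// divr_ge0// ltW.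
have -> : d * x = n.+1%:R * (d / n.+1%:R * x) by rewrite mulrA mulrCA divff ?mulr1// pnatr_eq0.
have dV0 : 0 <= d^-1 by rewrite invr_ge0 ltW.
rewrite expRM_natl -exprMn lerXn2r ?nnegrE ?mulr_ge0 ?expR_ge0//.
rewrite -ler_pdivrMl ?divr_gt0 ?ltr0n// invf_div.
by apply: le_trans (expR_ge1Dx _); rewrite lerDr.
Qed.

Lemma expR_half_ln_cvg : expR (ln r / 2) @[r --> (0 : R)^'+] --> (0 : R).
Proof.
apply/cvgrPdist_lt => e e0; near=> r.
have r0 : 0 < r by near: r; exact: nbhs_right_gt.
have re : r < e ^+ 2 by near: r; apply: nbhs_right_lt; rewrite exprn_gt0.
rewrite sub0r normrN gtr0_norm ?expR_gt0//.
rewrite -[ltRHS](@lnK _ e) ?posrE// ltr_expR ltr_pdivrMr// mulr_natr -lnXn//.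
by rewrite ltr_ln ?posrE// exprn_gt0.
Unshelve. all: by end_near. Qed.

Lemma ln_iint_cvg0 c n a W :
  cvgc (0 : R)^'+ (fun r => c * (ln r)%:C ^+ n * iint (a :: W) r) 0.
Proof.
have [C C0 hC] := @exprn_le_expR n (1 / 2) (ltac:(lra)).
apply: (@cvgc_le _ _ _ _ _ _ (fun r => normc c * C * 2 * expR (ln r / 2))).
  near=> r.
  have r0 : 0 < r by near: r; exact: nbhs_right_gt.
  have r2 : r < 1 / 2 by near: r; apply: nbhs_right_lt; lra.
  rewrite subr0 !normcM normcX normc_real -!mulrA ler_wpM2l ?normc_ge0//.
  rewrite ler0_norm; last by rewrite ln_le0//; lra.
  have l0 : 0 <= - ln r by rewrite oppr_ge0 ln_le0//; lra.
  apply: le_trans (_ : C * expR (1 / 2 * - ln r) * (2 * r) <= _).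
    apply: ler_pM; rewrite ?exprn_ge0 ?normc_ge0 ?hC//.
    apply: le_trans (iint_le _ _ _) _; first by rewrite r0; lra.
    rewrite ler_pdivrMr; last by lra.
    have : 0 <= r * (1 - 2 * r) by apply: mulr_ge0; lra.
    by lra.
  rewrite -mulrA ler_wpM2l// mulrCA ler_wpM2l// -{2}(@lnK _ r) ?posrE// -expRD.
  by rewrite ler_expR; lra.
rewrite -[X in _ --> X](mulr0 (normc c * C * 2)).
by apply: cvgM; [exact: cvg_cst|exact: expR_half_ln_cvg].
Unshelve. all: by end_near. Qed.

(* Integration by parts lowers the power of the logarithm. *)
Lemma polylogs_word_primitive v (b : nat) c a W : wvals v c -> conv_word (a :: W) ->
  exists G, [/\ polylogs (v + b + size W).+1 G, cvgc (0 : R)^'+ G 0 & forall r, 0 < r < 1 ->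
    derc G r (letter_form a r * (c * (ln r)%:C ^+ b * iint W r))].
Proof.
elim: b v c a W => [|b IH] v c a W hc hW.
  exists (fun r => c * iint (a :: W) r); split.
  - apply: polylogs_eq (polylogs_weight _ (polylogs_word 0 hc hW)).
      by move=> r _; rewrite expr0 mulr1.
    by rewrite /= addnS.
  - by rewrite -(mulr0 c); apply: cvgcZ; exact: iint_cvg0.
  - move=> r r01; apply: derc_eq (dercZ c (derc_iint hW r01)).
  by rewrite expr0; ring.
(* The term to subtract is a primitive of [(b + 1) c ln^b r iint (a :: W) / r], which the induction
   hypothesis provides for the letter [None] and the word [a :: W]. *)
have [G [hG cG dG]] := IH _ _ None (a :: W) (wvalsM (wvals_nat b.+1) hc) hW.
exists (fun r => c * (ln r)%:C ^+ b.+1 * iint (a :: W) r - G r); split.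
- apply: polylogsD; last first.
    by apply: polylogsN; apply: polylogs_weight hG; rewrite /= add0n !addnS.
  by apply: polylogs_weight (polylogs_word b.+1 hc hW); rewrite /= addnS.
- by rewrite -[X in cvgc _ _ X](subrr 0); apply: cvgcB cG; exact: ln_iint_cvg0.
move=> r r01; have r0 : 0 < r by case/andP: r01.
apply: derc_eq (dercB (dercM (dercZ c (dercX b.+1 (derc_ln r0))) (derc_iint hW r01)) (dG r r01)).
by rewrite /letter_form; ring.
Qed.

(** The letters [Some j] are regular at 0, so that they can be put in front of any convergent word,
    the empty one included, and the primitive can be chosen to vanish at 0. *)
Lemma polylogs_primitive w F j : polylogs w F ->
  exists G, [/\ polylogs w.+1 G, cvgc (0 : R)^'+ G 0 &
    forall r, 0 < r < 1 -> derc G r (letter_form (Some j) r * F r)].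
Proof.
elim=> {w F} [w|w F G _ [F' [hF cF dF]] _ [G' [hG cG dG]]|w b c W hc hW|w F G FG _ [G' [hG cG dG]]].
- exists (fun=> 0); split; [exact: polylogs0|exact: cvgc_cst|].
  by move=> r _; rewrite mulr0; exact: derc_cst.
- exists (fun r => F' r + G' r); split; first exact: polylogsD.
    by rewrite -[X in cvgc _ _ X](addr0 0); exact: cvgcD.
  by move=> r r01; rewrite mulrDr; apply: dercD; [exact: dF|exact: dG].
- by apply: polylogs_word_primitive => //; case: W hW.
- by exists G'; split => // r r01; rewrite -FG//; exact: dG.
Qed.

End shuffles.

(** * Regularization at 1 *)

Section regularization.
Context {R : realType}.
Implicit Types (r t : R) (U V W : seq (option nat)) (F G e : R -> R[i]).

Definition negligible1 e := exists C d : R, [/\ 0 <= C, 0 < d &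
  forall r, 1 / 2 <= r < 1 -> normc (e r) <= C * expR (- d * mlog r)].

(* Asymptotic expansions at [r = 1] in powers of [- ln (1 - r)], up to an error
   [O((1 - r)^d)], with coefficients in [wvals]. *)
Inductive log_expansion : nat -> (R -> R[i]) -> Prop :=
| log_expansion_negl w e : negligible1 e -> log_expansion w e
| log_expansionD w F G : log_expansion w F -> log_expansion w G ->
    log_expansion w (fun r => F r + G r)
| log_expansionX v k c : wvals v c -> log_expansion (v + k) (fun r => c * (mlog r)%:C ^+ k)
| log_expansion_eq w F G : (forall r, 1 / 2 <= r < 1 -> F r = G r) ->
    log_expansion w F -> log_expansion w G.

Lemma negligible1Z c e : negligible1 e -> negligible1 (fun r => c * e r).
Proof.
move=> [C [d [C0 d0 h]]]; exists (normc c * C), d; split => //.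
  by rewrite mulr_ge0 ?normc_ge0.
by move=> r r01; rewrite normcM -mulrA ler_wpM2l ?normc_ge0// h.
Qed.

Lemma expR_ge_id (x : R) : x <= expR x.
Proof. by apply: le_trans (expR_ge1Dx x); rewrite lerDr. Qed.

(** Half of the exponent [d] pays for the logarithm, by [u <= expR u] at [u = d / 2 * mlog r]. *)
Lemma negligible1_mlog e : negligible1 e -> negligible1 (fun r => (mlog r)%:C * e r).
Proof.
move=> [C [d [C0 d0 h]]]; exists (2 / d * C), (d / 2); split => //.
- by rewrite mulr_ge0// divr_ge0// ltW.
- by rewrite divr_gt0.
move=> r r01; have L0 : 0 <= mlog r by rewrite mlog_ge0//; lra.
rewrite normcM normc_real ger0_norm//.
have -> : 2 / d * C * expR (- (d / 2) * mlog r) =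
    (2 / d * expR (d / 2 * mlog r)) * (C * expR (- d * mlog r)).
  have -> : - (d / 2) * mlog r = d / 2 * mlog r + - d * mlog r by field.
  by rewrite expRD; ring.
apply: ler_pM => //; [exact: normc_ge0| |exact: h].
rewrite -ler_pdivrMl ?divr_gt0// invf_div; exact: expR_ge_id.
Qed.

Lemma negligible1_0 : negligible1 (fun=> 0).
Proof. by exists 0, 1; split => // r _; rewrite normc0 mul0r. Qed.

Lemma log_expansionZ v w c F : wvals v c -> log_expansion w F ->
  log_expansion (v + w) (fun r => c * F r).
Proof.
move=> hc; elim=> {w F} [w e he|w F G _ h _ h'|w k d hd|w F G FG _ h].
- by apply: log_expansion_negl; exact: negligible1Z.
- by apply: log_expansion_eq (log_expansionD h h') => r _; rewrite mulrDr.
- rewrite addnA; apply: log_expansion_eq (log_expansionX k (wvalsM hc hd)).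
  by move=> r _; rewrite mulrA.
- by apply: log_expansion_eq h => r r01; rewrite FG.
Qed.

Lemma log_expansion_mlog w F : log_expansion w F ->
  log_expansion w.+1 (fun r => (mlog r)%:C * F r).
Proof.
elim=> {w F} [w e he|w F G _ h _ h'|w k d hd|w F G FG _ h].
- by apply: log_expansion_negl; exact: negligible1_mlog.
- by apply: log_expansion_eq (log_expansionD h h') => r _; rewrite mulrDr.
- rewrite -addnS; apply: log_expansion_eq (log_expansionX k.+1 hd).
  by move=> r _; rewrite exprS mulrCA.
- by apply: log_expansion_eq h => r r01; rewrite FG.
Qed.

Lemma log_expansion_sum w (I : eqType) (s : seq I) (F : I -> R -> R[i]) :
  (forall i, i \in s -> log_expansion w (F i)) ->
  log_expansion w (fun r => \sum_(i <- s) F i r).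
Proof.
elim: s => [|i s IH] h.
  apply: log_expansion_eq (log_expansion_negl _ negligible1_0) => r _.
  by rewrite big_nil.
apply: log_expansion_eq (log_expansionD (h i _) (IH _)) => [r _||j js].
- by rewrite big_cons.
- exact: mem_head.
- by apply: h; rewrite inE js orbT.
Qed.

Lemma log_expansion_adm W : adm W -> log_expansion (size W) (iint W).
Proof.
move=> aW; apply: (@log_expansion_eq _ (fun r => word_val W * (mlog r)%:C ^+ 0 +
    (iint W r - word_val W))).
  by move=> r _; rewrite expr0 mulr1 addrC subrK.
apply: log_expansionD.
  by rewrite -[size W]addn0; apply: log_expansionX; exact: wvals_word.
apply: log_expansion_negl; have [C C0 h] := @iint_rate R _ aW.
by exists C, (1 / 2); split => //; lra.
Qed.

Lemma iint_x1 r : 0 < r < 1 -> iint [:: Some 0%N] r = (mlog r)%:C.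
Proof.
move=> r01; apply/eqP; rewrite -subr_eq0; apply/eqP; move: r r01.
apply: (@derc0_cvg_right R (fun r => iint [:: Some 0%N] r - (mlog r)%:C)) => [r r01|].
  have r1 : r < 1 by case/andP: r01.
  apply: derc_eq (dercB (@derc_iint R (Some 0%N) [::] r isT r01)
    (derc_real (is_derive_mlog r1))).
  rewrite /letter_form expr0 mul1r iint_nil// mulr1 mul1r.
  by rewrite fmorphV rmorphB rmorph1 subrr.
rewrite -[X in cvgc _ _ X](subrr 0); apply: cvgcB; first exact: iint_cvg0.
split => /=; last exact: cvg_cst.
have h : {for 0, continuous (@mlog R)}.
  apply: differentiable_continuous; apply/derivable1_diffP.
  by have [] := @is_derive_mlog R 0 ltr01.
rewrite [X in _ --> X](_ : 0 = mlog 0); last by rewrite /mlog subr0 ln1 oppr0.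
exact: cvg_at_right_filter.
Qed.

(* All the ways of inserting the letter [x_1] in [x_1^m W]. *)
Lemma sum_shuffle_x1 (g : seq (option nat) -> R[i]) m a W :
  \sum_(V <- shuffle [:: Some 0%N] (nseq m (Some 0%N) ++ a :: W)) g V =
  m.+1%:R * g (nseq m.+1 (Some 0%N) ++ a :: W) +
  \sum_(V <- shuffle [:: Some 0%N] W) g (nseq m (Some 0%N) ++ a :: V).
Proof.
elim: m g => [|m IH] g.
  by rewrite [nseq 0 _ ++ _]/= shuffle_cons big_cat /= big_seq1 big_map mul1r.
rewrite [nseq m.+1 _ ++ _]/= shuffle_cons big_cat big_map /= big_seq1 big_map.
by rewrite (IH (fun V => g (Some 0%N :: V))) -[m.+2%:R]natr1 /=; ring.
Qed.

Lemma sum_shuffle_x1_nil (g : seq (option nat) -> R[i]) m :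
  \sum_(V <- shuffle [:: Some 0%N] (nseq m (Some 0%N))) g V =
  m.+1%:R * g (nseq m.+1 (Some 0%N)).
Proof.
elim: m g => [|m IH] g; first by rewrite /= big_seq1 mul1r.
rewrite [nseq m.+1 _]/= shuffle_cons big_cat big_map /= big_seq1 big_map.
by rewrite (IH (fun V => g (Some 0%N :: V))) -[m.+2%:R]natr1 /=; ring.
Qed.

Lemma conv_nseq m W : conv_word W -> conv_word (nseq m (Some 0%N) ++ W).
Proof.
by elim: m => // m IH /IH; rewrite /=; case: (_ ++ _).
Qed.

Lemma wvals_inv_nat n : wvals 0 (n%:R^-1 : R[i]).
Proof. by rewrite -(ratr_nat _ n) -fmorphV; exact: wvals_rat. Qed.

(** Induction on the number [m] of leading letters [x_1], for all tails at once. Multiplying the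
    integral of [x_1^m a W] by [mlog], which is the integral of [x_1], gives [m + 1] times the
    integral of [x_1^(m+1) a W] plus words with only [m] leading letters [x_1]. Solving costs a
    division by [m + 1], harmless over the rationals. *)
Lemma log_expansion_x1 m W : (W == [::]) || adm W ->
  log_expansion (m + size W) (iint (nseq m (Some 0%N) ++ W)).
Proof.
elim: m W => [|m IH] W hW.
  case/orP: hW => [/eqP ->|]; last exact: log_expansion_adm.
  apply: log_expansion_eq (log_expansionX 0 wvals1) => r r01.
  by rewrite expr0 mulr1 /= iint_nil//; lra.
have cW : conv_word W by case/orP: hW => [/eqP -> //|/andP[]].
have m0 : m.+1%:R != 0 :> R[i] by rewrite pnatr_eq0.
case: W hW cW => [|a W] hW cW.
  apply: (@log_expansion_eq _ (fun r => m.+1%:R^-1 *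
      ((mlog r)%:C * iint (nseq m (Some 0%N)) r))).
    move=> r r01; have r01' : 0 < r < 1 by lra.
    rewrite -iint_x1// iintM//; last by rewrite -[nseq m _]cats0; exact: conv_nseq.
    by rewrite sum_shuffle_x1_nil mulKf// cats0.
  rewrite addSn -[X in log_expansion X.+1]add0n -addnS.
  apply: log_expansionZ; first exact: wvals_inv_nat.
  by apply: log_expansion_mlog; have := IH [::] isT; rewrite cats0.
have aW : adm (a :: W) by [].
apply: (@log_expansion_eq _ (fun r => m.+1%:R^-1 *
    ((mlog r)%:C * iint (nseq m (Some 0%N) ++ a :: W) r +
    (-1) * \sum_(V <- shuffle [:: Some 0%N] W) iint (nseq m (Some 0%N) ++ a :: V) r))).
  move=> r r01; have r01' : 0 < r < 1 by lra.
  rewrite -iint_x1// iintM//; last exact: conv_nseq.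
  by rewrite sum_shuffle_x1 mulN1r addrK mulKf.
rewrite addSn -[X in log_expansion X.+1]add0n -addnS.
apply: log_expansionZ; first exact: wvals_inv_nat.
apply: log_expansionD; first by apply: log_expansion_mlog; exact: IH.
rewrite -[X in log_expansion X]add0n; apply: log_expansionZ.
  by apply: wvalsN; exact: wvals1.
apply: log_expansion_sum => V hV.
have -> : (m + size (a :: W)).+1 = (m + size (a :: V))%N.
  by rewrite /= (size_shuffle hV) /= add1n !addnS.
apply: IH; case/andP: aW => _ haW; rewrite /adm haW andbT orFb.
apply: conv_cons; first by rewrite (size_shuffle hV).
exact: conv_shuffle (conv_word_tail cW) hV.
Qed.

(** Indices are not reduced modulo 3, so [dr/(1 - r)] has several codes; [coef_x1_prefix] replaces
    the leading ones by [Some 0]. *)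
Definition is_x1 (a : option nat) := if a is Some j then (3 %| j)%N else false.

Lemma coef_x1_prefix X W l : all is_x1 X ->
  coef (X ++ W) l = coef (nseq (size X) (Some 0%N) ++ W) l :> R[i].
Proof.
elim: X l => [|[j|] X IH] l //= /andP[hj hX]; case: eqP => // _.
congr (_ / _); apply: eq_bigr => m _; rewrite IH// mul0n expr0.
by rewrite zetaX_dvd// dvdn_mulr.
Qed.

Lemma log_expansion_iint W : conv_word W -> log_expansion (size W) (iint W).
Proof.
move=> cW.
have [X [W' [eW hX hW']]] : exists X W', [/\ W = X ++ W', all is_x1 X & (W' == [::]) || adm W'].
  elim: W cW => [|a W IH] cW; first by exists [::], [::].
  have [ha|ha] := boolP (is_x1 a); last first.
    exists [::], (a :: W); split => //; rewrite /adm cW /=.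
    by case: a ha {cW}.
  have [X [W' [eW hX hW']]] := IH (conv_word_tail cW).
  by exists (a :: X), W'; split => //=; rewrite ?eW// ha.
have := log_expansion_x1 (size X) hW'; rewrite eW size_cat.
apply: log_expansion_eq => r _; rewrite /iint; congr (cps _ r).
by apply/funext => l; rewrite [RHS]coef_x1_prefix.
Qed.

Lemma ln_bound r : 1 / 2 <= r < 1 -> `|ln r| <= 2 * (1 - r).
Proof.
move=> /andP[r2 r1]; have r0 : 0 < r by lra.
rewrite ler0_norm; last by rewrite ln_le0// ltW.
rewrite -lnV ?posrE//.
have -> : r^-1 = 1 + (r^-1 - 1) by ring.
apply: le_trans (le_ln1Dx _) _; first by rewrite ltrBrDl subrr invr_gt0.
rewrite -(@ler_pM2r _ r)// mulrBl mulVf ?gt_eqF// mul1r.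
have : 0 <= (2 * r - 1) * (1 - r) by apply: mulr_ge0; lra.
by lra.
Qed.

Lemma log_expansion_polylogs w F : polylogs w F -> log_expansion w F.
Proof.
elim=> {w F} [w|w F G _ h _ h'|v [|b] c W hc hW|w F G FG _ h].
- exact: log_expansion_negl negligible1_0.
- exact: log_expansionD.
- rewrite addn0; apply: log_expansion_eq (log_expansionZ hc (log_expansion_iint hW)).
  by move=> r _; rewrite expr0 mulr1.
(* A positive power of [ln r] is [O(1 - r)] at 1, which outweighs the growth [(1 - r)^(- 1/2)]
   allowed to the integral. *)
- apply: log_expansion_negl.
  have [C C0 hC] := @iint_growth R W (1 / 2) hW (ltac:(lra)).
  exists (normc c * (2 * C)), (1 / 2); split.
  + by rewrite mulr_ge0 ?normc_ge0// mulr_ge0.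
  + by lra.
  + move=> r r01; rewrite !normcM -!mulrA ler_wpM2l ?normc_ge0//.
  have -> : 2 * (C * expR (- (1 / 2) * mlog r)) =
      (2 * (1 - r)) * (C * expR (1 / 2 * mlog r)).
    have -> : - (1 / 2) * mlog r = - mlog r + 1 / 2 * mlog r by field.
    rewrite expRD [expR (- _)]expRN expR_mlog; last by lra.
    by rewrite invrK; ring.
  apply: ler_pM; rewrite ?normc_ge0 ?hC//.
  rewrite normcX normc_real exprS.
  have h := ln_bound r01; apply: le_trans h.
  rewrite ler_piMr// exprn_ile1//; have := ln_bound r01; lra.
- by apply: log_expansion_eq h => r r01; apply: FG; lra.
Qed.

Lemma mlog_cvg : (mlog r)^-1 @[r --> (1 : R)^'-] --> (0 : R).
Proof.
apply/cvgrPdist_lt => e e0; near=> r.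
have r1 : r < 1 by near: r; exact: nbhs_left_lt.
have hr : e^-1 < mlog r.
  rewrite /mlog ltrNr -ltr_expR lnK ?posrE ?subr_gt0//.
  rewrite ltrBlDr -ltrBlDl; near: r; apply: nbhs_left_gt.
  by rewrite gtrBl expR_gt0.
have m0 : 0 < mlog r by apply: lt_trans hr; rewrite invr_gt0.
by rewrite sub0r normrN gtr0_norm ?invr_gt0// invf_plt ?posrE.
Unshelve. all: by end_near. Qed.

Lemma negligible1_cvg e : negligible1 e -> cvgc (1 : R)^'- e 0.
Proof.
move=> [C [d [C0 d0 h]]].
apply: (@cvgc_le _ _ _ _ _ _ (fun r => C / d * (mlog r)^-1)).
  near=> r; rewrite subr0.
  have r01 : 1 / 2 <= r < 1.
    apply/andP; split; last by near: r; exact: nbhs_left_lt.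
    by apply: ltW; near: r; apply: nbhs_left_gt; lra.
  have m0 : 0 < mlog r.
    by rewrite /mlog oppr_gt0 ln_lt0//; lra.
  apply: le_trans (h r r01) _; rewrite -mulrA ler_wpM2l//.
  rewrite mulNr expRN -invfM lef_pV2 ?posrE ?expR_gt0 ?mulr_gt0//.
  exact: expR_ge_id.
by rewrite -[X in _ --> X](mulr0 (C / d)); apply: cvgM; [exact: cvg_cst|exact: mlog_cvg].
Unshelve. all: by end_near. Qed.

Lemma log_expansion_poly w F : log_expansion w F ->
  exists2 p : {poly R[i]}, wvals w p`_0 & cvgc (1 : R)^'- (fun r => F r - p.[(mlog r)%:C]) 0.
Proof.
elim=> {w F} [w e he|w F G _ [p hp cp] _ [q hq cq]|v k c hc|w F G FG _ [p hp cp]].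
- exists 0; first by rewrite coef0; exact: wvals0.
  by under eq_fun do rewrite horner0 subr0; exact: negligible1_cvg.
- exists (p + q); first by rewrite coefD; exact: wvalsD.
  apply: near_eq_cvgc (_ : cvgc _ (fun r => (F r - p.[(mlog r)%:C]) + (G r - q.[(mlog r)%:C])) 0).
    by apply: nearW => r; rewrite hornerD; ring.
  by rewrite -[X in cvgc _ _ X](addr0 0); exact: cvgcD.
- exists (c *: 'X^k).
    rewrite coefZ coefXn; case: k => [|k]; first by rewrite mulr1 addn0.
    by rewrite mulr0; exact: wvals0.
  by under eq_fun do rewrite hornerZ hornerXn subrr; exact: cvgc_cst.
- exists p => //; apply: near_eq_cvgc cp; near=> r.
  rewrite FG//; apply/andP; split; last by near: r; exact: nbhs_left_lt.
  by apply: ltW; near: r; apply: nbhs_left_gt; lra.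
Unshelve. all: by end_near. Qed.

(** Induction on the polynomial: if [p X + c] converges along [mlog r], division by [mlog r], which
    tends to infinity, shows that [p] tends to 0 along it, hence is zero. *)
Lemma poly_cvg_const (p : {poly R[i]}) z :
  cvgc (1 : R)^'- (fun r => p.[(mlog r)%:C]) z -> p = z%:P.
Proof.
elim/poly_ind: p z => [|p c IH] z.
  under eq_fun do rewrite horner0.
  by move=> h; rewrite -(cvgc_unique (cvgc_cst (F := (1 : R)^'-) 0) h) polyC0.
under eq_fun do rewrite hornerD hornerC hornerM hornerX.
move=> h; have p0 : p = 0.
  rewrite -polyC0; apply: IH.
  have hm : cvgc (1 : R)^'- (fun r => ((mlog r)^-1)%:C : R[i]) 0.
    by split => /=; [exact: mlog_cvg|exact: cvg_cst].
  have H : cvgc (1 : R)^'- (fun r => (p.[(mlog r)%:C] * (mlog r)%:C + c - c) *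
      ((mlog r)^-1)%:C) ((z - c) * 0).
    by apply: cvgcM hm; apply: cvgcB h _; exact: cvgc_cst.
  rewrite mulr0 in H; apply: near_eq_cvgc H.
  near=> r; have m0 : mlog r != 0.
    rewrite /mlog oppr_eq0 lt_eqF// ln_lt0// subr_gt0 gtrBl; apply/andP; split; near: r.
    - exact: nbhs_left_lt.
    - exact: nbhs_left_gt.
  by rewrite addrK fmorphV mulfK// (inj_eq (@complexI R)).
move: h; rewrite p0; under eq_fun do rewrite horner0 mul0r add0r.
by move=> hc; rewrite -(cvgc_unique (cvgc_cst (F := (1 : R)^'-) c) hc) mul0r add0r.
Unshelve. all: by end_near. Qed.

(** The coefficients of positive powers of the logarithm are never computed: the existence of the
    limit forces them to vanish, and the constant coefficient lies in the span by construction. *)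
Theorem polylogs_limit w F z : polylogs w F -> cvgc (1 : R)^'- F z -> wvals w z.
Proof.
move=> /log_expansion_polylogs/log_expansion_poly[p hp cp] cF.
suff e : p = z%:P by move: hp; rewrite e coefC eqxx.
apply: poly_cvg_const; rewrite -[z]subr0.
by apply: near_eq_cvgc (cvgcB cF cp); apply: nearW => r; ring.
Qed.

End regularization.

(** * The polylogarithmic integrals *)

Section polylogs_of_y.
Context {R : realType}.
Implicit Types (r t : R) (n p : nat).

(** Since [iint [:: Some j]] is [- log (1 - zeta^j r)], this is the logarithm of [yfun] that
    vanishes at 0. Written with words it involves no choice of branch and is visibly of weight 1. *)
Definition ell r : R[i] :=
  - iint [:: Some 0%N] r - iint [:: Some 2] r + 2 * iint [:: Some 1%N] r.

Definition dell r : R[i] :=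
  - letter_form (Some 0%N) r - letter_form (Some 2) r + 2 * letter_form (Some 1%N) r.

(* [y = t(1 - t)] in the coordinate [u = zeta * r = (t - w)/(t - conj w)],
   [w = exp(i pi/3)]. *)
Definition yfun r : R[i] := (1 - r%:C) * (1 - zeta ^+ 2 * r%:C) / (1 - zeta * r%:C) ^+ 2.

(** The logarithmic derivative of [v = (1 - zeta^2 r) / (1 - r)], which equals [zeta e^(- z)] on the
    path. *)
Definition dlogv r : R[i] := letter_form (Some 0%N) r - letter_form (Some 2) r.

Lemma polylogs_ell : polylogs 1 ell.
Proof.
have h j : polylogs 1 (iint [:: Some j] : R -> R[i]) by exact: (@polylogs_iint R [:: Some j]).
apply: polylogsD; first by apply: polylogsD; exact: polylogsN.
by rewrite -[1%N]add0n; apply: polylogsZ => //; exact: wvals_nat.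
Qed.

Lemma derc_ell r : 0 < r < 1 -> derc ell r (dell r).
Proof.
move=> r01.
have h j : derc (iint [:: Some j]) r (letter_form (Some j) r : R[i]).
  apply: derc_eq (@derc_iint R (Some j) [::] r isT r01).
  by rewrite iint_nil// mulr1.
by apply: dercD; [apply: dercB; [exact: dercN|]|exact: dercZ].
Qed.

Lemma ell_cvg0 : cvgc (0 : R)^'+ ell 0.
Proof.
rewrite (_ : 0 = - 0 - 0 + 2 * 0 :> R[i]); last by ring.
by apply: cvgcD; [apply: cvgcB; [apply: cvgcN|]|apply: cvgcZ]; exact: iint_cvg0.
Qed.

Lemma cvgc_cexp (T : Type) (F : set_system T) {FF : ProperFilter F} (f : T -> R[i]) c :
  cvgc F f c -> cvgc F (fun x : T => cexp (f x)) (cexp c).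
Proof.
move=> [h1 h2]; split; apply: cvgM.
- exact: (cvg_comp _ _ h1 (@continuous_expR R _)).
- exact: (cvg_comp _ _ h2 (@continuous_cos R _)).
- exact: (cvg_comp _ _ h1 (@continuous_expR R _)).
- exact: (cvg_comp _ _ h2 (@continuous_sin R _)).
Qed.

Lemma one_sub_r_neq0 r : 0 <= r < 1 -> 1 - r%:C != 0 :> R[i].
Proof. by move=> /(one_sub_zetaX_neq0 0); rewrite expr0 mul1r. Qed.

Lemma one_sub_zr_neq0 r : 0 <= r < 1 -> 1 - zeta * r%:C != 0 :> R[i].
Proof. by move=> /(one_sub_zetaX_neq0 1); rewrite expr1. Qed.

Lemma one_sub_z2r_neq0 r : 0 <= r < 1 -> 1 - zeta ^+ 2 * r%:C != 0 :> R[i].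
Proof. exact: one_sub_zetaX_neq0. Qed.

Lemma derc_lin (c : R[i]) r : derc (fun t => 1 - c * t%:C) r (- c).
Proof.
apply: derc_eq (dercB (derc_cst 1 r) (dercZ c (derc_real (is_derive_id r (1 : R))))).
by rewrite rmorph1 mulr1 sub0r.
Qed.

Lemma derc_lin1 r : derc (fun t => 1 - t%:C : R[i]) r (- 1).
Proof.
apply: derc_eq (dercB (derc_cst 1 r) (derc_real (is_derive_id r (1 : R)))).
by rewrite rmorph1 sub0r.
Qed.

Lemma derc_yfun r : 0 <= r < 1 -> derc yfun r (dell r * yfun r).
Proof.
move=> r01; have n0 := one_sub_r_neq0 r01; have n1 := one_sub_zr_neq0 r01; have n2 := one_sub_z2r_neq0 r01.
have n1' : (1 - zeta * r%:C) ^+ 2 != 0 :> R[i] by rewrite expf_neq0.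
apply: derc_eq (dercM (dercM (derc_lin1 r) (derc_lin (zeta ^+ 2) r))
  (dercV n1' (dercX 2 (derc_lin zeta r)))).
rewrite /dell /yfun /letter_form expr0 expr1 !mul1r.
by field; rewrite n0 n1 n2.
Qed.

Lemma cexp_ell r : 0 < r < 1 -> cexp (ell r) = yfun r.
Proof.
move=> r01.
suff h : yfun r * cexp (- ell r) = 1.
  by apply: (mulIf (cexp_neq0 (- ell r))); rewrite h -cexpD subrr cexp0.
move: r r01; apply: (@derc0_cvg_right R (fun r => yfun r * cexp (- ell r))) => [r r01|].
  apply: derc_eq (dercM (derc_yfun _) (derc_cexp (dercN (derc_ell r01)))).
    by ring.
  by case/andP: r01 => /ltW ->.
rewrite -[X in cvgc _ _ X](mulr1 1); apply: cvgcM; last first.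
  have h : cvgc (0 : R)^'+ (fun t => cexp (- ell t)) (cexp (- 0)).
    by apply: cvgc_cexp; apply: cvgcN; exact: ell_cvg0.
  by move: h; rewrite oppr0 cexp0.
have y0 : yfun 0 = 1 :> R[i].
  by rewrite /yfun (_ : 0%:C = 0 :> R[i])// !mulr0 !subr0 expr1n divr1 mulr1.
have /derc_continuous : derc yfun 0 (dell 0 * yfun 0) by apply: derc_yfun; rewrite lexx ltr01.
by rewrite y0 => -[h1 h2]; split; apply: cvg_at_right_filter.
Qed.

Lemma normc_one_sub_zr r : 0 <= r -> 1 <= normc (1 - zeta * r%:C : R[i]).
Proof.
move=> r0; apply: le_trans (ler_normc_Re _); apply: le_trans (ler_norm _).
by rewrite /zeta /=; lra.
Qed.

Lemma normc_one_sub_z2r r : normc (1 - zeta ^+ 2 * r%:C : R[i]) = normc (1 - zeta * r%:C : R[i]).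
Proof.
rewrite -zeta_conj -[RHS]normc_conj; congr normc.
by apply: complexP; rewrite /zeta /=; ring.
Qed.

(** The factors [1 - zeta r] and [1 - zeta^2 r] are conjugate, so the modulus is
    [(1 - r) / |1 - zeta r|], with a denominator at least 1. *)
Lemma normc_yfun_le r : 0 <= r < 1 -> normc (yfun r) <= 1 - r.
Proof.
move=> /andP[r0 r1]; have h := normc_one_sub_zr r0.
have h0 : 0 < normc (1 - zeta * r%:C : R[i]) by apply: lt_le_trans h.
have e : normc (1 - r%:C : R[i]) = 1 - r.
  rewrite (_ : 1 - r%:C = (1 - r)%:C :> R[i]); last by rewrite rmorphB rmorph1.
  by rewrite normc_real ger0_norm// subr_ge0 ltW.
rewrite !normcM normcV normcX normc_one_sub_z2r e expr2 invfM mulrA mulfK ?gt_eqF//.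
by rewrite ler_pdivrMr// ler_peMr// subr_ge0 ltW.
Qed.

Lemma one_sub_yfun r : 0 <= r < 1 ->
  1 - yfun r = - (3 * zeta * r%:C) / (1 - zeta * r%:C) ^+ 2.
Proof.
move=> r01; have n1 := one_sub_zr_neq0 r01.
rewrite /yfun; apply: (mulIf (expf_neq0 2 n1)).
rewrite mulrBl !divfK ?expf_neq0// mul1r.
have h := @zeta_quad R; have : r%:C * (zeta ^+ 2 + zeta + 1) = 0 :> R[i] by rewrite h mulr0.
by move=> h'; apply/eqP; rewrite -subr_eq0 -[X in _ == X]h'; apply/eqP; ring.
Qed.

Definition liy_term p n r : R[i] := yfun r ^+ n.+1 / n.+1%:R ^+ p.

(** This is [Li_p (yfun r)]. Dividing [yfun r] by [1 - r] leaves coefficients of modulus at most 1,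
    so that the results on [cps] apply at the real point [1 - r]; the outer factor makes up for the
    exponent [n + 1]. *)
Definition liy p r : R[i] :=
  (1 - r)%:C * cps (fun n => (yfun r / (1 - r)%:C) ^+ n.+1 / n.+1%:R ^+ p) (1 - r).

Lemma normc_invXn n p : normc ((n.+1%:R ^+ p)^-1 : R[i]) <= 1.
Proof.
rewrite normcV normcX normc_natr invf_le1 ?exprn_gt0 ?ltr0n//.
by rewrite exprn_ege1// ler1n.
Qed.

Lemma liy_cvg p r : 0 < r < 1 ->
  cvgc \oo (fun n => \sum_(0 <= k < n) liy_term p k r) (liy p r).
Proof.
move=> /andP[r0 r1]; have s0 : 0 < 1 - r by rewrite subr_gt0.
have s0' : (1 - r)%:C != 0 :> R[i] by rewrite (inj_eq (@complexI R)) gt_eqF.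
pose a n : R[i] := (yfun r / (1 - r)%:C) ^+ n.+1 / n.+1%:R ^+ p.
have ha n : normc (a n) <= 1.
  rewrite normcM -[leRHS]mulr1; apply: ler_pM; rewrite ?normc_ge0 ?normc_invXn//.
  rewrite normcX exprn_ile1 ?normc_ge0// normcM normcV normc_real gtr0_norm//.
  by rewrite ler_pdivrMr// mul1r normc_yfun_le// ltW.
have s01 : 0 < 1 - r < 1 by rewrite s0 gtrBl.
apply: near_eq_cvgc (cvgcZ (1 - r)%:C (cvg_cps (bounded_tempered ha) s01)).
apply: nearW => n; rewrite mulr_sumr; apply: eq_bigr => k _.
rewrite /a /liy_term; set s := (1 - r)%:C in s0' *; set y := yfun r.
rewrite !exprS expr_div_n; have h1 := expf_neq0 k s0'.
have h2 : k.+1%:R ^+ p != 0 :> R[i] by rewrite expf_neq0// pnatr_eq0.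
move: (_ ^+ p) s y (s ^+ k) (y ^+ k) h1 h2 s0' => N s' y' S Y h1 h2 s0'.
by field; do ?[apply/andP; split].
Qed.

Lemma liy_tail p r n : 0 < r < 1 ->
  normc (liy p r - \sum_(0 <= k < n) liy_term p k r) <= (1 - r) ^+ n.+1 / r.
Proof.
move=> r01; have /andP[r0 r1] := r01.
have h : cvgc \oo (fun m => \sum_(0 <= k < m + n) liy_term p k r -
    \sum_(0 <= k < n) liy_term p k r) (liy p r - \sum_(0 <= k < n) liy_term p k r).
  apply: cvgcB; last exact: cvgc_cst.
  elim: n => [|n IH]; first by under eq_fun do rewrite addn0; exact: liy_cvg.
  by under eq_fun do rewrite addnS -addSn; exact: (cvgc_shiftS IH).
apply: (cvgc_normc_le h) => m.
have -> : \sum_(0 <= k < m + n) liy_term p k r =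
    \sum_(0 <= k < n) liy_term p k r + \sum_(n <= k < m + n) liy_term p k r.
  by rewrite -big_cat_nat ?leq_addl.
rewrite addrAC subrr add0r.
apply: le_trans (ler_normc_sum _ _ _) _.
have s0 : 0 <= 1 - r by rewrite subr_ge0 ltW.
apply: le_trans (_ : \sum_(n <= i < m + n) (1 - r) ^+ i.+1 <= _).
  apply: ler_sum => i _; rewrite normcM -[leRHS]mulr1.
  apply: ler_pM; rewrite ?normc_ge0 ?normc_invXn// normcX lerXn2r ?nnegrE ?normc_ge0//.
  by rewrite normc_yfun_le// ltW.
rewrite -{1}[n]add0n big_addn addnK.
rewrite (eq_bigr (fun i => (1 - r) ^+ n.+1 * (1 - r) ^+ i)); last first.
  by move=> i _; rewrite -exprD addSn addnC.
rewrite -mulr_sumr ler_wpM2l ?exprn_ge0//.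
rewrite [in leRHS](_ : r = 1 - (1 - r)); last by ring.
by rewrite sum_geometric_le// s0 gtrBl.
Qed.

Lemma liy_le p r : 0 < r < 1 -> normc (liy p r) <= (1 - r) / r.
Proof.
by move=> /(liy_tail p 0); rewrite big_nil subr0 expr1.
Qed.

Lemma liy_cvg1 p : cvgc (1 : R)^'- (liy p) 0.
Proof.
apply: (@cvgc_le _ _ _ _ _ _ (fun r => 2 * (1 - r))).
  near=> r; rewrite subr0.
  have r1 : r < 1 by near: r; exact: nbhs_left_lt.
  have r2 : 1 / 2 < r by near: r; apply: nbhs_left_gt; lra.
  apply: le_trans (liy_le _ _) _; first by lra.
  rewrite ler_pdivrMr; last by lra.
  have : 0 <= (1 - r) * (2 * r - 1) by apply: mulr_ge0; lra.
  by lra.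
apply: cvg_at_left_filter; rewrite -[X in _ --> X](mulr0 2) -[X in 2 * X](subrr 1).
by apply: cvgM; [exact: cvg_cst|apply: cvgB; [exact: cvg_cst|exact: cvg_id]].
Unshelve. all: by end_near. Qed.

Lemma liy0 r : 0 < r < 1 -> liy 0 r = yfun r / (1 - yfun r).
Proof.
move=> r01; have /andP[r0 r1] := r01; have r01' : 0 <= r < 1 by rewrite ltW.
have ny : 1 - yfun r != 0.
  rewrite one_sub_yfun// mulf_neq0//; last first.
    by rewrite invr_neq0// expf_neq0// one_sub_zr_neq0.
  rewrite oppr_eq0 !mulf_neq0 ?pnatr_eq0//.
    by rewrite -normc_eq0 normc_zeta oner_eq0.
  by rewrite (inj_eq (@complexI R)) gt_eqF.
have h : cvgc \oo (fun n => (yfun r - yfun r ^+ n.+1) / (1 - yfun r)) (yfun r / (1 - yfun r)).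
  rewrite -[X in cvgc _ _ (X / _)]subr0.
  under eq_fun do rewrite mulrC.
  rewrite mulrC; apply: cvgcZ; apply: cvgcB; first exact: cvgc_cst.
  apply: (@cvgc_le _ _ _ _ _ _ (fun n => (1 - r) ^+ n)).
    apply: nearW => n; rewrite subr0 normcX exprSr.
    have h1 := normc_yfun_le r01'; have h0 := normc_ge0 (yfun r).
    apply: le_trans (_ : normc (yfun r) ^+ n * 1 <= _).
      by rewrite ler_wpM2l ?exprn_ge0//; lra.
    by rewrite mulr1 lerXn2r ?nnegrE//; lra.
  apply: cvg_expr; rewrite ger0_norm; lra.
apply: (cvgc_unique (liy_cvg 0 r01)); apply: near_eq_cvgc h; apply: nearW => n.
apply: (mulIf ny); rewrite divfK//; elim: n => [|n IH].
  by rewrite big_nil mul0r expr1 subrr.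
rewrite big_nat_recr//= mulrDl -IH /liy_term expr0 divr1 !exprS; ring.
Qed.

Lemma normc_letter_form_le j r : 0 <= r < 1 ->
  normc (letter_form (Some j) r : R[i]) <= (1 - r)^-1.
Proof.
move=> /andP[r0 r1]; have s0 : 0 < 1 - r by rewrite subr_gt0.
rewrite normcM normc_zetaX mul1r normcV lef_pV2 ?posrE//; last first.
  by rewrite lt_def normc_ge0 normc_eq0 one_sub_zetaX_neq0// r0.
have : normc (1 : R[i]) <= normc (1 - zeta ^+ j * r%:C : R[i]) + normc (zeta ^+ j * r%:C : R[i]).
  by rewrite -{1}(subrK (zeta ^+ j * r%:C) 1) le_normcD.
rewrite normc1 normcM normc_zetaX mul1r normc_real ger0_norm//.
by lra.
Qed.

Lemma dlogv_le r : 0 <= r < 1 -> normc (dlogv r) <= 2 / (1 - r).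
Proof.
move=> r01; apply: le_trans (le_normcD _ _) _; rewrite normcN.
by have := normc_letter_form_le 0 r01; have := normc_letter_form_le 2 r01; lra.
Qed.

Lemma dell_le r : 0 < r < 1 -> normc (dell r) <= 4 / (1 - r).
Proof.
move=> /andP[r0 r1]; have h j := normc_letter_form_le j (_ : 0 <= r < 1).
have {}h j : normc (letter_form (Some j) r : R[i]) <= (1 - r)^-1.
  by apply: h; rewrite ltW.
rewrite /dell (_ : 2 * letter_form (Some 1%N) r =
  letter_form (Some 1%N) r + letter_form (Some 1%N) r); last by ring.
apply: le_trans (le_normcD _ _) _; apply: le_trans (lerD (le_normcD _ _) (le_normcD _ _)) _.
rewrite !normcN.
have := h 0%N; have := h 1%N; have := h 2; lra.
Qed.

(* The partial sums have derivatives [dell * S_n] converging uniformly on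
   compact subintervals. *)
Lemma liy_primitive p (G : R -> R[i]) :
  (forall r, 0 < r < 1 -> derc G r (dell r * liy p r)) ->
  forall r s, 0 < r < 1 -> 0 < s < 1 -> liy p.+1 r - G r = liy p.+1 s - G s.
Proof.
move=> dG.
suff H a b : 0 < a < 1 -> 0 < b < 1 -> a <= b -> liy p.+1 a - G a = liy p.+1 b - G b.
  move=> r s hr hs; have [rs|sr] := leP r s; first exact: H.
  by symmetry; apply: H => //; exact: ltW.
move=> a01 b01 ab; have /andP[a0 a1] := a01; have /andP[b0 b1] := b01.
pose S n r : R[i] := \sum_(0 <= k < n) liy_term p.+1 k r.
pose T n r : R[i] := \sum_(0 <= k < n) liy_term p k r.
have dS n r : 0 < r < 1 -> derc (S n) r (dell r * T n r).
  move=> r01; have r01' : 0 <= r < 1 by case/andP: r01 => /ltW ->.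
  rewrite /T mulr_sumr; apply: derc_sum => k _.
  have k0 : k.+1%:R != 0 :> R[i] by rewrite pnatr_eq0.
  apply: derc_eq; last first.
    by apply: (dercM (dercX k.+1 (derc_yfun r01')) (derc_cst ((k.+1%:R ^+ p.+1)^-1) r)).
  rewrite /liy_term mulr0 addr0 /= [yfun r ^+ k.+1]exprS [_ ^+ p.+1]exprS.
  have k1 := expf_neq0 p k0; move: (_ ^+ p) k1 => N k1.
  by move: (k.+1%:R : R[i]) k0 => M k0; field; rewrite ?k0 ?k1.
apply/eqP; rewrite -subr_eq0; apply/eqP.
apply: (@cvgc_unique R nat \oo _ (fun n => (S n a - G a) - (S n b - G b))).
  by apply: cvgcB; apply: cvgcB; [exact: liy_cvg|exact: cvgc_cst|exact: liy_cvg|exact: cvgc_cst].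
apply: (@cvgc_le _ _ _ _ _ _ (fun n => 4 / (1 - b) * (b - a) / a * (1 - a) ^+ n)).
  apply: nearW => n; rewrite subr0 normcB.
  pose K := 4 / (1 - b) * ((1 - a) ^+ n.+1 / a).
  have K0 : 0 <= K.
    rewrite mulr_ge0// ?divr_ge0 ?exprn_ge0//; lra.
  apply: le_trans (_ : K * b - K * a <= _).
    apply: (@derc_mean_value R (fun r => S n r - G r) (fun r => dell r * T n r - dell r * liy p r)
      (fun r => K * r) (fun=> K) a b ab) => t /andP[at_ tb].
    - have t01 : 0 < t < 1 by rewrite (lt_le_trans a0 at_) (le_lt_trans tb b1).
      by apply: dercB; [exact: dS|exact: dG].
    - have := is_deriveZ K (is_derive_id t (1 : R)).
      by move=> h; apply: (is_derive_eq h); rewrite /GRing.scale /= mulr1.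
    - have t0 : 0 < t := lt_le_trans a0 at_.
      have t01 : 0 < t < 1 by rewrite t0 (le_lt_trans tb b1).
      rewrite -mulrBr normcM; apply: ler_pM; rewrite ?normc_ge0//.
        apply: le_trans (dell_le t01) _; rewrite ler_wpM2l// lef_pV2 ?posrE; lra.
      rewrite normcB; apply: le_trans (liy_tail p n t01) _.
      apply: ler_pM; rewrite ?exprn_ge0 ?invr_ge0 ?(ltW t0)//; first by lra.
        by rewrite lerXn2r ?nnegrE//; lra.
      by rewrite lef_pV2.
  rewrite -mulrBr /K exprS.
  have : 0 <= 4 / (1 - b) * (b - a) / a * (1 - a) ^+ n * a.
    rewrite !mulr_ge0 ?invr_ge0 ?exprn_ge0 ?(ltW a0)//; lra.
  set P := (1 - a) ^+ n => hP.
  have -> : 4 / (1 - b) * ((1 - a) * P / a) * (b - a) =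
    4 / (1 - b) * (b - a) / a * P - 4 / (1 - b) * (b - a) / a * P * a by ring.
  by lra.
rewrite -[X in _ --> X](mulr0 (4 / (1 - b) * (b - a) / a)); apply: cvgM; first exact: cvg_cst.
apply: cvg_expr; rewrite ger0_norm; lra.
Qed.

(** A primitive determines [Li_(p+1)(y)] up to a constant, which is read off at [r = 1], where
    [y = 0] and the polylogarithm vanishes: minus the constant is the limit of the primitive there,
    and [polylogs_limit] puts it in the span. *)
Lemma polylogs_liy p : polylogs p.+1 (liy p.+1).
Proof.
have step q G : polylogs q.+1 G -> (forall r, 0 < r < 1 -> derc G r (dell r * liy q r)) ->
    polylogs q.+1 (liy q.+1).
  move=> hG dG; pose k : R[i] := liy q.+1 (1 / 2) - G (1 / 2).
  have h01 : 0 < (1 / 2 : R) < 1 by lra.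
  have hk r : 0 < r < 1 -> liy q.+1 r = k + G r.
    by move=> r01; rewrite /k -(liy_primitive dG r01 h01) subrK.
  have Gk : cvgc (1 : R)^'- G (0 - k).
    apply: near_eq_cvgc (_ : cvgc _ (fun r => liy q.+1 r - k) _); last first.
      by apply: cvgcB; [exact: liy_cvg1|exact: cvgc_cst].
    near=> r; rewrite hk ?addKr// ?addrK; last first.
      by apply/andP; split; near: r; [exact: nbhs_left_gt|exact: nbhs_left_lt].
    by rewrite addrC addKr.
  have vk : wvals q.+1 k.
    by rewrite -[k]opprK; apply: wvalsN; rewrite -sub0r; exact: polylogs_limit hG Gk.
  apply: polylogs_eq (polylogsD (polylogs_cst vk) hG) => r r01.
  by rewrite hk.
elim: p => [|p IH].
  (* Up to the constant [log (- 3 zeta)] this is [- log (1 - y)], read off the factorization in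
     [one_sub_yfun]. *)
  apply: (@step 0%N (fun r => - (ln r)%:C - 2 * iint [:: Some 1%N] r)).
    apply: polylogsD.
      apply: polylogsN; apply: polylogs_eq (polylogs_word 1 wvals1 (W := [::]) isT).
      by move=> r r01; rewrite iint_nil// mulr1 mul1r expr1.
    apply: polylogsN; rewrite -[1%N]add0n; apply: polylogsZ; first exact: wvals_nat.
    exact: (@polylogs_iint R [:: Some 1%N]).
  move=> r r01; have /andP[r0 r1] := r01; have r01' : 0 <= r < 1 by rewrite ltW.
  apply: derc_eq (dercB (dercN (derc_ln r0)) (dercZ 2 (@derc_iint R (Some 1%N) [::] r isT r01))).
  rewrite iint_nil// liy0// one_sub_yfun// /dell /yfun /letter_form expr0 expr1 !mul1r mulr1.
  have n0 := one_sub_r_neq0 r01'; have n1 := one_sub_zr_neq0 r01'; have n2 := one_sub_z2r_neq0 r01'.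
  have rC0 : r%:C != 0 by rewrite (inj_eq (@complexI R)) gt_eqF.
  have z0 : zeta != 0 :> R[i] by rewrite -normc_eq0 normc_zeta oner_eq0.
  have h3 : 3 != 0 :> R[i] by rewrite pnatr_eq0.
  have e : zeta ^+ 2 = - zeta - 1 :> R[i] := zeta_sqr.
  rewrite e in n2 *.
  have e3 : zeta ^+ 3 = 1 :> R[i] := zeta3.
  have q : zeta ^+ 2 + zeta + 1 = 0 :> R[i] := zeta_quad.
  move: (zeta : R[i]) (r%:C : R[i]) z0 rC0 n0 n1 n2 e q => z x z0 rC0 n0 n1 n2 e q.
  (* Cleared of this denominator, the two sides differ by [- 2 x (z^2 + z + 1)]. *)
  have nD : 3 * z * x * (1 - z * x) != 0 by rewrite !mulf_neq0.
  apply: (mulIf nD).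
  transitivity (- (3 * z + 3 * z ^+ 2 * x)); first by field; rewrite ?rC0 ?n1.
  transitivity (- (3 * z - 2 * x - 2 * z * x + z ^+ 2 * x)); last first.
    by field; rewrite ?rC0 ?n1 ?n0 ?n2 ?z0 ?h3.
  apply/eqP; rewrite -subr_eq0; apply/eqP.
  by rewrite -[RHS](mulr0 (- 2 * x)) -q; ring.
have [G0 [h0 _ d0]] := polylogs_primitive 0 IH.
have [G1 [h1 _ d1]] := polylogs_primitive 1 IH.
have [G2 [h2 _ d2]] := polylogs_primitive 2 IH.
apply: (@step _ (fun r => - G0 r - G2 r + 2 * G1 r)).
  apply: polylogsD; first by apply: polylogsD; exact: polylogsN.
  by rewrite -[p.+2]add0n; apply: polylogsZ => //; exact: wvals_nat.
move=> r r01.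
apply: derc_eq (dercD (dercB (dercN (d0 r r01)) (d2 r r01)) (dercZ 2 (d1 r r01))).
by rewrite /dell; ring.
Unshelve. all: by end_near. Qed.

Lemma polylogs_integral p i : exists G, [/\ polylogs (p.+1 + i).+1 G, cvgc (0 : R)^'+ G 0 &
  forall r, 0 < r < 1 -> derc G r (liy p.+1 r * ell r ^+ i * dlogv r)].
Proof.
have h : polylogs (p.+1 + i) (fun r => liy p.+1 r * ell r ^+ i).
  apply: polylogsM; first exact: polylogs_liy.
  by apply: polylogs_weight (polylogsX i polylogs_ell); rewrite muln1.
have [G0 [h0 c0 d0]] := polylogs_primitive 0 h.
have [G2 [h2 c2 d2]] := polylogs_primitive 2 h.
exists (fun r => G0 r - G2 r); split.
- by apply: polylogsD => //; exact: polylogsN.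
- by rewrite -[X in cvgc _ _ X](subrr 0); exact: cvgcB.
- move=> r r01; apply: derc_eq (dercB (d0 r r01) (d2 r r01)).
  by rewrite /dlogv; ring.
Qed.

End polylogs_of_y.

(** * Cyclotomic multiple zeta values *)

Section cyclotomic_values.
Context {R : realType}.
Implicit Types (W : seq (option nat)) (s : seq (nat * R[i])) (l m t a : nat).

Fixpoint nested s l : R[i] :=
  if s is x :: s' then
    if l == 0%N then 0 else x.2 ^+ l / l%:R ^+ x.1 * \sum_(0 <= m < l) nested s' m
  else (l == 0%N)%:R.

(* The word [x_0^(a_1 - 1) x_(s_1) x_0^(a_2 - 1) x_(s_2) ...] corresponds to
   [z_1 = s_1, z_2 = s_2 / s_1, ...]; [a] counts the letters [x_0] already read
   and [t] is the exponent of the inverse of the previous [s_i]. *)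
Fixpoint word_index a t W : seq (nat * R[i]) :=
  match W with
  | [::] => [::]
  | None :: W' => word_index a.+1 t W'
  | Some j :: W' => (a.+1, zeta ^+ (t + j)) :: word_index 0 (2 * j) W'
  end.

Lemma zetaX_3 j : zeta ^+ (3 * j) = 1 :> R[i].
Proof. by rewrite exprM zeta3 expr1n. Qed.

(** As [zeta^(- 1) = zeta^2], one has [zeta^(j (l - m)) = zeta^(j l) zeta^(2 j m)]: the factor in
    [m] passes to the next entry of the index, where [t] records it. A pending exponent [a > 0]
    needs a further letter to be attached to, hence the condition on [size W]. *)
Lemma nested_word_index W a t l : conv_word W -> (0 < size W)%N || (a == 0%N) ->
  nested (word_index a t W) l = zeta ^+ (t * l) * coef W l / l%:R ^+ a.
Proof.
elim: W a t l => [|[j|] W IH] a t l cW h.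
- move: h => /= /eqP ->; rewrite expr0 divr1; case: eqP => [->|_].
    by rewrite muln0 expr0 mulr1.
  by rewrite mulr0.
- rewrite /=; case: eqP => [->|/eqP l0]; first by rewrite mulr0 mul0r.
  have cW' := conv_word_tail cW.
  have -> : \sum_(0 <= m < l) nested (word_index 0 (2 * j) W) m =
      \sum_(0 <= m < l) zeta ^+ (2 * j * m) * coef W m.
    by apply: eq_bigr => m _; rewrite IH ?orbT// expr0 divr1.
  have -> : \sum_(0 <= m < l) zeta ^+ (j * (l - m)) * coef W m =
      zeta ^+ (j * l) * (\sum_(0 <= m < l) zeta ^+ (2 * j * m) * coef W m) :> R[i].
    rewrite big_distrr /= !big_nat; apply: eq_bigr => m /andP[_ ml].
    rewrite mulrA -exprD; congr (_ * _).
    have -> : (j * l + 2 * j * m = j * (l - m) + 3 * (j * m))%N.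
      by rewrite -{1}(subnK (ltnW ml)); lia.
    by rewrite exprD zetaX_3 mulr1.
  rewrite -exprM mulnDl exprD exprS invfM; move: (\sum_(0 <= m < l) _) => S.
  by move: (_^-1) (_^-1) => N M; ring.
- have cW' := conv_word_tail cW.
  rewrite [word_index _ _ _]/= IH //; last by case: W cW {IH h cW'}.
  rewrite [coef (None :: W) l]/=; case: eqP => [l0|/eqP l0].
    rewrite l0 mulr0 mul0r; case: W cW {IH h cW'} => // b W _.
    by rewrite coef_cons0 mulr0 mul0r.
  by rewrite exprS invfM !mulrA; ring.
Qed.

Lemma sumn_word_index W a t : conv_word W -> (0 < size W)%N || (a == 0%N) ->
  sumn [seq x.1 | x <- word_index a t W] = (a + size W)%N.
Proof.
elim: W a t => [|[j|] W IH] a t cW h /=.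
- by move: h => /= /eqP ->.
- by rewrite IH ?orbT ?(conv_word_tail cW)// add0n addSnnS.
- by rewrite IH ?addSnnS//; case: W cW {IH h}.
Qed.

Lemma word_index_pos W a t x : x \in word_index a t W -> (0 < x.1)%N /\ x.2 ^+ 3 = 1.
Proof.
elim: W a t => [|[j|] W IH] a t //=; last exact: IH.
rewrite inE => /orP[/eqP -> /=|]; last exact: IH.
by split=> //; rewrite -exprM mulnC zetaX_3.
Qed.

Lemma word_index_neq0 W a t : conv_word W -> (0 < size W)%N -> word_index a t W != [::].
Proof.
elim: W a t => [|[j|] W IH] a t //= cW _.
by apply: IH; [exact: conv_word_tail cW|case: W cW].
Qed.

(** Used with [a = 1]: a word starting with [None] has first exponent at least 2, which excludes the
    divergent pair (1, 1). *)
Lemma head_word_index W a t x : (a < (head x (word_index a t W)).1)%N ||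
  (word_index a t W == [::]).
Proof.
elim: W a t => [|[j|] W IH] a t /=; first by rewrite orbT.
  by rewrite ltnSn.
by have /orP[/ltnW ->//|->] := IH a.+1 t; rewrite orbT.
Qed.

Definition cons_ffun n (T : finType) (k : T) (l : {ffun 'I_n -> T}) : {ffun 'I_n.+1 -> T} :=
  [ffun j => if unlift ord0 j is Some i then l i else k].

Definition tail_ffun n (T : finType) (l : {ffun 'I_n.+1 -> T}) : {ffun 'I_n -> T} :=
  [ffun i => l (lift ord0 i)].

Lemma cons_ffun0 n (T : finType) (k : T) (l : {ffun 'I_n -> T}) : cons_ffun k l ord0 = k.
Proof. by rewrite ffunE unlift_none. Qed.

Lemma cons_ffunS n (T : finType) (k : T) (l : {ffun 'I_n -> T}) i :
  cons_ffun k l (lift ord0 i) = l i.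
Proof. by rewrite ffunE liftK. Qed.

Lemma cons_ffunK n (T : finType) (k : T) (l : {ffun 'I_n -> T}) : tail_ffun (cons_ffun k l) = l.
Proof. by apply/ffunP => i; rewrite ffunE cons_ffunS. Qed.

Lemma tail_ffunK n (T : finType) (l : {ffun 'I_n.+1 -> T}) : cons_ffun (l ord0) (tail_ffun l) = l.
Proof.
apply/ffunP => i; case: (unliftP ord0 i) => [j ->|->].
  by rewrite cons_ffunS ffunE.
by rewrite cons_ffun0.
Qed.

(** The bound [B] fixes the type of the indices, while [K] limits their values: the recursion on the
    tail lowers [K] to the leading index and keeps the type. *)
Definition decreasing n B K (l : {ffun 'I_n -> 'I_B}) :=
  [forall j : 'I_n, (0 < l j < K)%N] &&
  [forall i : 'I_n, forall j : 'I_n, (i < j)%N ==> (l j < l i)%N].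

Lemma decreasing_cons n B K (k : 'I_B) (l : {ffun 'I_n -> 'I_B}) :
  decreasing K (cons_ffun k l) = (0 < k < K)%N && decreasing k l.
Proof.
apply/idP/idP => [/andP[/forallP h1 /forallP h2]|/andP[hk /andP[/forallP h1 /forallP h2]]].
  have hk := h1 ord0; rewrite cons_ffun0 in hk; rewrite hk /=.
  apply/andP; split; apply/forallP => i.
    have := h1 (lift ord0 i); rewrite cons_ffunS => /andP[-> _] /=.
    by have /forallP/(_ (lift ord0 i))/implyP := h2 ord0; rewrite cons_ffun0 cons_ffunS; exact.
  apply/forallP => j; apply/implyP => ij.
  have /forallP/(_ (lift ord0 j))/implyP := h2 (lift ord0 i).
  by rewrite !cons_ffunS; apply; rewrite /= /bump /= !add1n ltnS.
apply/andP; split; apply/forallP => i.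
  case: (unliftP ord0 i) => [j ->|->]; last by rewrite cons_ffun0.
  rewrite cons_ffunS; have /andP[-> h] := h1 j.
  by rewrite (ltn_trans h)//; case/andP: hk.
apply/forallP => j; apply/implyP; case: (unliftP ord0 j) => [j' ->|-> //].
case: (unliftP ord0 i) => [i' ->|->]; rewrite ?cons_ffunS ?cons_ffun0.
  rewrite /= /bump /= !add1n ltnS => ij.
  by have /forallP/(_ j')/implyP := h2 i'; apply.
by move=> _; have /andP[] := h1 j'.
Qed.

Lemma sum_nested s B K : (0 < K <= B)%N ->
  \sum_(l : {ffun 'I_(size s) -> 'I_B} | decreasing K l)
    \prod_(j < size s) ((nth (0%N, 0) s j).2 ^+ l j / (l j)%:R ^+ (nth (0%N, 0) s j).1) =
  \sum_(0 <= k < K) nested s k.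
Proof.
elim: s K => [|x s IH] K /andP[K0 KB].
  rewrite (big_pred1 (finfun (fun i : 'I_0 => False_rect 'I_B (notF (ltn_ord i))))).
    rewrite big_ord0 -(prednK K0) big_nat_recl//= big1 ?addr0// => i _.
  move=> l; have -> : decreasing K l by apply/andP; split; apply/forallP => -[].
  by symmetry; apply/eqP/ffunP => -[].
pose F (k : 'I_B) : R[i] := x.2 ^+ k / k%:R ^+ x.1.
transitivity (\sum_(k : 'I_B | (0 < k < K)%N) F k * \sum_(0 <= m < k) nested s m).
  rewrite (partition_big (fun l : {ffun 'I_(size s).+1 -> 'I_B} => l ord0)
    (fun k : 'I_B => (0 < k < K)%N)) /=; last first.
    by move=> l /andP[/forallP/(_ ord0)].
  apply: eq_bigr => k hk; have /andP[k0 kK] := hk.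
  rewrite -IH; last by rewrite k0 (leq_trans (ltnW kK)).
  rewrite (reindex_onto (@cons_ffun _ _ k) (@tail_ffun _ _)); last first.
    by move=> l /andP[_ /eqP <-]; exact: tail_ffunK.
  rewrite big_distrr /=; apply: eq_big => [l|l _].
    by rewrite decreasing_cons hk cons_ffun0 cons_ffunK !eqxx !andbT.
  rewrite big_ord_recl cons_ffun0 /=; congr (_ * _).
  by apply: eq_bigr => i _; rewrite cons_ffunS.
rewrite -(big_mkord (fun k => (0 < k < K)%N)
  (fun k => x.2 ^+ k / k%:R ^+ x.1 * \sum_(0 <= m < k) nested s m)).
rewrite (@big_cat_nat _ _ _ K)//= [X in _ + X]big1_seq; last first.
  move=> k; rewrite mem_index_iota => /andP[/andP[_ h] /andP[h' _]].
  by move: h; rewrite ltnNge h'.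
rewrite addr0 big_mkcond /= !big_nat; apply: eq_bigr => k /andP[_ kK].
by rewrite kK andbT lt0n; case: eqP => //= ->.
Qed.

Lemma Li_partial_nested s L (n : nat) : size s = n.+1 ->
  Li_partial (fun j : 'I_n.+1 => (nth (0%N, 0) s j).1)
    (fun j : 'I_n.+1 => (nth (0%N, 0) s j).2) L = \sum_(0 <= k < L.+1) nested s k.
Proof.
move=> e; rewrite -(@sum_nested s L.+1 L.+1) ?leqnn// /Li_partial.
rewrite e; apply: eq_bigl => l; rewrite /decreasing; congr (_ && _).
by apply/forallP/forallP => h j; have := h j; rewrite ltn_ord andbT.
Qed.

Lemma cvgc_limn (u : nat -> R[i]) c : cvgc \oo u c -> limn (u : nat -> R[i]^o) = c.
Proof.
move=> /cvgc_normc h; apply: cvg_lim => //.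
apply/cvgrPdist_lt => e e0.
(* In the order of [R[i]] a positive element is real, which reduces the limit to the real one of the
   modulus. *)
have [er e_] : 0 < Re e /\ e = (Re e)%:C.
  by move: e0; rewrite ltcE /= => /andP[/eqP i0 r0]; split => //; case: e r0 i0 => a b /= _ ->.
have /cvgrPdist_lt/(_ _ er) := h; apply: filterS => n.
rewrite sub0r normrN ger0_norm ?normc_ge0// => hn.
by rewrite e_ distrC normc_def -/(normc _) ltcR; case: (u n - c) hn.
Qed.

Lemma word_val_CMZV W : adm W -> CMZV R (size W) 3 (word_val W).
Proof.
move=> aW; have /andP[cW hW] := aW; have W0 : (0 < size W)%N by case: W aW hW cW.
pose s := word_index 0 0 W.
have s0 := word_index_neq0 0 0 cW W0; rewrite -/s in s0.
have [n en] : exists n, size s = n.+1 by case: s s0 => // x s' _; exists (size s').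
have hs (j : 'I_n.+1) : nth (0%N, 0) s j \in s by rewrite mem_nth// en.
exists n, (fun j : 'I_n.+1 => (nth (0%N, 0) s j).1), (fun j : 'I_n.+1 => (nth (0%N, 0) s j).2).
split.
- by move=> j; have [] := word_index_pos (hs j).
- have := @sumn_word_index W 0 0 cW; rewrite W0 add0n => <-//.
  by rewrite sumnE big_map (big_nth (0%N, 0)) -/s en big_mkord.
- by move=> j; have [] := word_index_pos (hs j).
- rewrite /= /s => -[]; have := s0; rewrite /s.
  case: W aW cW hW W0 s s0 en hs => // -[j|] W aW cW hW _ s _ _ _ s0 h1 h2.
    by have := @zetaX_neq1 R _ hW; move: h2; rewrite /= add0n => ->; rewrite eqxx.
  have := head_word_index W 1 0 (0%N, 0 : R[i]); rewrite -[word_index 1 0 W]/(word_index 0 0 (None :: W)).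
  by rewrite (negbTE s0) orbF; move: h1; rewrite nth0 => ->.
- symmetry; apply: cvgc_limn.
  have := cvgc_shiftS (cvg_word_val aW (R := R)).
  apply: near_eq_cvgc; apply: nearW => L.
  rewrite (Li_partial_nested _ en); apply: eq_bigr => k _.
  by rewrite nested_word_index ?W0// mul0n !expr0 mul1r divr1.
Qed.

Lemma Qspan0 (S : set R[i]) : Qspan S 0.
Proof.
exists 0%N, (fun=> 0), (fun=> 0); split; first by case.
by rewrite big_ord0.
Qed.

Lemma QspanD (S : set R[i]) x y : Qspan S x -> Qspan S y -> Qspan S (x + y).
Proof.
move=> [r [c [v [hv ->]]]] [r' [c' [v' [hv' ->]]]].
exists (r + r')%N, (fun j => match fintype.split j with inl i => c i | inr i => c' i end),
  (fun j => match fintype.split j with inl i => v i | inr i => v' i end); split.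
  by move=> j; case: fintype.split.
rewrite big_split_ord /=; congr (_ + _); apply: eq_bigr => i _.
- by rewrite (unsplitK (inl i : 'I_r + 'I_r')).
- by rewrite (unsplitK (inr i : 'I_r + 'I_r')).
Qed.

Lemma QspanZ (S : set R[i]) q x : Qspan S x -> Qspan S (ratr q * x).
Proof.
move=> [r [c [v [hv ->]]]]; exists r, (fun j => q * c j), v; split => //.
by rewrite big_distrr /=; apply: eq_bigr => j _; rewrite rmorphM /= mulrA.
Qed.

Theorem wvals_frakZ w x : (0 < w)%N -> wvals w x -> frakZ R w 3 x.
Proof.
move=> + h; elim: h => {w x} [w|w x y _ hx _ hy|w q x _ hx||W aW] w0 //.
- exact: Qspan0.
- by apply: QspanD; [exact: hx|exact: hy].
- by apply: QspanZ; exact: hx.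
- exists 1%N, (fun=> 1), (fun=> word_val W); split.
    by move=> _; exact: word_val_CMZV.
  by rewrite big_ord1 rmorph1 mul1r.
Qed.

End cyclotomic_values.

(** * Improper integrals *)

Section exhaustions.
Context {R : realType}.
Local Notation mu := (@lebesgue_measure R).
Implicit Types (D : set R) (a b : nat -> R) (f F G : R -> R).

(** One notion for the line, the half-line and the unit interval: integrals over [D] become limits
    of integrals over segments, where the fundamental theorem of calculus applies. *)
Definition exhausts D a b := [/\ forall n, a n < b n,
  forall n, a n.+1 <= a n /\ b n <= b n.+1 & D = \bigcup_n `[a n, b n]%classic].

Lemma exhausts_sub D a b n : exhausts D a b -> `[a n, b n]%classic `<=` D.
Proof. by move=> [_ _ ->] x h; exists n. Qed.

Lemma exhausts_homo D a b : exhausts D a b ->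
  {homo (fun n => `[a n, b n]%classic) : n m / (n <= m)%N >-> (n <= m)%O}.
Proof.
move=> [_ h _]; apply: homo_leq => [n|x y z|n]; first by [].
  exact: le_trans.
rewrite subsetEset => x /=; rewrite !in_itv /= => /andP[ax xb].
by have [h1 h2] := h n; rewrite (le_trans h1 ax) (le_trans xb h2).
Qed.

Lemma exhausts_measurable D a b : exhausts D a b -> measurable D.
Proof. by move=> [_ _ ->]; apply: bigcup_measurable => n _; exact: measurable_itv. Qed.

Lemma sub_within_continuous D f x y : `[x, y]%classic `<=` D ->
  {in D, continuous f} -> {within `[x, y], continuous f}.
Proof.
move=> xyD cf; apply: continuous_in_subspaceT => t; rewrite inE => ht.
by apply: cf; rewrite inE; exact: xyD.
Qed.

Lemma is_derive_continuous f (x d : R) : is_derive x 1 f d -> {for x, continuous f}.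
Proof. by move=> [h _]; apply: differentiable_continuous; exact/derivable1_diffP. Qed.

Lemma cvge_unique (u : nat -> \bar R) (x y : \bar R) :
  u n @[n --> \oo] --> x -> u n @[n --> \oo] --> y -> x = y.
Proof. by move=> ux uy; rewrite -(cvg_lim _ ux)// -(cvg_lim _ uy). Qed.

Lemma FTC2_segment D f F x y : `[x, y]%classic `<=` D -> x < y ->
  {in D, continuous f} -> (forall t, D t -> is_derive t 1 F (f t)) ->
  (\int[mu]_(t in `[x, y]) (f t)%:E = (F y - F x)%:E)%E.
Proof.
move=> xyD xy cf dF; rewrite EFinB; apply: continuous_FTC2 => //.
- exact: sub_within_continuous cf.
- have cF t : x <= t <= y -> {for t, continuous F}.
    by move=> txy; apply: is_derive_continuous (dF t _); apply: xyD; rewrite /= in_itv.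
  split=> [t||].
  + by rewrite in_itv/= => /andP[xt ty]; have [] := dF t (xyD _ _); rewrite //= in_itv /= !ltW.
  + by apply: cvg_at_right_filter; apply: cF; rewrite lexx ltW.
  + by apply: cvg_at_left_filter; apply: cF; rewrite lexx ltW.
- move=> t; rewrite in_itv/= => /andP[xt ty]; rewrite derive1E.
  have Dt : D t by apply: xyD; rewrite /= in_itv /= !ltW.
  by have [_ ->] := dF t Dt.
Qed.

Lemma ge0_improper_FTC D a b f F (la lb : R) : open D -> exhausts D a b ->
  {in D, continuous f} -> (forall t, D t -> is_derive t 1 F (f t)) ->
  (forall t, D t -> 0 <= f t) ->
  F (a n) @[n --> \oo] --> la -> F (b n) @[n --> \oo] --> lb ->
  (\int[mu]_(t in D) (f t)%:E = (lb - la)%:E)%E.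
Proof.
move=> oD eD cf dF f0 Fa Fb.
have mf : measurable_fun D f by exact: open_continuous_measurable_fun.
have := @ge0_nondecreasing_set_cvg_integral _ (measurableTypeR R) R (fun n => `[a n, b n]%classic)
  (fun t => (f t)%:E) mu (exhausts_homo eD) (fun n => measurable_itv _) _ _.
have [ab _ DE] := eD; rewrite -DE => h.
apply: (@cvge_unique (fun n => \int[mu]_(x in `[a n, b n]) (f x)%:E)%E).
  apply: h => n; last by move=> x hx; rewrite lee_fin f0//; exact: exhausts_sub eD _ hx.
  apply/measurable_EFinP; apply: measurable_funS mf; first exact: exhausts_measurable eD.
  exact: exhausts_sub eD.
have -> : (fun n => \int[mu]_(x in `[a n, b n]) (f x)%:E)%E = (fun n => (F (b n) - F (a n))%:E).
  by apply/funext => n; apply: FTC2_segment cf dF => //; exact: exhausts_sub eD.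
by apply: cvg_EFin; [exact: nearW|exact: cvgB].
Qed.

Lemma ge0_improper_integrable D a b f F (la lb : R) : open D -> exhausts D a b ->
  {in D, continuous f} -> (forall t, D t -> is_derive t 1 F (f t)) ->
  (forall t, D t -> 0 <= f t) ->
  F (a n) @[n --> \oo] --> la -> F (b n) @[n --> \oo] --> lb ->
  mu.-integrable D (EFin \o f).
Proof.
move=> oD eD cf dF f0 Fa Fb; apply/integrableP; split.
  by apply/measurable_EFinP; exact: open_continuous_measurable_fun.
rewrite (_ : (\int[mu]_(x in D) _ = \int[mu]_(t in D) (f t)%:E)%E).
  by rewrite (ge0_improper_FTC oD eD cf dF f0 Fa Fb) ltry.
apply: eq_integral; by move=> t; rewrite inE => Dt; rewrite /= ger0_norm// f0.
Qed.

(** Without a sign condition, the restrictions of [f] to the segments are dominated by [|f|], and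
    dominated convergence replaces monotone convergence. *)
Lemma improper_FTC D a b f F (la lb : R) : open D -> exhausts D a b ->
  {in D, continuous f} -> (forall t, D t -> is_derive t 1 F (f t)) ->
  mu.-integrable D (EFin \o f) ->
  F (a n) @[n --> \oo] --> la -> F (b n) @[n --> \oo] --> lb ->
  \int[mu]_(t in D) f t = lb - la.
Proof.
move=> oD eD cf dF intf Fa Fb.
have mD := exhausts_measurable eD.
have mf : measurable_fun D f by exact: open_continuous_measurable_fun.
suff h : (\int[mu]_(t in D) (f t)%:E = (lb - la)%:E)%E by rewrite /Rintegral h.
pose fn n t := (f \_ `[a n, b n]%classic) t.
have cvfn : (\int[mu]_(t in D) (fn n t)%:E)%E @[n --> \oo] --> (\int[mu]_(t in D) (f t)%:E)%E.
  apply: (@dominated_cvg _ _ _ mu _ mD _ _ (fun t => `|f t|%:E)) => //.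
  - move=> n; apply/measurable_EFinP.
    apply: (iffLR (measurable_restrict f (measurable_itv _) mD)).
    by apply: measurable_funS mf => //; exact: subIsetl.
  - move=> t Dt; apply: cvg_EFin; first exact: nearW.
    apply: cvg_near_cst; have [_ _ DE] := eD; move: Dt; rewrite DE => -[N _ hN].
    near=> n; rewrite /= /fn patchE mem_set//.
    have Nn : (N <= n)%N by near: n; exact: nbhs_infty_ge.
    by have /subsetPset := exhausts_homo eD Nn; apply.
  - exact: integrable_norm intf.
  - move=> n t Dt; rewrite lee_fin /fn patchE; case: ifP => // _.
    by rewrite normr0.
apply: (cvge_unique cvfn).
have -> : (fun n => \int[mu]_(t in D) (fn n t)%:E)%E = (fun n => (F (b n) - F (a n))%:E).
  apply/funext => n.
  rewrite -(@FTC2_segment D f F (a n) (b n) (exhausts_sub (n:=n) eD) _ cf dF); last first.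
    by have [ab _ _] := eD; exact: ab.
  rewrite [RHS]integral_mkcond [LHS]integral_mkcond.
  apply: eq_integral => t _; rewrite /fn !patchE.
  case: ifPn => // tD; first by case: ifPn.
  by rewrite ifF//; apply: contraNF tD; rewrite !inE; exact: exhausts_sub.
by apply: cvg_EFin; [exact: nearW|exact: cvgB].
Unshelve. all: by end_near. Qed.

(** Substitution on each segment, then monotone convergence on both sides; for this [phi] has to
    carry the exhaustion of [D] to one of [D']. *)
Lemma ge0_substitution D a b D' (phi dphi G : R -> R) : open D -> exhausts D a b ->
  open D' -> exhausts D' (phi \o a) (phi \o b) ->
  (forall t, D t -> is_derive t 1 phi (dphi t)) -> {in D, continuous dphi} ->
  (forall s t, D s -> D t -> s < t -> phi s < phi t) ->
  (forall t, D t -> 0 <= dphi t) ->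
  {in D', continuous G} -> (forall t, D' t -> 0 <= G t) ->
  (\int[mu]_(t in D') (G t)%:E = \int[mu]_(t in D) (G (phi t) * dphi t)%:E)%E.
Proof.
move=> oD eD oD' eD' dp cdp iphi dp0 cG G0.
have [ab _ DE] := eD; have [_ _ DE'] := eD'.
have phiD t : D t -> D' (phi t).
  rewrite DE DE' => -[n _]; rewrite /= in_itv /= => /andP[h1 h2]; exists n => //=.
  rewrite in_itv /=.
  have Da : D (a n) by apply: (exhausts_sub (n:=n) eD); rewrite /= in_itv /= lexx ltW.
  have Db : D (b n) by apply: (exhausts_sub (n:=n) eD); rewrite /= in_itv /= lexx ltW.
  have Dt : D t by apply: (exhausts_sub (n:=n) eD); rewrite /= in_itv /= h1.
  apply/andP; split.
  - by move: h1; rewrite le_eqVlt => /predU1P[->//|h]; rewrite ltW// iphi.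
  - by move: h2; rewrite le_eqVlt => /predU1P[->//|h]; rewrite ltW// iphi.
have cphi : {in D, continuous phi}.
  by move=> t; rewrite inE => Dt; exact: is_derive_continuous (dp t Dt).
have cH : {in D, continuous (fun t => G (phi t) * dphi t)}.
  move=> t Dt; apply: cvgM; last exact: cdp.
  apply: (@cvg_comp _ _ _ phi G); first exact: cphi.
  by apply: cG; rewrite inE; apply: phiD; rewrite inE in Dt.
have mG : measurable_fun D' G by exact: open_continuous_measurable_fun.
have mH : measurable_fun D (fun t => G (phi t) * dphi t) by exact: open_continuous_measurable_fun.
have h1 := @ge0_nondecreasing_set_cvg_integral _ (measurableTypeR R) R (fun n => `[phi (a n), phi (b n)]%classic)
  (fun t => (G t)%:E) mu (exhausts_homo eD') (fun n => measurable_itv _) _ _.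
have h2 := @ge0_nondecreasing_set_cvg_integral _ (measurableTypeR R) R (fun n => `[a n, b n]%classic)
  (fun t => (G (phi t) * dphi t)%:E) mu (exhausts_homo eD) (fun n => measurable_itv _) _ _.
rewrite -DE' in h1; rewrite -DE in h2.
apply: (@cvge_unique (fun n => \int[mu]_(x in `[phi (a n), phi (b n)]) (G x)%:E)%E).
  apply: h1 => n.
    apply/measurable_EFinP; apply: measurable_funS mG; first exact: exhausts_measurable eD'.
    exact: (exhausts_sub (n:=n) eD').
  by move=> x hx; rewrite lee_fin G0//; exact: (exhausts_sub (n:=n) eD') hx.
have -> : (fun n => \int[mu]_(x in `[phi (a n), phi (b n)]) (G x)%:E)%E =
   (fun n => \int[mu]_(x in `[a n, b n]) (G (phi x) * dphi x)%:E)%E.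
  apply/funext => n; have sD := exhausts_sub (n:=n) eD.
  have dE (t : R) : D t -> derive1 phi t = dphi t.
    by move=> Dt; rewrite derive1E; have [_] := dp t Dt.
  have Da : D (a n) by apply: sD; rewrite /= in_itv /= lexx ltW.
  have Db : D (b n) by apply: sD; rewrite /= in_itv /= lexx ltW.
  have cphi' (t : R) : D t -> {for t, continuous (derive1 phi)}.
    move=> Dt; have := cdp t (mem_set Dt); rewrite /prop_for /continuous_at dE// => h.
    apply: cvg_trans h; apply: near_eq_cvg.
    have : nbhs t D by exact: open_nbhs_nbhs.
    by apply: filterS => s Ds; rewrite dE.
  rewrite integration_by_substitution_increasing.
  - apply: eq_integral => t; rewrite inE => ht.
    by rewrite -(dE t (sD _ ht)).
  - exact: ltW.
  - move=> s t hs ht st; apply: iphi => //; exact: sD.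
  - move=> t ht; apply: cphi'; apply: sD; move: ht; rewrite /= !in_itv /= => /andP[u v].
    by rewrite !ltW.
  - apply/cvg_ex; exists (derive1 phi (a n)); apply: cvg_at_right_filter; exact: cphi'.
  - apply/cvg_ex; exists (derive1 phi (b n)); apply: cvg_at_left_filter; exact: cphi'.
  - split=> [t||].
    + rewrite in_itv /= => /andP[u v].
      by have [] := dp t (sD _ _); rewrite //= in_itv /= !ltW.
    + by apply: cvg_at_right_filter; apply: cphi; rewrite inE.
    + by apply: cvg_at_left_filter; apply: cphi; rewrite inE.
  - by apply: sub_within_continuous cG; exact: (exhausts_sub (n:=n) eD').
apply: h2 => n.
  apply/measurable_EFinP; apply: measurable_funS mH; first exact: exhausts_measurable eD.
  exact: (exhausts_sub (n:=n) eD).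
move=> x hx; have Dx := exhausts_sub (n:=n) eD hx.
by rewrite lee_fin mulr_ge0 ?dp0// G0//; exact: phiD.
Qed.

Lemma dominated_integrable D f (g : R -> R) : open D -> measurable D -> {in D, continuous f} ->
  (forall t, D t -> `|f t| <= g t) -> mu.-integrable D (EFin \o g) ->
  mu.-integrable D (EFin \o f).
Proof.
move=> oD mD cf fg ig; apply: le_integrable ig => //.
  by apply/measurable_EFinP; exact: open_continuous_measurable_fun.
move=> t Dt; rewrite /= lee_fin; apply: le_trans (fg t Dt) _; exact: ler_norm.
Qed.

Lemma exhausts_setT : exhausts setT (fun n => - n.+1%:R) (fun n => n.+1%:R).
Proof.
split=> [n|n|].
- by rewrite (@lt_trans _ _ 0)// oppr_lt0.
- by rewrite lerN2 !ler_nat.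
- apply/esym; rewrite -subTset => x _.
  exists (Num.truncn `|x|) => //=; rewrite in_itv /= -ler_norml ltW//.
  exact: truncnS_gt.
Qed.

Lemma exhausts_pos (a b : nat -> R) : (forall n, 0 < a n < b n) ->
  (forall n, a n.+1 <= a n /\ b n <= b n.+1) ->
  a n @[n --> \oo] --> (0 : R) -> b n @[n --> \oo] --> +oo ->
  exhausts `]0, +oo[%classic a b.
Proof.
move=> h1 h2 ha hb; split => [n||]; [by case/andP: (h1 n)|exact: h2|].
apply/seteqP; split => x /=; rewrite in_itv /= andbT.
  move=> x0; near \oo => n; exists n => //=; rewrite in_itv /=; apply/andP; split.
  - by apply: ltW; near: n; exact: cvgr_lt ha _ x0.
  - by near: n; move/cvgryPge : hb; exact.
move=> [n _]; rewrite /= in_itv /= => /andP[h _]; apply: lt_le_trans h.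
by case/andP: (h1 n).
Unshelve. all: by end_near. Qed.

Lemma invS3_cvg : n.+3%:R^-1 @[n --> \oo] --> (0 : R).
Proof.
have := @cvg_harmonic R; rewrite -(cvg_shiftn 2) /=.
by under eq_fun do rewrite /harmonic /= addn2.
Qed.

(** With [n.+2] the first segment would shrink to the point 1/2, whereas [exhausts] wants
    [a n < b n]. *)
Lemma exhausts_unit : exhausts `]0, 1[%classic
  (fun n => n.+3%:R^-1) (fun n => 1 - n.+3%:R^-1 : R).
Proof.
split=> [n|n|].
- have : n.+3%:R^-1 < 2^-1 :> R by rewrite ltf_pV2 ?posrE ?ltr0n// ltr_nat.
  by move: (n.+3%:R^-1 : R) => x; lra.
- rewrite lerD2l lerN2; suff : n.+4%:R^-1 <= n.+3%:R^-1 :> R by [].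
  by rewrite lef_pV2 ?posrE ?ltr0n// ler_nat.
- apply/seteqP; split => x /=; rewrite in_itv /=.
    move=> /andP[x0 x1].
    near \oo => n; exists n => //=; rewrite in_itv /=; apply/andP; split.
    - by apply: ltW; near: n; exact: cvgr_lt invS3_cvg _ x0.
    - rewrite lerBrDr -lerBrDl; apply: ltW; near: n.
      by apply: cvgr_lt invS3_cvg _ _; rewrite subr_gt0.
  move=> [n _]; rewrite /= in_itv /= => /andP[h1 h2].
  have hn : 0 < n.+3%:R^-1 :> R by rewrite invr_gt0 ltr0n.
  by rewrite (lt_le_trans hn h1) (le_lt_trans h2)// gtrBl.
Unshelve. all: by end_near. Qed.

End exhaustions.

(** * Gamma and Beta integrals *)

Section gamma.
Context {R : realType}.
Local Notation mu := (@lebesgue_measure R).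
Implicit Types (x t : R).

Lemma is_derive_expR_comp (f : R -> R) t d : is_derive t 1 f d ->
  is_derive t 1 (fun u => expR (f u)) (d * expR (f t)).
Proof.
move=> df; apply: (is_derive_eq (@is_derive1_comp _ expR f _ _ _ (is_derive_expR (f t)) df)).
by rewrite mulrC.
Qed.

Lemma is_derive_ln_comp (f : R -> R) t d : 0 < f t -> is_derive t 1 f d ->
  is_derive t 1 (fun u => ln (f u)) (d / f t).
Proof.
move=> f0 df; apply: (is_derive_eq (@is_derive1_comp _ (@ln R) f _ _ _ (is_derive1_ln f0) df)).
by rewrite mulrC.
Qed.

Lemma is_derive_mull (c t : R) : is_derive t 1 (fun u : R => c * u) c.
Proof.
have h := is_deriveZ c (is_derive_id t (1 : R)).
by apply: (is_derive_eq h); rewrite /GRing.scale /= mulr1.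
Qed.

Definition softplus t := ln (1 + expR t).

Lemma one_expR_gt0 t : 0 < 1 + expR t.
Proof. by rewrite addr_gt0// expR_gt0. Qed.

Lemma is_derive_softplus t : is_derive t 1 softplus (expR t / (1 + expR t)).
Proof.
apply: is_derive_ln_comp; first exact: one_expR_gt0.
have h := is_deriveD (is_derive_cst (1 : R) t (1 : R)) (is_derive_expR t).
by apply: (is_derive_eq h); rewrite add0r.
Qed.

Lemma softplus_ge0 t : 0 <= softplus t.
Proof. by rewrite ln_ge0// lerDl expR_ge0. Qed.

Lemma softplusN t : softplus (- t) = softplus t - t.
Proof.
rewrite /softplus (_ : 1 + expR (- t) = (1 + expR t) * expR (- t)).
  by rewrite lnM ?posrE ?one_expR_gt0 ?expR_gt0// expRK.
by rewrite mulrDl mul1r expRxMexpNx_1 addrC.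
Qed.

(** The Gamma integrand in the variable [log t]: it is smooth on the whole line, and translations
    take the place of dilations. *)
Definition gamma_kernel x t := expR (x * t - expR t).

Lemma is_derive_gamma_kernel x t :
  is_derive t 1 (gamma_kernel x) (x * gamma_kernel x t - gamma_kernel (x + 1) t).
Proof.
have h := is_derive_expR_comp (is_deriveB (is_derive_mull x t) (is_derive_expR t)).
apply: (is_derive_eq h); rewrite mulrBl -expRD; congr (_ - expR _).
by rewrite mulrDl mul1r /= addrCA addrA.
Qed.

Lemma gamma_kernel_continuous x : continuous (gamma_kernel x).
Proof. by move=> t; exact: is_derive_continuous (is_derive_gamma_kernel x t). Qed.

Lemma gamma_kernel_gt0 x t : 0 < gamma_kernel x t.
Proof. exact: expR_gt0. Qed.

Lemma exhausts_expR : exhausts `]0, +oo[%classic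
  (expR \o (fun n => - n.+1%:R)) (expR \o (fun n => n.+1%:R) : nat -> R).
Proof.
have [h1 h2 h3] := @exhausts_setT R.
split => [n|n|] /=.
- by rewrite ltr_expR h1.
- by have [h h'] := h2 n; rewrite !ler_expR h h'.
- apply/seteqP; split => t /=; rewrite in_itv /= andbT.
    move=> t0; have : setT (ln t) by [].
    rewrite h3 => -[n _]; rewrite /= in_itv /= => hn; exists n => //=.
    by rewrite in_itv /= -[t]lnK ?posrE// !ler_expR.
  by move=> [n _]; rewrite /= in_itv /= => /andP[+ _]; apply: lt_le_trans; exact: expR_gt0.
Qed.

Lemma powR_continuous_pos x t : 0 < t -> {for t, continuous (fun u : R => u `^ x)}.
Proof. by move=> t0; exact: is_derive_continuous (is_derive1_powR x t0). Qed.

Lemma gamma_integralE x :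
  (\int[mu]_(t in `]0%R, +oo[) (t `^ (x - 1) * expR (- t))%:E =
   \int[mu]_(t in [set: R]) (gamma_kernel x t)%:E)%E.
Proof.
rewrite (@ge0_substitution R setT _ _ `]0, +oo[%classic expR expR
  (fun t => t `^ (x - 1) * expR (- t)) _ exhausts_setT).
- apply: eq_integral => t _; rewrite -expRM -!expRD /gamma_kernel; congr (expR _)%:E.
  by rewrite mulrBr mulr1 addrAC subrK mulrC.
- exact: openT.
- exact: interval_open.
- exact: exhausts_expR.
- by move=> t _; exact: continuous_expR.
- by move=> u t _ _; rewrite ltr_expR.
- by move=> t _; exact: expR_ge0.
- move=> t; rewrite inE /= in_itv /= andbT => t0; apply: cvgM.
    exact: powR_continuous_pos.
  apply: (@continuous_comp _ _ _ (fun u : R => - u) expR).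
    exact: opp_continuous.
  exact: continuous_expR.
- by move=> t _; rewrite mulr_ge0 ?powR_ge0 ?expR_ge0.
Qed.

(** The inequality [ln (1 + u) <= u] at [u = (1 + e^t) / (x + 1) - 1] bounds [(x + 1) softplus t] by
    [e^t] plus a constant. The dominating function is chosen for its elementary primitive. *)
Lemma gamma_kernel_le x t : 0 < x ->
  gamma_kernel x t <= expR (1 + (x + 1) * ln (x + 1)) * expR (x * t - (x + 1) * softplus t).
Proof.
move=> x0; rewrite -expRD ler_expR.
have x1 : 0 < x + 1 by rewrite addr_gt0.
have : softplus t <= (1 + expR t) / (x + 1) - 1 + ln (x + 1).
  rewrite -lerBlDr -lnV ?posrE// -lnM ?posrE ?invr_gt0 ?one_expR_gt0//.
  have := @le_ln1Dx R ((1 + expR t) / (x + 1) - 1).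
  rewrite subrKC; apply.
  by rewrite ltrBrDl subrr divr_gt0// one_expR_gt0.
rewrite -(ler_pM2l x1) mulrDr mulrBr mulrCA divff ?gt_eqF// mulr1.
by move: (ln _) (softplus t) (expR t) => l s e; lra.
Qed.

Lemma expR_NnatS_cvg (x : R) : 0 < x -> expR (- (x * n.+1%:R)) @[n --> \oo] --> (0 : R).
Proof.
move=> x0; have h : (x * n.+1%:R) @[n --> \oo] --> +oo.
  apply/cvgryPge => M; near=> n.
  rewrite mulrC -ler_pdivrMr//; apply: (@le_trans _ _ n%:R); last by rewrite ler_nat.
  by near: n; exact: nbhs_infty_ger.
exact: (cvg_comp _ _ h (@cvgr_expR R)).
Unshelve. all: by end_near. Qed.

Lemma expRN_natS_cvg : expR (- n.+1%:R) @[n --> \oo] --> (0 : R).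
Proof. by have := @expR_NnatS_cvg 1 ltr01; under eq_fun do rewrite mul1r. Qed.

(** The integrand is [e^(x t) (1 + e^t)^(- x - 1)], the derivative of [(e^t / (1 + e^t))^x / x],
    which increases from 0 to [1 / x]. *)
Lemma softplus_weight_integrable x : 0 < x ->
  mu.-integrable setT (EFin \o (fun t => expR (x * t - (x + 1) * softplus t))).
Proof.
move=> x0.
pose H t := expR (x * t - x * softplus t) / x.
have dH t : is_derive t 1 H (expR (x * t - (x + 1) * softplus t)).
  have d1 : is_derive t 1 (fun u => x * softplus u) (x * (expR t / (1 + expR t))).
    by apply: is_derive_eq (is_deriveZ x (is_derive_softplus t)) _.
  have d2 := is_derive_expR_comp (is_deriveB (is_derive_mull x t) d1).
  have d3 := is_deriveZ x^-1 d2.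
  have -> : H = (x^-1 *: (fun u => expR ((fun u => x * u) u - (fun u => x * softplus u) u))).
    by apply/funext => u; rewrite /H mulrC.
  apply: is_derive_eq d3 _; rewrite /= /GRing.scale /=.
  rewrite (_ : x * t - (x + 1) * softplus t = x * t - x * softplus t - softplus t); last first.
    by move: (softplus t) => s; ring.
  rewrite (expRD _ (- softplus t)) expRN {2}/softplus lnK ?posrE ?one_expR_gt0//.
  have := one_expR_gt0 t; move: (expR t) (expR (_ - _)) => e E h.
  by field; rewrite ?(gt_eqF h) ?(gt_eqF x0).
apply: (@ge0_improper_integrable _ setT _ _ _ H 0 x^-1 openT exhausts_setT).
- move=> t _.
  have h := is_deriveB (is_derive_mull x t) (is_deriveZ (x + 1) (is_derive_softplus t)).
  exact: (is_derive_continuous (is_derive_expR_comp h)).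
- by move=> t _; exact: expR_ge0.
- rewrite -(mul0r x^-1); apply: cvgMl.
  apply: (@squeeze_cvgr _ _ _ _ (fun=> 0) (fun n => expR (- (x * n.+1%:R)))).
  + apply: nearW => n; rewrite expR_ge0/= ler_expR mulrN gerBl.
    by rewrite mulr_ge0 ?softplus_ge0 ?ltW.
  + exact: cvg_cst.
  + exact: expR_NnatS_cvg.
- rewrite -[x^-1]mul1r; apply: cvgMl.
  have -> : (fun n => expR (x * n.+1%:R - x * softplus n.+1%:R)) =
    (fun n => expR (- x * softplus (- n.+1%:R))).
    by apply/funext => n; rewrite softplusN mulNr mulrBr opprB.
  have h : 1 + expR (- n.+1%:R) @[n --> \oo] --> (1 + 0 : R).
    by apply: cvgD; [exact: cvg_cst|exact: expRN_natS_cvg].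
  have hs : softplus (- n.+1%:R) @[n --> \oo] --> ln (1 + 0 : R).
    by apply: (@cvg_comp _ _ _ _ (@ln R) _ _ _ h); apply: continuous_ln; rewrite addr0.
  have : expR (- x * softplus (- n.+1%:R)) @[n --> \oo] --> expR (- x * ln (1 + 0)).
    apply: (@cvg_comp _ _ _ (fun n : nat => - x * softplus (- n.+1%:R)) expR).
      by apply: cvgMr; exact: hs.
    exact: continuous_expR.
  by rewrite addr0 ln1 mulr0 expR0.
Unshelve. all: by end_near. Qed.

Lemma gamma_kernel_integrable x : 0 < x ->
  mu.-integrable setT (EFin \o gamma_kernel x).
Proof.
move=> x0; apply: (@dominated_integrable _ setT (gamma_kernel x)
  (fun t => expR (1 + (x + 1) * ln (x + 1)) * expR (x * t - (x + 1) * softplus t))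
  openT measurableT) => [t _|t _|].
- exact: gamma_kernel_continuous.
- by rewrite gtr0_norm ?gamma_kernel_gt0//; exact: gamma_kernel_le.
- have h := integrableZl measurableT (expR (1 + (x + 1) * ln (x + 1)))
    (softplus_weight_integrable x0).
  exact: h.
Qed.

Lemma GammaE x : Gamma x = \int[mu]_(t in [set: R]) gamma_kernel x t.
Proof. by rewrite /Gamma /Rintegral gamma_integralE. Qed.

Lemma EFin_Gamma x : 0 < x ->
  (\int[mu]_(t in [set: R]) (gamma_kernel x t)%:E = (Gamma x)%:E)%E.
Proof.
move=> x0; rewrite GammaE /Rintegral fineK//.
by apply: integrable_fin_num => //; exact: gamma_kernel_integrable.
Qed.

Lemma Gamma_gt0 x : 0 < x -> 0 < Gamma x.
Proof.
move=> x0; rewrite -lte_fin -EFin_Gamma//.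
apply: (@lt_le_trans _ _ (\int[mu]_(t in `[0%R, 1%R]) (cst (expR (- expR 1))%:E t))%E).
  by rewrite integral_cst//= lebesgue_measure_itv /= lte_fin ltr01 sube0 mule1 lte_fin expR_gt0.
apply: (@le_trans _ _ (\int[mu]_(t in `[0%R, 1%R]) (gamma_kernel x t)%:E)%E).
  apply: ge0_le_integral => //.
  - by move=> t _; rewrite lee_fin expR_ge0.
  - apply/measurable_EFinP; apply: measurable_funTS.
    by apply: continuous_measurable_fun; exact: gamma_kernel_continuous.
  - move=> t /=; rewrite in_itv /= => /andP[t0 t1]; rewrite lee_fin ler_expR.
    have : 0 <= x * t by rewrite mulr_ge0// ltW.
    have : expR t <= expR 1 by rewrite ler_expR.
    by lra.
apply: ge0_subset_integral => //.
- apply/measurable_EFinP.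
  by apply: continuous_measurable_fun; exact: gamma_kernel_continuous.
- by move=> t _; rewrite lee_fin expR_ge0.
Qed.

Lemma GammaS x : 0 < x -> Gamma (x + 1) = x * Gamma x.
Proof.
move=> x0; have x1 : 0 < x + 1 by rewrite addr_gt0.
have ix := gamma_kernel_integrable x0; have ix1 := gamma_kernel_integrable x1.
have ixx : mu.-integrable setT (EFin \o (fun t => x * gamma_kernel x t)).
  exact: (integrableZl measurableT x ix).
have : \int[mu]_(t in setT) (x * gamma_kernel x t - gamma_kernel (x + 1) t) = 0 - 0.
  apply: (@improper_FTC _ setT _ _ _ (gamma_kernel x) 0 0 openT exhausts_setT).
  - move=> t _; apply: cvgB; last exact: gamma_kernel_continuous.
    by apply: cvgMr; exact: gamma_kernel_continuous.
  - by move=> t _; exact: is_derive_gamma_kernel.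
  - rewrite (_ : EFin \o _ = (fun t => (x * gamma_kernel x t)%:E - (gamma_kernel (x+1) t)%:E)%E)//.
    exact: integrableB.
  - apply: (@squeeze_cvgr _ _ _ _ (fun=> 0) (fun n => expR (- (x * n.+1%:R)))).
    + apply: nearW => n; rewrite ltW ?gamma_kernel_gt0//= ler_expR mulrN gerBl.
      exact: expR_ge0.
    + exact: cvg_cst.
    + exact: expR_NnatS_cvg.
  - apply: (@squeeze_cvgr _ _ _ _ (fun=> 0)
      (fun n => expR (1 + (x + 1) * ln (x + 1)) * expR (- n.+1%:R))).
    + apply: nearW => n; rewrite ltW ?gamma_kernel_gt0//=.
      apply: le_trans (gamma_kernel_le _ x0) _.
      rewrite ler_pM2l ?expR_gt0// ler_expR.
      have : (x + 1) * n.+1%:R <= (x + 1) * softplus n.+1%:R.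
        rewrite ler_pM2l// -[leLHS]expRK ler_ln ?posrE ?expR_gt0 ?one_expR_gt0//.
        by rewrite lerDr.
      by move: (softplus _) => s; lra.
    + exact: cvg_cst.
    + rewrite -(mulr0 (expR (1 + (x + 1) * ln (x + 1)))); apply: cvgMr; exact: expRN_natS_cvg.
rewrite RintegralB// RintegralZl// -!GammaE subrr => /eqP.
by rewrite subr_eq0 => /eqP.
Unshelve. all: by end_near. Qed.

Lemma Gamma1 : Gamma 1 = 1 :> R.
Proof.
apply: EFin_inj; rewrite -EFin_Gamma//.
rewrite -[in RHS](opprK 1) -[- - 1]add0r.
apply: (@ge0_improper_FTC _ setT _ _ _ (fun t => - expR (- expR t)) (-1) 0 openT exhausts_setT).
- by move=> t _; exact: gamma_kernel_continuous.
- move=> t _.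
  have h := is_deriveN (is_derive_expR_comp (is_deriveN (is_derive_expR t))).
  apply: (is_derive_eq h).
  by rewrite mulNr opprK /gamma_kernel mul1r expRD.
- by move=> t _; exact: expR_ge0.
- apply: cvgN; rewrite -[X in _ --> X]expR0 -[X in _ --> expR X]oppr0.
  apply: (@cvg_comp _ _ _ (fun n : nat => - expR (- n.+1%:R)) expR).
    by apply: cvgN; exact: expRN_natS_cvg.
  exact: continuous_expR.
- rewrite -oppr0; apply: cvgN.
  apply: (@squeeze_cvgr _ _ _ _ (fun=> 0) (fun n => expR (- n.+1%:R))).
  + apply: nearW => n; rewrite expR_ge0/= ler_expR lerN2.
    by apply: le_trans (expR_ge1Dx _); rewrite lerDr.
  + exact: cvg_cst.
  + exact: expRN_natS_cvg.
Unshelve. all: by end_near. Qed.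

Lemma Gamma_nat n : Gamma n.+1%:R = n`!%:R :> R.
Proof.
elim: n => [|n IH]; first by rewrite Gamma1.
by rewrite -[in LHS]addn1 natrD GammaS ?ltr0n// IH factS natrM.
Qed.

End gamma.

(** * The Beta integral and the inverse central binomial *)

Section beta.
Context {R : realType}.
Local Notation mu := (@lebesgue_measure R).
Implicit Types (x t : R).

Lemma ge0_integral_translation (G : R -> R) (c : R) : continuous G -> (forall t, 0 <= G t) ->
  (\int[mu]_(t in [set: R]) (G t)%:E = \int[mu]_(t in [set: R]) (G (c + t))%:E)%E.
Proof.
move=> cG G0.
have d1 t : setT t -> is_derive t 1 (fun u => c + u) (1 : R).
  move=> _; have h := is_deriveD (is_derive_cst c t (1 : R)) (is_derive_id t (1 : R)).
  by apply: (is_derive_eq h); rewrite add0r.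
transitivity (\int[mu]_(t in [set: R]) (G (c + t) * 1)%:E)%E; last first.
  by apply: eq_integral => t _; rewrite mulr1.
apply: (@ge0_substitution R setT _ _ setT (fun t => c + t) (fun=> 1) G openT exhausts_setT openT _ d1).
- have [h1 h2 h3] := @exhausts_setT R.
  split => [n|n|]; rewrite /= ?ltrD2l ?lerD2l; [exact: h1|exact: h2|].
  apply/esym; rewrite -subTset => t _; have : setT (t - c) by [].
  rewrite h3 => -[n _ /=]; rewrite in_itv /= => /andP[u v]; exists n => //=.
  by rewrite in_itv /= -lerBrDl u -lerBlDl v.
- by move=> t _; exact: cvg_cst.
- by move=> s t _ _; rewrite ltrD2l.
- by move=> t _; exact: ler01.
- by move=> t _; exact: cG.
- by move=> t _; exact: G0.
Qed.

Lemma ge0_integral_scale (G : R -> R) (k : R) : measurable_fun [set: R] G ->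
  (forall t, 0 <= G t) -> 0 <= k ->
  (\int[mu]_(t in [set: R]) (G t * k)%:E = \int[mu]_(t in [set: R]) (G t)%:E * k%:E)%E.
Proof.
move=> mG G0 k0; rewrite -ge0_integralZr//; first exact/measurable_EFinP.
by move=> t _; rewrite lee_fin.
Qed.

Definition beta_kernel x t := expR (x * t - 2 * x * softplus t).

Lemma is_derive_beta_exponent x t :
  is_derive t 1 (fun u => x * u - 2 * x * softplus u) (x - 2 * x * (expR t / (1 + expR t))).
Proof.
have h := is_deriveB (is_derive_mull x t) (is_deriveZ (2 * x) (is_derive_softplus t)).
exact: (is_derive_eq h).
Qed.

Lemma beta_kernel_continuous x : continuous (beta_kernel x).
Proof.
move=> t; exact: (is_derive_continuous (is_derive_expR_comp (is_derive_beta_exponent x t))).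
Qed.

Lemma beta_kernelN x t : beta_kernel x (- t) = beta_kernel x t.
Proof. by rewrite /beta_kernel softplusN; congr expR; ring. Qed.

(** Since [e^s + e^(s + z) = e^(s + softplus z)], a product of two Gamma integrands is the Beta
    integrand times a translated Gamma integrand of parameter [2 x]. *)
Lemma gamma_kernelM x (s z : R) : gamma_kernel x s * gamma_kernel x (s + z) =
  beta_kernel x z * gamma_kernel (2 * x) (softplus z + s).
Proof.
rewrite -!expRD; congr expR.
rewrite (expRD (softplus z)) {3}/softplus lnK ?posrE ?one_expR_gt0// expRD.
by move: (softplus z) (expR _) (expR _) => a c d; ring.
Qed.

Lemma gamma_kernel_integral_shift (y c u : R) : 0 < y -> 0 <= c ->
  ((c * Gamma y)%:E = \int[mu]_(z in [set: R]) (c * gamma_kernel y (u + z))%:E)%E.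
Proof.
move=> y0 c0.
have cg := @gamma_kernel_continuous R y.
have k0 t : 0 <= gamma_kernel y t by exact: expR_ge0.
rewrite mulrC EFinM -(EFin_Gamma y0) (ge0_integral_translation u cg k0).
have mk : measurable_fun [set: R] (fun z => gamma_kernel y (u + z)).
  apply: continuous_measurable_fun => t.
  apply: (@continuous_comp _ _ _ (fun z : R => u + z) (gamma_kernel y)); last exact: cg.
  by apply: cvgD; [exact: cvg_cst|exact: cvg_id].
rewrite -(ge0_integral_scale mk (fun t => k0 (u + t)) c0).
by apply: eq_integral => z _; rewrite mulrC.
Qed.

(** The inner variable is translated by [s], the integrals are exchanged by Tonelli, and the
    [s]-integral is translated by [softplus z]. With extended nonnegative integrals, finiteness can
    be settled afterwards. *)
Lemma Gamma_sqr x : 0 < x ->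
  ((Gamma x ^+ 2)%:E = \int[mu]_(z in [set: R]) (beta_kernel x z)%:E * (Gamma (2 * x))%:E)%E.
Proof.
move=> x0; have x20 : 0 < 2 * x by rewrite mulr_gt0.
have k0 y t : 0 <= gamma_kernel y t by exact: expR_ge0.
have b0 t : 0 <= beta_kernel x t by exact: expR_ge0.
have mk : measurable_fun [set: R] (gamma_kernel x).
  by apply: continuous_measurable_fun; exact: gamma_kernel_continuous.
have mb : measurable_fun [set: R] (beta_kernel x).
  by apply: continuous_measurable_fun; exact: beta_kernel_continuous.
pose F (p : measurableTypeR R * measurableTypeR R) :=
  (gamma_kernel x p.1 * gamma_kernel x (p.1 + p.2))%:E.
have mF : measurable_fun setT F.
  apply/measurable_EFinP; apply: measurable_funM.
    exact: (measurableT_comp mk measurable_fst).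
  apply: (measurableT_comp mk); apply: measurable_funD.
    exact: measurable_fst.
  exact: measurable_snd.
have F0 p : (0 <= F p)%E by rewrite lee_fin mulr_ge0.
rewrite expr2 EFinM -{1}(EFin_Gamma x0).
rewrite -(ge0_integral_scale mk (k0 x) (ltW (Gamma_gt0 x0))).
transitivity (\int[mu]_(s in setT) \int[mu]_(z in setT) F (s, z))%E.
  by apply: eq_integral => s _; exact: gamma_kernel_integral_shift.
rewrite (@fubini_tonelli _ _ _ _ R mu mu F mF F0).
rewrite -(ge0_integral_scale mb b0 (ltW (Gamma_gt0 x20))).
apply: eq_integral => z _.
rewrite (gamma_kernel_integral_shift (softplus z) x20 (b0 z)).
by apply: eq_integral => s _; rewrite /F /= gamma_kernelM.
Qed.

Lemma inv_central_binom_beta x : 0 < x ->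
  ((1 / central_binom x)%:E =
   x%:E * \int[mu]_(z in `]0%R, +oo[) (beta_kernel x z)%:E)%E.
Proof.
move=> x0; have x20 : 0 < 2 * x by rewrite mulr_gt0.
have G2 := Gamma_gt0 x20; have G1 := Gamma_gt0 x0.
have := Gamma_sqr x0; rewrite ge0_symfun_integralT; last 3 first.
- by move=> t; exact: expR_ge0.
- exact: beta_kernel_continuous.
- by move=> t; rewrite /= beta_kernelN.
rewrite -set_itvcy -integral_itv_obnd_cbnd; last first.
  apply/measurable_EFinP; apply: measurable_funTS.
  by apply: continuous_measurable_fun; exact: beta_kernel_continuous.
set I := (\int[mu]_(z in _) _)%E => hI.
have I0 : (0 <= I)%E by apply: integral_ge0 => t _; rewrite lee_fin expR_ge0.
(* An infinite Beta integral would make the finite number [Gamma x ^+ 2] infinite. *)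
have fI : I \is a fin_num.
  rewrite ge0_fin_numE// ltNge leye_eq; apply/negP => /eqP Ioo; move: hI.
  by rewrite Ioo mulry gtr0_sg// mul1e mulyr gtr0_sg// mul1e.
rewrite -(fineK fI) in hI *; move: (fine I) hI => {I0 fI}J.
rewrite -!EFinM => -[hJ]; congr EFin.
rewrite /central_binom !GammaS// div1r invf_div exprMn hJ.
by field; rewrite !gt_eqF.
Qed.

End beta.

(** * Deformation of the path *)

Section strip.
Context {R : realType}.
Local Notation mu := (@lebesgue_measure R).
Implicit Types (x r : R) (z d : R[i]).

Lemma is_derive_integral (D : set R) (f df : R -> R -> R) (G : R -> R) (a u v : R) :
  measurable D -> u < a < v ->
  (forall x, u < x < v -> mu.-integrable D (EFin \o f x)) ->
  (forall x y, u < x < v -> D y -> is_derive x 1 (f ^~ y) (df x y)) ->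
  (forall x y, u < x < v -> D y -> `|df x y| <= G y) ->
  mu.-integrable D (EFin \o G) ->
  is_derive a 1 (fun x => \int[mu]_(y in D) f x y) (\int[mu]_(y in D) df a y).
Proof.
move=> mD auv intf dfE dfG iG.
have Ia : `]u, v[%classic a by rewrite /= in_itv.
have hf x : `]u, v[%classic x -> mu.-integrable D (EFin \o f x).
  by rewrite /= in_itv; exact: intf.
have hd x y : `]u, v[%classic x -> D y -> derivable (f ^~ y) x 1.
  by rewrite /= in_itv => h Dy; have [] := dfE x y h Dy.
have pE x y : `]u, v[%classic x -> D y -> partial1of2 f x y = df x y.
  by rewrite /= in_itv partial1of2E => h Dy; have [_ ->] := dfE x y h Dy.
have G0 y : 0 <= `|G y| by [].
have iG' : mu.-integrable D (EFin \o (fun y => `|G y|)) by exact: (integrable_norm iG).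
have hG x y : `]u, v[%classic x -> D y -> `|partial1of2 f x y| <= `|G y|.
  by move=> h Dy; rewrite pE//; apply: le_trans (ler_norm _); apply: dfG.
have h1 := @derivable_under_integral R _ (measurableTypeR R) mu f D mD a u v Ia hf hd
  (fun y => `|G y|) G0 iG' hG.
have h2 := @differentiation_under_integral R _ (measurableTypeR R) mu f D mD a u v Ia hf hd
  (fun y => `|G y|) G0 iG' hG.
apply: DeriveDef => //; rewrite -derive1E h2.
by apply: eq_Rintegral => y; rewrite inE => Dy; rewrite pE.
Qed.

Lemma cvgc_Re_continuous (f : R -> R[i]) x : cvgc (nbhs x) f (f x) ->
  {for x, continuous (fun t => Re (f t))}.
Proof. by case. Qed.

Lemma continuous_segment_integrable (f : R -> R) (a b : R) :
  (forall x, a <= x <= b -> {for x, continuous f}) ->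
  mu.-integrable `[a, b] (EFin \o f).
Proof.
move=> cf; apply: continuous_compact_integrable; first exact: segment_compact.
by apply: continuous_in_subspaceT => t; rewrite inE /= in_itv => ht; exact: cf.
Qed.

(** The half-angle formula says that [1 + e^(i t)] has argument [t / 2]. It makes the integrand real
    on the imaginary axis. *)
Lemma atan_half (t : R) : `|t| < pi -> atan (sin t / (1 + cos t)) = t / 2.
Proof.
rewrite ltr_norml => /andP[t1 t2].
have h : t / 2 \in `]- (pi / 2), (pi / 2)[.
  by rewrite in_itv /=; apply/andP; split; [rewrite -mulNr|]; rewrite ltr_pM2r.
have c0 : cos (t / 2) != 0 by rewrite gt_eqF// cos_gt0_pihalf// -in_itv.
rewrite -[RHS]tanK//; congr atan.
have e : t = (t / 2) *+ 2 by rewrite -mulr_natr divfK.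
rewrite {1 2}e sin_mulr2n cos_mulr2n /tan.
move: (cos _) (sin _) c0 => c u c0.
rewrite (_ : 1 + (c ^+ 2 *+ 2 - 1) = 2 * c ^+ 2); last by ring.
by rewrite -mulr_natr; field.
Qed.

(** This is [2 pi / 3]. Its definition by the cosine gives [e^(i theta0) = zeta] directly. *)
Definition theta0 : R := acos (- (1 / 2)).

Lemma theta0_bound : 0 <= theta0 < pi.
Proof.
have h : - 1 <= - (1 / 2 : R) <= 1 by apply/andP; split; lra.
rewrite acos_ge0//= lt_neqAle acos_lepi// andbT; apply/eqP => e.
have := acosK (x := - (1 / 2) : R); rewrite in_itv /= h => /(_ isT).
by rewrite -/theta0 e cospi => ?; lra.
Qed.

Lemma cexp_theta0 : cexp (0 +i* theta0) = zeta.
Proof.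
have h : - 1 <= - (1 / 2 : R) <= 1 by apply/andP; split; lra.
rewrite /cexp /= expR0 !mul1r /theta0 acosK ?in_itv//= sin_acos//.
rewrite /zeta; congr (_ +i* _).
rewrite (_ : 1 - (- (1 / 2)) ^+ 2 = 3 / 4 :> R); last by field.
rewrite sqrtrM// sqrtrV//; congr (_ * _); congr (_^-1).
by rewrite (_ : 4 = 2 ^+ 2 :> R) ?sqrtr_sqr ?ger0_norm// expr2; lra.
Qed.

(* On this half-strip [Re (1 + e^z) >= 1/2], so that the principal logarithm
   of [1 + e^z] is smooth. *)
Definition strip z := Re z <= 0 /\ - (pi / 2) <= Im z <= theta0.

Lemma cos_ge_half (t : R) : - (pi / 2) <= t <= theta0 -> - (1 / 2) <= cos t.
Proof.
move=> /andP[t1 t2]; have /andP[h0 hpi] := theta0_bound.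
have [tneg|tpos] := leP t 0.
  apply: (@le_trans _ _ 0); first lra.
  rewrite cos_ge0_pihalf// t1 /=; apply: le_trans tneg _.
  by rewrite divr_ge0// pi_ge0.
have h : - 1 <= - (1 / 2 : R) <= 1 by apply/andP; split; lra.
rewrite -[leLHS]acosK ?in_itv//= -/theta0.
have [->//|ne] := eqVneq t theta0.
apply: ltW; rewrite ltr_cos ?in_itv/= ?h0 ?(ltW hpi) ?(ltW tpos)//.
  by rewrite lt_neqAle ne.
by apply: le_trans t2 _; exact: ltW.
Qed.

Lemma strip_Re z : strip z -> 1 / 2 <= Re (1 + cexp z).
Proof.
move=> [h1 h2]; have hc := cos_ge_half h2; rewrite ReD /=.
have e1 : expR (Re z) <= 1 by rewrite -expR0 ler_expR.
have e0 : 0 < expR (Re z) by exact: expR_gt0.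
move: (expR _) (cos _) e0 e1 hc => e c *; nra.
Qed.

Lemma strip_neq0 z : strip z -> 1 + cexp z != 0.
Proof.
move=> /strip_Re; apply: contraTneq => ->; rewrite -ltNge /=; lra.
Qed.

(** The continuation [(e^z / (1 + e^z)^2)^x] of [beta_kernel] to the half-strip, with the branch
    given by [z - 2 log (1 + e^z)]; [bfac] is its logarithmic derivative. *)
Definition bexp x z : R[i] := cexp (x%:C * (z - 2 * clog (1 + cexp z))).
Definition bfac x z : R[i] := x%:C * (1 - 2 * cexp z / (1 + cexp z)).

Lemma derc_bexp x (f : R -> R[i]) t d : strip (f t) -> derc f t d ->
  derc (fun s => bexp x (f s)) t (bexp x (f t) * (bfac x (f t) * d)).
Proof.
move=> sf df; apply: derc_cexp.
have d1 : derc (fun s => 1 + cexp (f s)) t (0 + cexp (f t) * d).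
  by apply: dercD; [exact: derc_cst|exact: derc_cexp].
have r0 : 0 < Re (1 + cexp (f t)) by apply: lt_le_trans (strip_Re sf); lra.
have h := dercZ x%:C (dercB df (dercZ 2 (derc_clog r0 d1))).
apply: derc_eq h; rewrite /bfac add0r.
by have := strip_neq0 sf; move: (cexp _) => w w0; field.
Qed.

Lemma derc_bfac x (f : R -> R[i]) t d : strip (f t) -> derc f t d ->
  exists e, derc (fun s => bfac x (f s)) t e.
Proof.
move=> sf df; have h := strip_neq0 sf.
have d0 := derc_cexp df.
have d1 : derc (fun s => 1 + cexp (f s)) t (0 + cexp (f t) * d).
  by apply: dercD; [exact: derc_cst|exact: d0].
have d2 := dercM (dercZ 2 d0) (dercV h d1).
eexists; exact: dercZ x%:C (dercB (derc_cst 1 t) d2).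
Qed.

(** On the strip [|1 + e^z|] is at least 1/2, so its power [- 2 x] is at most [2^(2 x)]. *)
Lemma normc_bexp_le x z : 0 < x -> strip z ->
  normc (bexp x z) <= expR (2 * x * ln 2) * expR (x * Re z).
Proof.
move=> x0 sz; have h := strip_Re sz.
rewrite normc_cexp -expRD ler_expR ReM /= mul0r subr0 ReD.
have -> : Re (- (2 * clog (1 + cexp z))) =
  - ln (Re (1 + cexp z) ^+ 2 + Im (1 + cexp z) ^+ 2).
  by rewrite /clog; move: (1 + cexp z) => w /=; field.
suff : - ln 2 * 2 <= ln (Re (1 + cexp z) ^+ 2 + Im (1 + cexp z) ^+ 2).
  by move: (ln (_ + _)) (ln 2) => l l2 hl; nra.
rewrite -lnV ?posrE// mulr_natr -lnXn ?invr_gt0//.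
rewrite ler_ln ?posrE ?exprn_gt0 ?invr_gt0//; last first.
  by rewrite ltr_pwDl ?sqr_ge0// exprn_gt0// (lt_le_trans _ h)//; lra.
apply: (@le_trans _ _ (Re (1 + cexp z) ^+ 2)); last by rewrite lerDl sqr_ge0.
have h0 : 0 <= Re (1 + cexp z) by apply: le_trans h; lra.
by rewrite lerXn2r ?nnegrE// -div1r.
Qed.

Lemma normc_bfac_le x z : 0 < x -> strip z -> normc (bfac x z) <= 5 * x.
Proof.
move=> x0 sz; have h := strip_Re sz.
rewrite normcM normc_real gtr0_norm// mulrC ler_pM2r//.
apply: le_trans (le_normcD _ _) _; rewrite normc1 normcN !normcM normcV.
have h1 : 1 / 2 <= normc (1 + cexp z).
  by apply: le_trans h (le_trans (ler_norm _) (ler_normc_Re _)).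
have h2 : normc (cexp z) <= 1 by rewrite normc_cexp -expR0 ler_expR; case: sz.
have -> : normc (2 : R[i]) = 2 by rewrite (normc_natr 2).
have h3 : (normc (1 + cexp z))^-1 <= 2.
  by rewrite -[leRHS]invrK lef_pV2 ?posrE ?invr_gt0//; [lra|apply: lt_le_trans h1; lra].
have := normc_ge0 (cexp z); move: h2 h3.
have : 0 <= (normc (1 + cexp z))^-1 by rewrite invr_ge0 normc_ge0.
by move: (normc (cexp z)) (_^-1) => a b *; nra.
Qed.

Lemma cexp_real (t : R) : cexp t%:C = (expR t)%:C.
Proof. by rewrite /cexp /= cos0 sin0 mulr1 mulr0. Qed.

Lemma bexp_real x (t : R) : bexp x t%:C = (beta_kernel x t)%:C.
Proof.
rewrite /bexp cexp_real.
have -> : clog (1 + (expR t)%:C) = (softplus t)%:C.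
  rewrite /clog /= addr0 mul0r atan0 expr0n /= addr0 lnXn ?one_expR_gt0//.
  by congr (_ +i* _); rewrite /softplus; field.
rewrite -cexp_real; congr cexp.
by apply: complexP => /=; ring.
Qed.

(** The imaginary part of the exponent is [x (t - 2 (t / 2)) = 0]. *)
Lemma Im_bexp_imaginary x (t : R) : `|t| < pi -> Im (bexp x (0 +i* t)) = 0.
Proof.
move=> tpi; rewrite /bexp.
have -> : 1 + cexp (0 +i* t) = (1 + cos t) +i* sin t.
  by apply: complexP; rewrite /= expR0 !mul1r ?add0r.
rewrite [clog _]/clog [Re (_ +i* _)]/= [Im (_ +i* _)]/= atan_half//.
move: (ln _ / 2) => L.
set B := (X in sin X); have -> : B = 0 by rewrite /B /=; field.
by rewrite sin0 mulr0.
Qed.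

End strip.

(** * The path and its homotopy to the real axis *)

Section path.
Context {R : realType}.
Local Notation mu := (@lebesgue_measure R).
Implicit Types (x r t a : R).

(** The branch of the logarithm of [zeta (1 - r) / (1 - zeta^2 r)] that starts at [i theta0]. The
    principal logarithm can be used because [1 - zeta^2 r] has positive real part. *)
Definition zpath r : R[i] :=
  (- mlog r)%:C - clog (1 - zeta ^+ 2 * r%:C) + (0 +i* theta0).

Lemma one_sub_z2rE r :
  1 - zeta ^+ 2 * r%:C = (1 + r / 2) +i* (r * (Num.sqrt 3 / 2)) :> R[i].
Proof. by rewrite -zeta_conj /zeta; apply: complexP => /=; ring. Qed.

Lemma derc_zpath r : 0 <= r < 1 -> derc zpath r (- dlogv r).
Proof.
move=> /andP[r0 r1].
have h : 0 < Re (1 - zeta ^+ 2 * r%:C).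
  by rewrite one_sub_z2rE /= ltr_pwDl// divr_ge0.
have d1 := derc_real (is_deriveN (is_derive_mlog r1)).
have d2 := derc_clog h (derc_lin (zeta ^+ 2) r).
apply: derc_eq (dercD (dercB d1 d2) (derc_cst (0 +i* theta0) r)).
rewrite /dlogv /letter_form expr0 !mul1r rmorphN fmorphV rmorphB rmorph1.
by ring.
Qed.

Lemma Re_zpath r : Re (zpath r) = - mlog r - ln (1 + r + r ^+ 2) / 2.
Proof.
rewrite /zpath one_sub_z2rE /clog !ReD /= addr0.
have h : Num.sqrt 3 ^+ 2 = 3 :> R by rewrite sqr_sqrtr.
by congr (_ - ln _ / 2); rewrite !exprMn h; field.
Qed.

Lemma Re_zpath_le r : 0 <= r < 1 -> Re (zpath r) <= - mlog r.
Proof.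
move=> /andP[r0 r1]; rewrite Re_zpath gerBl divr_ge0// ln_ge0//.
by rewrite -addrA lerDl addr_ge0// sqr_ge0.
Qed.

Lemma Im_zpath r : 0 <= r < 1 -> - (pi / 2) <= Im (zpath r) <= theta0.
Proof.
move=> /andP[r0 r1]; rewrite /zpath one_sub_z2rE /clog !ImD /=.
set q := _ / (1 + r / 2).
have q0 : 0 <= q by rewrite divr_ge0 ?mulr_ge0 ?divr_ge0 ?sqrtr_ge0// addr_ge0 ?divr_ge0.
have a0 : 0 <= atan q by rewrite -atan0 le_atan.
have a1 := atan_ltpi2 q; have /andP[h0 h1] := @theta0_bound R.
by apply/andP; split; move: (pi : R) (atan q) theta0 a0 a1 h0 h1 => p a b *; lra.
Qed.

Lemma zpath0 : zpath 0 = 0 +i* theta0 :> R[i].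
Proof.
rewrite /zpath one_sub_z2rE /mlog subr0 ln1 /clog.
by apply: complexP => /=; rewrite ?mul0r ?addr0 ?mul0r ?atan0 ?expr0n ?expr1n /= ?addr0 ?ln1; ring.
Qed.

(* The homotopy from the real axis to the path: both are traversed from the
   imaginary axis to [-oo]. *)
Definition zhom a r : R[i] := Re (zpath r) +i* (a * Im (zpath r)).
Definition dzhom a r : R[i] := Re (- dlogv r) +i* (a * Im (- dlogv r)).
Definition homotopy_deriv x a r : R[i] :=
  bexp x (zhom a r) * (bfac x (zhom a r) * dzhom a r) * (0 +i* Im (zpath r)) +
  bexp x (zhom a r) * (0 +i* Im (- dlogv r)).

Lemma zhom_strip a r : 0 <= a <= 1 -> 0 <= r < 1 -> strip (zhom a r).
Proof.
move=> /andP[a0 a1] r01; split.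
  change (Re (zpath r) <= 0).
  by apply: le_trans (Re_zpath_le r01) _; rewrite oppr_le0 mlog_ge0.
change (- (pi / 2) <= a * Im (zpath r) <= theta0).
have /andP[h1 h2] := Im_zpath r01.
have p0 : 0 <= pi / 2 :> R by rewrite divr_ge0// pi_ge0.
have /andP[t0 _] := @theta0_bound R.
by move: (pi / 2 : R) theta0 (Im _) p0 t0 h1 h2 => p u b *; apply/andP; split; nra.
Qed.

Lemma derc_zhom a r : 0 <= r < 1 -> derc (zhom a) r (dzhom a r).
Proof.
move=> r01; have [h1 h2] := derc_zpath r01; split; first exact: h1.
exact: (is_derive_eq (is_deriveZ a h2)).
Qed.

Lemma derc_scale_Im (u v a : R) : derc (fun s : R => u +i* (s * v)) a (0 +i* v).
Proof.
split => /=; first exact: is_derive_cst.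
have h := is_deriveM (is_derive_id a (1 : R)) (is_derive_cst v a (1 : R)).
by apply: (is_derive_eq h); rewrite /GRing.scale /= mulr1 mulr0 add0r.
Qed.

Lemma derc_zhom_scale a r : derc (zhom ^~ r) a (0 +i* Im (zpath r)).
Proof. exact: derc_scale_Im. Qed.

Lemma derc_dzhom_scale a r : derc (dzhom ^~ r) a (0 +i* Im (- dlogv r)).
Proof. exact: derc_scale_Im. Qed.

Lemma derc_bexp_zhom x a r : 0 <= a <= 1 -> 0 <= r < 1 ->
  derc (fun s => bexp x (zhom s r)) a
    (bexp x (zhom a r) * (bfac x (zhom a r) * (0 +i* Im (zpath r)))).
Proof.
move=> a01 r01.
exact: (@derc_bexp _ x (zhom ^~ r) a _ (zhom_strip a01 r01) (derc_zhom_scale a r)).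
Qed.

(** Here [0 +i* Im (zpath r)] is the derivative of [zhom] in [a], and [dzhom] the one in [r]. With
    [derc_homotopy_a], which has the same right-hand side, this says that the form [bexp dz] pulled
    back by the homotopy is closed; it replaces Cauchy's theorem. *)
Lemma derc_homotopy_r x a r : 0 <= a <= 1 -> 0 <= r < 1 ->
  derc (fun s => bexp x (zhom a s) * (0 +i* Im (zpath s))) r (homotopy_deriv x a r).
Proof.
move=> a01 r01; apply: dercM.
  by apply: derc_bexp; [exact: zhom_strip|exact: derc_zhom].
have [h1 h2] := derc_zpath r01; split => /=; [exact: is_derive_cst|exact: h2].
Qed.

Lemma derc_homotopy_a x a r : 0 <= a <= 1 -> 0 <= r < 1 ->
  derc (fun s => bexp x (zhom s r) * dzhom s r) a (homotopy_deriv x a r).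
Proof.
move=> a01 r01.
apply: derc_eq (dercM (derc_bexp_zhom x a01 r01) (derc_dzhom_scale a r)).
rewrite /homotopy_deriv; move: (zhom a r) (dzhom a r) => z d.
ring.
Qed.

Lemma homotopy_deriv_continuous x a r : 0 <= a <= 1 -> 0 <= r < 1 ->
  cvgc (nbhs a) (fun s => homotopy_deriv x s r) (homotopy_deriv x a r).
Proof.
move=> a01 r01.
have c1 := derc_continuous (derc_bexp_zhom x a01 r01).
have [e d3] := @derc_bfac _ x (zhom ^~ r) a _ (zhom_strip a01 r01) (derc_zhom_scale a r).
have c2 := derc_continuous d3; have c3 := derc_continuous (derc_dzhom_scale a r).
apply: cvgcD; apply: cvgcM; [|exact: cvgc_cst|exact: c1|exact: cvgc_cst].
by apply: cvgcM; [exact: c1|apply: cvgcM; [exact: c2|exact: c3]].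
Qed.

Lemma normc_Im (u : R) : normc (0 +i* u) = `|u|.
Proof. by rewrite /normc expr0n /= add0r sqrtr_sqr. Qed.

Lemma normc_bexp_zhom_le x a r : 0 < x -> 0 <= a <= 1 -> 0 <= r < 1 ->
  normc (bexp x (zhom a r)) <= expR (2 * x * ln 2) * expR (- x * mlog r).
Proof.
move=> x0 a01 r01; apply: le_trans (normc_bexp_le x0 (zhom_strip a01 r01)) _.
by rewrite ler_pM2l ?expR_gt0// ler_expR mulNr -mulrN ler_pM2l//; exact: Re_zpath_le.
Qed.

Lemma normc_Im_zpath r : 0 <= r < 1 -> `|Im (zpath r)| <= 2 * pi.
Proof.
move=> r01; have /andP[h1 h2] := Im_zpath r01; have /andP[h3 h4] := @theta0_bound R.
by rewrite ler_norml; move: (pi : R) theta0 (Im _) h1 h2 h3 h4 => p u b *; apply/andP; split; lra.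
Qed.

Lemma homotopy_deriv_le x : 0 < x -> exists2 M, 0 <= M & forall a r, 0 <= a <= 1 -> 0 <= r < 1 ->
  normc (homotopy_deriv x a r) <= M / (1 - r).
Proof.
move=> x0; pose C := expR (2 * x * ln 2).
have C0 : 0 <= C by exact: expR_ge0.
have p0 : 0 <= pi :> R by exact: pi_ge0.
exists (C * (5 * x * 4 * (2 * pi) + 2)) => [|a r a01 r01].
  by rewrite mulr_ge0// addr_ge0// !mulr_ge0// ltW.
have s0 : 0 <= (1 - r)^-1 by case/andP: r01 => _ r1; rewrite invr_ge0 subr_ge0 ltW.
have e1 : normc (bexp x (zhom a r)) <= C.
  apply: le_trans (normc_bexp_zhom_le x0 a01 r01) _.
  by rewrite -[leRHS]mulr1 ler_wpM2l// -expR0 ler_expR mulNr oppr_le0 mulr_ge0 ?mlog_ge0// ltW.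
have dl := dlogv_le r01.
have dR : `|Re (- dlogv r)| <= 2 / (1 - r).
  by apply: le_trans (ler_normc_Re _) _; rewrite normcN.
have dI : `|Im (- dlogv r)| <= 2 / (1 - r).
  by apply: le_trans (ler_normc_Im _) _; rewrite normcN.
have e2 : normc (dzhom a r) <= 4 / (1 - r).
  apply: le_trans (normc_le_ReIm _) _; rewrite /= normrM.
  have : `|a| * `|Im (- dlogv r)| <= 1 * (2 / (1 - r)).
    by apply: ler_pM => //; case/andP: a01 => h1 h2; rewrite ger0_norm.
  by lra.
have e3 := normc_bfac_le x0 (zhom_strip a01 r01).
have e4 := normc_Im_zpath r01.
have h1 : normc (bexp x (zhom a r) * (bfac x (zhom a r) * dzhom a r) *
    (0 +i* Im (zpath r))) <= C * (5 * x * (4 / (1 - r))) * (2 * pi).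
  rewrite (normcM _ (0 +i* _)) normc_Im (normcM (bexp _ _)) (normcM (bfac _ _)).
  by do ![apply: ler_pM; rewrite ?mulr_ge0 ?normc_ge0//].
have h2 : normc (bexp x (zhom a r) * (0 +i* Im (- dlogv r))) <= C * (2 / (1 - r)).
  by rewrite (normcM (bexp _ _)) normc_Im; apply: ler_pM; rewrite ?normc_ge0.
apply: le_trans (le_normcD _ _) _.
apply: le_trans (lerD h1 h2) _.
by rewrite le_eqVlt; apply/orP; left; apply/eqP; ring.
Qed.

(** The real part of the integral over the vertical segment from the real axis to the path at
    parameter [r], the side that closes the contour. Its derivative in [r] is the difference of the
    two integrands. *)
Definition vertical_int x r := \int[mu]_(a in `[0, 1])
  Re (bexp x (zhom a r) * (0 +i* Im (zpath r))).

Lemma bexp_zhom_continuous x a r : 0 <= a <= 1 -> 0 <= r < 1 ->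
  {for a, continuous (fun s =>
    Re (bexp x (zhom s r) * (0 +i* Im (zpath r))))}.
Proof.
move=> a01 r01; apply: cvgc_Re_continuous; apply: cvgcM; last exact: cvgc_cst.
exact: derc_continuous (derc_bexp_zhom x a01 r01).
Qed.

Lemma zhom1 r : zhom 1 r = zpath r.
Proof. by rewrite /zhom mul1r; case: (zpath r). Qed.

Lemma integral_homotopy_deriv x r : 0 <= r < 1 ->
  \int[mu]_(a in `[0, 1]) Re (homotopy_deriv x a r) =
  beta_kernel x (Re (zpath r)) * Re (dlogv r) -
  Re (bexp x (zpath r) * dlogv r).
Proof.
move=> r01; pose F a := Re (bexp x (zhom a r) * dzhom a r).
have sub01 a : `[0, 1]%classic a -> 0 <= a <= 1 by rewrite /= in_itv.
have -> : \int[mu]_(a in `[0, 1]) Re (homotopy_deriv x a r) = F 1 - F 0.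
  have cf : {in `[0, 1]%classic, continuous (fun a => Re (homotopy_deriv x a r))}.
    move=> a /set_mem /sub01 a01.
    exact: cvgc_Re_continuous (homotopy_deriv_continuous x a01 r01).
  have dF a : `[0, 1]%classic a -> is_derive a 1 F (Re (homotopy_deriv x a r)).
    by move=> /sub01 a01; have [] := derc_homotopy_a x a01 r01.
  have h := FTC2_segment (@subset_refl _ `[0, 1]%classic) ltr01 cf dF.
  by rewrite /Rintegral h.
rewrite /F zhom1 (_ : dzhom 1 r = - dlogv r); last by rewrite /dzhom mul1r; case: (dlogv r).
rewrite (_ : zhom 0 r = (Re (zpath r))%:C); last by rewrite /zhom mul0r.
rewrite (_ : dzhom 0 r = (Re (- dlogv r))%:C); last by rewrite /dzhom mul0r.
rewrite bexp_real -rmorphM mulrN.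
by move: (bexp x (zpath r)) (beta_kernel _ _) (dlogv r) => [u v] b [c d] /=; ring.
Qed.

Lemma is_derive_vertical_int x r : 0 < x -> 0 < r < 1 ->
  is_derive r 1 (vertical_int x) (beta_kernel x (Re (zpath r)) * Re (dlogv r) -
    Re (bexp x (zpath r) * dlogv r)).
Proof.
move=> x0 /andP[r0 r1]; rewrite -integral_homotopy_deriv ?(ltW r0)//.
have [M M0 hM] := homotopy_deriv_le x0.
(* Parameters up to [(1 + r) / 2] stay away from 1, so that one constant bounds the derivative on a
   neighbourhood of [r]. *)
have rv : r < (1 + r) / 2 by lra.
have sub01 a : `[0, 1]%classic a -> 0 <= a <= 1 by rewrite /= in_itv.
apply: (@is_derive_integral _ _ _ (fun s a => Re (homotopy_deriv x a s))
  (fun=> M / (1 - (1 + r) / 2)) r 0 ((1 + r) / 2)).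
- exact: measurable_itv.
- by rewrite r0.
- move=> s /andP[s0 s1]; apply: continuous_segment_integrable => a a01.
  by apply: bexp_zhom_continuous => //; rewrite (ltW s0)/=; lra.
- move=> s a /andP[s0 s1] /sub01 a01.
  have s01 : 0 <= s < 1 by rewrite (ltW s0)/=; lra.
  by have [] := derc_homotopy_r x a01 s01.
- move=> s a /andP[s0 s1] /sub01 a01.
  have s01 : 0 <= s < 1 by rewrite (ltW s0)/=; lra.
  apply: le_trans (ler_normc_Re _) _; apply: le_trans (hM _ _ a01 s01) _.
  by rewrite ler_wpM2l// lef_pV2 ?posrE; lra.
- by apply: continuous_segment_integrable => a _; exact: cvg_cst.
Qed.

Lemma vertical_int_le x r (K : R) : (forall a, 0 <= a <= 1 ->
    `|Re (bexp x (zhom a r) * (0 +i* Im (zpath r)))| <= K) ->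
  0 <= r < 1 -> `|vertical_int x r| <= K.
Proof.
move=> h r01; rewrite /vertical_int.
have iF : mu.-integrable `[0, 1] (EFin \o (fun a =>
    Re (bexp x (zhom a r) * (0 +i* Im (zpath r))))).
  by apply: continuous_segment_integrable => a a01; exact: bexp_zhom_continuous.
apply: le_trans (le_normr_Rintegral _ iF) _ => //.
have -> : K = \int[mu]_(a in `[0, 1]) cst K a.
  by rewrite Rintegral_cst//= lebesgue_measure_itv /= lte_fin ltr01 sube0 mulr1.
apply: le_Rintegral => //.
- exact: (integrable_norm iF).
- by apply: continuous_segment_integrable => a _; exact: cvg_cst.
Qed.

(* On the imaginary axis the integrand [bexp] is real, so [Re (i bexp) = 0]. *)
Lemma vertical_int_near0 x : 0 < x -> exists M, forall r, 0 <= r <= 1 / 2 -> `|vertical_int x r| <= M * r.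
Proof.
move=> x0; have [M M0 hM] := homotopy_deriv_le x0; exists (M * 2) => r /andP[r0 r1].
apply: vertical_int_le => [a a01|]; last by rewrite r0; lra.
pose F s := bexp x (zhom a s) * (0 +i* Im (zpath s)).
have F0 : Re (F 0) = 0.
  have /andP[h0 h1] := @theta0_bound R; have /andP[a0 a1] := a01.
  have h : `|a * theta0| < pi.
    rewrite ger0_norm ?mulr_ge0//; apply: le_lt_trans h1.
    by rewrite -[leRHS]mul1r ler_wpM2r.
  have hI := Im_bexp_imaginary x h.
  rewrite /F (_ : zhom a 0 = 0 +i* (a * theta0)); last by rewrite /zhom zpath0.
  by rewrite zpath0; move: (bexp _ _) hI => w hw; rewrite ReM hw /=; ring.
have -> : Re (bexp x (zhom a r) * (0 +i* Im (zpath r))) = Re (F r - F 0).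
  by rewrite ReD -[Re (- _)]/(- Re (F 0)) F0 oppr0 addr0.
apply: le_trans (ler_normc_Re _) _.
have := @derc_mean_value R F (homotopy_deriv x a) (fun s => M * 2 * s) (fun=> M * 2) 0 r r0.
rewrite mulr0 subr0; apply.
- move=> t /andP[t0 t1]; apply: derc_homotopy_r => //.
  by rewrite t0; lra.
- by move=> t _; exact: is_derive_mull.
- move=> t /andP[t0 t1]; have t01 : 0 <= t < 1 by rewrite t0; lra.
  apply: le_trans (hM _ _ a01 t01) _; rewrite ler_wpM2l//.
  by rewrite -[leRHS]invrK lef_pV2 ?posrE ?invr_gt0//; lra.
Qed.

Lemma vertical_int_near1 x : 0 < x -> exists M, forall r, 0 <= r < 1 ->
  `|vertical_int x r| <= M * expR (- x * mlog r).
Proof.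
move=> x0; exists (expR (2 * x * ln 2) * (2 * pi)) => r r01.
apply: vertical_int_le => // a a01; apply: le_trans (ler_normc_Re _) _.
rewrite (normcM (bexp _ _)) normc_Im mulrAC.
apply: ler_pM; rewrite ?normc_ge0//; last exact: normc_Im_zpath.
exact: normc_bexp_zhom_le.
Qed.

End path.

(** * The integral over the path and its derivatives in x *)

Section representation.
Context {R : realType}.
Local Notation mu := (@lebesgue_measure R).
Implicit Types (x r t : R) (i : nat).

Lemma dlogv_continuous r : 0 <= r < 1 -> cvgc (nbhs r) dlogv (dlogv r).
Proof.
move=> r01; have h j : cvgc (nbhs r) (letter_form (Some j)) (letter_form (Some j) r).
  apply: (@derc_continuous R (letter_form (Some j)) r).
  exact: (dercZ (zeta ^+ j) (dercV (one_sub_zetaX_neq0 j r01) (derc_lin (zeta ^+ j) r))).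
by apply: cvgcB; exact: h.
Qed.

Lemma cexp_zpath r : 0 <= r < 1 ->
  cexp (zpath r) = zeta * (1 - r%:C) / (1 - zeta ^+ 2 * r%:C).
Proof.
move=> /andP[r0 r1]; rewrite /zpath !cexpD cexp_theta0 cexpN clogK; last first.
  by rewrite one_sub_z2rE /= ltr_pwDl// divr_ge0.
rewrite cexp_real expRN expR_mlog// invrK rmorphB rmorph1.
by rewrite mulrC mulrA.
Qed.

Lemma one_add_cexp_zpath r : 0 <= r < 1 ->
  1 + cexp (zpath r) = - zeta ^+ 2 * (1 - zeta * r%:C) / (1 - zeta ^+ 2 * r%:C).
Proof.
move=> r01; have n2 := one_sub_z2r_neq0 r01; rewrite cexp_zpath//.
apply: (mulIf n2); rewrite mulrDl !divfK// mul1r.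
have h3 := @zeta3 R; have hq := @zeta_quad R.
apply/eqP; rewrite -subr_eq0; apply/eqP.
have -> : 1 - zeta ^+ 2 * r%:C + zeta * (1 - r%:C) - - zeta ^+ 2 * (1 - zeta * r%:C) =
  (zeta ^+ 2 + zeta + 1) - r%:C * (zeta ^+ 2 + zeta + zeta ^+ 3) by ring.
by rewrite h3 hq mulr0 subr0.
Qed.

(** Equality of the exponentials would leave a multiple of [2 i pi] undetermined, which matters once
    multiplied by a real [x]. Comparing derivatives and the value at 0 settles the branch. *)
Lemma zpath_ell r : 0 < r < 1 -> zpath r - 2 * clog (1 + cexp (zpath r)) = ell r.
Proof.
move=> r01; apply/eqP; rewrite -subr_eq0; apply/eqP; move: r r01.
have st r : 0 <= r < 1 -> strip (zpath r).
  by move=> r01; rewrite -zhom1; apply: zhom_strip => //; rewrite ler01 lexx.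
have dz r : 0 <= r < 1 -> derc (fun s => zpath s - 2 * clog (1 + cexp (zpath s))) r
    (- dlogv r - 2 * ((0 + cexp (zpath r) * - dlogv r) / (1 + cexp (zpath r)))).
  move=> r01; apply: dercB; first exact: derc_zpath.
  apply: dercZ; apply: derc_clog.
    by apply: lt_le_trans (strip_Re (st r r01)); rewrite divr_gt0.
  by apply: dercD; [exact: derc_cst|exact/derc_cexp/derc_zpath].
apply: (@derc0_cvg_right R (fun r => zpath r - 2 * clog (1 + cexp (zpath r)) - ell r)) => [r r01|].
  have r01' : 0 <= r < 1 by case/andP: r01 => /ltW -> ->.
  apply: derc_eq (dercB (dz r r01') (derc_ell r01)).
  have n0 := one_sub_r_neq0 r01'; have n1 := one_sub_zr_neq0 r01'.
  have n2 := one_sub_z2r_neq0 r01'.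
  rewrite one_add_cexp_zpath// cexp_zpath// /dlogv /dell /letter_form expr0 expr1 !mul1r.
  have z0 : zeta != 0 :> R[i] by rewrite -normc_eq0 normc_zeta oner_eq0.
  have h3 : zeta ^+ 3 = 1 :> R[i] := @zeta3 R.
  move: (zeta : R[i]) z0 h3 (r%:C : R[i]) n0 n1 n2 => z z0 h3 s n0 n1 n2.
  (* The difference of the derivatives is a multiple of [zeta^3 - 1]. *)
  transitivity (2 / (z * (1 - z * s) * (1 - z ^+ 2 * s)) * (z ^+ 3 - 1)); last first.
    by rewrite h3 subrr mulr0.
  by field; rewrite n0 n1 n2 z0.
have z01 : 0 <= (0 : R) < 1 by rewrite lexx ltr01.
have [c1 c2] := derc_continuous (dz 0 z01).
(* The number [1 + zeta] has modulus 1 and, by [atan_half], half the argument of [zeta], so the two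
   logarithms cancel. *)
have e : zpath 0 - 2 * clog (1 + cexp (zpath 0)) = 0 :> R[i].
  rewrite zpath0 cexp_theta0 /clog; have /andP[t0 tpi] := @theta0_bound R.
  have := @atan_half R theta0; rewrite ger0_norm// => /(_ tpi).
  have [<- <-] : Re (cexp (0 +i* theta0)) = cos theta0 :> R /\
     Im (cexp (0 +i* theta0)) = sin theta0 :> R.
    by rewrite /= expR0 !mul1r.
  rewrite cexp_theta0 ReD ImD => h.
  rewrite [Im 1]/= add0r h.
  have -> : (Re 1 + Re zeta) ^+ 2 + Im zeta ^+ 2 = 1 :> R.
    have s3 : Num.sqrt 3 ^+ 2 = 3 :> R by rewrite sqr_sqrtr.
    by rewrite /zeta /= exprMn s3; field.
  by rewrite ln1 mul0r; apply: complexP => /=; [ring|field].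
rewrite -[X in cvgc _ _ X](subr0 0); apply: cvgcB; last exact: ell_cvg0.
by rewrite e in c1 c2; split; exact: cvg_at_right_filter.
Qed.

Lemma bexp_zpath x r : 0 < r < 1 -> bexp x (zpath r) = cexp (x%:C * ell r).
Proof. by move=> r01; rewrite /bexp zpath_ell. Qed.

(** The real part of the path is monotone; the change of variable [t = - Re z] in the Beta integral
    relies on it. *)
Lemma Re_dlogv_ge0 r : 0 <= r < 1 -> 0 <= Re (dlogv r).
Proof.
move=> /andP[r0 r1]; rewrite /dlogv /letter_form one_sub_z2rE expr0 !mul1r -zeta_conj.
rewrite (_ : 1 - r%:C = (1 - r)%:C :> R[i]); last by rewrite rmorphB rmorph1.
rewrite -fmorphV ReD /=.
have a0 : 0 <= 1 + r / 2 by rewrite addr_ge0// divr_ge0.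
have s0 : 0 <= Num.sqrt 3 / 2 :> R by rewrite divr_ge0// sqrtr_ge0.
have i0 : 0 <= (1 - r)^-1 by rewrite invr_ge0 subr_ge0 ltW.
set N := _ + (r * _) ^+ 2.
have N0 : 0 <= N^-1 by rewrite invr_ge0 addr_ge0// sqr_ge0.
move: (Num.sqrt 3 / 2) (1 + r / 2) ((1 - r)^-1) (N^-1) s0 a0 i0 N0 => s a j n s0 a0 j0 n0.
have h1 : 0 <= a * n by exact: mulr_ge0.
have h2 : 0 <= s * (r * s * n) by rewrite !mulr_ge0.
by lra.
Qed.

Lemma mlog_continuous r : r < 1 -> {for r, continuous (@mlog R)}.
Proof. by move=> r1; exact: is_derive_continuous (is_derive_mlog r1). Qed.

Lemma mlog_unit n : mlog (1 - n.+3%:R^-1) = ln n.+3%:R :> R.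
Proof. by rewrite /mlog opprB addrCA subrr addr0 lnV ?posrE ?ltr0n// opprK. Qed.

Lemma ln_natS3_cvg : ln n.+3%:R @[n --> \oo] --> (+oo : set_system R).
Proof.
apply/cvgryPge => M; near=> n.
rewrite -[leLHS]expRK ler_ln ?posrE ?expR_gt0 ?ltr0n//.
apply: (@le_trans _ _ n%:R); last by rewrite ler_nat -addn3 leq_addr.
by near: n; exact: nbhs_infty_ger.
Unshelve. all: by end_near. Qed.

Lemma expmlog_cvg1 (x : R) : 0 < x ->
  expR (- x * mlog (1 - n.+3%:R^-1)) @[n --> \oo] --> (0 : R).
Proof.
move=> x0; have h : (x * ln n.+3%:R) @[n --> \oo] --> (+oo : set_system R).
  apply/cvgryPge => M; near=> n.
  rewrite mulrC -ler_pdivrMr//; near: n.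
  by have /cvgryPge := ln_natS3_cvg; exact.
have := cvg_comp _ _ h (@cvgr_expR R).
apply: cvg_trans; apply: near_eq_cvg; apply: nearW => n /=.
by rewrite mlog_unit mulNr.
Unshelve. all: by end_near. Qed.

Lemma mlog_cvg0 : mlog n.+3%:R^-1 @[n --> \oo] --> (0 : R).
Proof.
have -> : 0 = mlog 0 :> R by rewrite /mlog subr0 ln1 oppr0.
exact: (cvg_comp _ _ invS3_cvg (@mlog_continuous 0 ltr01)).
Qed.

Lemma mlog_weight_integrable x : 0 < x ->
  mu.-integrable `]0, 1[ (EFin \o (fun r => expR (- x * mlog r) / (1 - r))).
Proof.
move=> x0.
pose H r := (- x)^-1 * expR (- x * mlog r).
have dH r : `]0, 1[%classic r -> is_derive r 1 H (expR (- x * mlog r) / (1 - r)).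
  rewrite /= in_itv /= => /andP[r0 r1].
  apply: (is_derive_eq (is_deriveZ (- x)^-1 (is_derive_expmlog (- x) r1))).
  rewrite /GRing.scale /=; have : 1 - r != 0 by rewrite subr_eq0 gt_eqF.
  by move: (expR _) => e h; field; rewrite h gt_eqF.
apply: (@ge0_improper_integrable _ `]0, 1[%classic _ _ _ H (- x)^-1 0 _ exhausts_unit _ dH).
- exact: interval_open.
- move=> r; rewrite inE /= in_itv /= => /andP[r0 r1].
  apply: cvgM.
    exact: (is_derive_continuous (is_derive_expmlog (- x) r1)).
  apply: cvgV; first by rewrite subr_eq0 gt_eqF.
  by apply: cvgB; [exact: cvg_cst|exact: cvg_id].
- move=> r; rewrite /= in_itv /= => /andP[r0 r1].
  by rewrite divr_ge0 ?expR_ge0// subr_ge0 ltW.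
- rewrite -[X in _ --> X]mulr1; apply: cvgMr.
  have h : - x * mlog n.+3%:R^-1 @[n --> \oo] --> - x * (0 : R).
    by apply: cvgMr; exact: mlog_cvg0.
  have := cvg_comp _ _ h (@continuous_expR R (- x * 0)).
  by rewrite mulr0 expR0.
- rewrite -[X in _ --> X](mulr0 (- x)^-1); apply: cvgMr; exact: expmlog_cvg1.
Qed.

Lemma integrable_scale (D : set R) (c : R) (f : R -> R) : measurable D ->
  mu.-integrable D (EFin \o f) -> mu.-integrable D (EFin \o (fun t => c * f t)).
Proof.
move=> mD h; have := @integrableZl _ (measurableTypeR R) R mu D mD c _ h.
exact.
Qed.

Lemma integrable_sub (D : set R) (f g : R -> R) : measurable D ->
  mu.-integrable D (EFin \o f) -> mu.-integrable D (EFin \o g) ->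
  mu.-integrable D (EFin \o (fun t => f t - g t)).
Proof.
move=> mD hf hg; have := @integrableB _ (measurableTypeR R) R mu D mD _ _ hf hg.
exact.
Qed.

Lemma mlog_weight_integrableZ (C x : R) : 0 < x ->
  mu.-integrable `]0, 1[ (EFin \o (fun r => C * (expR (- x * mlog r) / (1 - r)))).
Proof.
move=> x0; have mD : measurable (`]0, 1[%classic : set R) by exact: measurable_itv.
exact: (integrable_scale C mD (mlog_weight_integrable x0)).
Qed.

Lemma Re_ell_le r : 0 < r < 1 -> Re (ell r) <= - mlog r.
Proof.
move=> r01; have r01' : 0 <= r < 1 by case/andP: r01 => /ltW -> ->.
rewrite -ler_expR -normc_cexp cexp_ell// expRN expR_mlog; last by case/andP: r01.
by rewrite invrK; exact: normc_yfun_le.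
Qed.

Lemma ell_le r : 0 < r < 1 -> normc (ell r) <= 4 * mlog r.
Proof.
move=> /andP[r0 r1]; apply/ler_addgt0Pl => e e0.
have /cvgr_lt/(_ e) h : normc (ell s) @[s --> (0 : R)^'+] --> (0 : R).
  have /cvgc_normc := ell_cvg0 (R := R).
  by under eq_fun do rewrite subr0.
near (0 : R)^'+ => s.
have s0 : 0 < s by near: s; exact: nbhs_right_gt.
have sr : s < r by near: s; exact: nbhs_right_lt.
have se : normc (ell s) < e by near: s; exact: h.
have sub t : s <= t <= r -> 0 < t < 1.
  by move=> /andP[t0 t1]; rewrite (lt_le_trans s0 t0) (le_lt_trans t1 r1).
have : normc (ell r - ell s) <= 4 * mlog r - 4 * mlog s.
  apply: (@derc_mean_value R ell dell (fun t => 4 * mlog t) (fun t => 4 / (1 - t)) s r (ltW sr)).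
  - by move=> t /sub; exact: derc_ell.
  - move=> t /sub /andP[_ t1].
    by apply: (is_derive_eq (is_deriveZ (4 : R) (is_derive_mlog t1))).
  - by move=> t /sub; exact: dell_le.
have := le_normcD (ell r - ell s) (ell s); rewrite subrK.
have : 0 <= mlog s by rewrite mlog_ge0// (ltW s0) (lt_trans sr r1).
by lra.
Unshelve. all: by end_near. Qed.

Definition eint i x r : R[i] := ell r ^+ i * cexp (x%:C * ell r) * dlogv r.

Lemma ellX_le i (d : R) : 0 < d -> exists2 C, 0 <= C & forall r, 0 < r < 1 ->
  normc (ell r) ^+ i <= C * expR (d * mlog r).
Proof.
move=> d0; have [C C0 hC] := exprn_le_expR i d0.
exists (4 ^+ i * C) => [|r r01]; first by rewrite mulr_ge0// exprn_ge0.
have m0 : 0 <= mlog r by apply: mlog_ge0; case/andP: r01 => /ltW -> ->.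
apply: (@le_trans _ _ ((4 * mlog r) ^+ i)).
  by rewrite lerXn2r ?nnegrE ?normc_ge0 ?mulr_ge0//; exact: ell_le.
by rewrite exprMn -mulrA ler_wpM2l ?exprn_ge0//; exact: hC.
Qed.

(** The factor [e^(x ell)] is bounded by [(1 - r)^x]; a small part [d] of this exponent absorbs the
    logarithmic growth of [ell^i]. The constant does not depend on [x], as differentiation under the
    integral requires. *)
Lemma eint_le i (d : R) : 0 < d -> exists2 C, 0 <= C & forall x r, 0 <= x -> 0 < r < 1 ->
  normc (eint i x r) <= C * (expR (- (x - d) * mlog r) / (1 - r)).
Proof.
move=> d0; have [C C0 hC] := ellX_le i d0.
exists (C * 2) => [|x r x0 r01]; first by rewrite mulr_ge0.
have r01' : 0 <= r < 1 by case/andP: r01 => /ltW -> ->.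
have h2 : normc (cexp (x%:C * ell r)) <= expR (- (x * mlog r)).
  rewrite normc_cexp ler_expR -mulrN.
  have -> : Re (x%:C * ell r) = x * Re (ell r).
    by case: (ell r) => u v /=; ring.
  by rewrite ler_wpM2l//; exact: Re_ell_le.
have h3 := dlogv_le r01'.
rewrite !normcM normcX.
apply: (@le_trans _ _ (C * expR (d * mlog r) * expR (- (x * mlog r)) * (2 / (1 - r)))).
  by do ![apply: ler_pM; rewrite ?mulr_ge0 ?exprn_ge0 ?normc_ge0 ?hC//].
rewrite (_ : - (x - d) * mlog r = d * mlog r + - (x * mlog r)); last by ring.
rewrite expRD le_eqVlt; apply/orP; left; apply/eqP.
by move: (expR _) (expR _) ((1 - r)^-1) => a b c; ring.
Qed.

Lemma eint_continuous i x r : 0 < r < 1 -> cvgc (nbhs r) (eint i x) (eint i x r).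
Proof.
move=> r01; have r01' : 0 <= r < 1 by case/andP: r01 => /ltW -> ->.
apply: cvgcM; last exact: dlogv_continuous.
apply: cvgcM.
  exact: (derc_continuous (dercX i (derc_ell r01))).
exact: (derc_continuous (derc_cexp (dercZ x%:C (derc_ell r01)))).
Qed.

Lemma eint_integrable i x : 0 < x ->
  mu.-integrable `]0, 1[ (EFin \o (fun r => Re (eint i x r))).
Proof.
move=> x0; have x2 : 0 < x / 2 by rewrite divr_gt0.
have [C C0 hC] := eint_le i x2.
have iW : mu.-integrable `]0, 1[
    (EFin \o (fun r => C * (expR (- (x / 2) * mlog r) / (1 - r)))).
  exact: mlog_weight_integrableZ.
apply: (dominated_integrable _ _ _ _ iW).
- exact: interval_open.
- exact: measurable_itv.
- move=> r; rewrite inE /= in_itv /= => r01.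
  exact: cvgc_Re_continuous (eint_continuous i x r01).
- move=> r; rewrite /= in_itv /= => r01; apply: le_trans (ler_normc_Re _) _.
  have := hC x r (ltW x0) r01.
  by rewrite (_ : x - x / 2 = x / 2)//; field.
Qed.

Definition fint i x := \int[mu]_(r in `]0, 1[) Re (eint i x r).

Lemma is_derive_fint i x : 0 < x -> is_derive x 1 (fint i) (fint i.+1 x).
Proof.
(* For [y] between [x / 2] and [2 x] the exponent [y - x / 4] is at least [x / 4], so one integrable
   weight dominates near [x]. *)
move=> x0; have x4 : 0 < x / 4 by rewrite divr_gt0.
have [C C0 hC] := eint_le i.+1 x4.
have iW : mu.-integrable `]0, 1[
    (EFin \o (fun r => C * (expR (- (x / 4) * mlog r) / (1 - r)))).
  exact: mlog_weight_integrableZ.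
apply: (@is_derive_integral R `]0, 1[%classic (fun y r => Re (eint i y r))
  (fun y r => Re (eint i.+1 y r)) _ x (x / 2) (2 * x) _ _ _ _ _ iW).
- exact: measurable_itv.
- by apply/andP; split; lra.
- by move=> y /andP[y0 _]; apply: eint_integrable; lra.
- move=> y r _; rewrite /= in_itv /= => r01.
  have d1 : derc (fun u : R => u%:C * ell r) y (ell r).
    have h := dercM (derc_real (is_derive_id y (1 : R))) (derc_cst (ell r) y).
    by apply: derc_eq h; rewrite mul1r mulr0 addr0.
  have [] // : derc (fun u => eint i u r) y (eint i.+1 y r).
  have h := dercM (dercZ (ell r ^+ i) (derc_cexp d1)) (derc_cst (dlogv r) y).
  apply: derc_eq h; rewrite /eint exprS mulr0 addr0; move: (cexp _) (ell r ^+ i) => a b.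
  by ring.
- move=> y r /andP[y0 y1]; rewrite /= in_itv /= => r01.
  apply: le_trans (ler_normc_Re _) _; apply: le_trans (hC y r _ r01) _; first lra.
  have /andP[r0 r1] := r01.
  rewrite ler_wpM2l// ler_wpM2r ?invr_ge0 ?subr_ge0 ?(ltW r1)// ler_expR ler_wpM2r//.
    by rewrite mlog_ge0// ltW.
  by lra.
Qed.

Definition path_pos r := - Re (zpath r).

Lemma path_posE r : path_pos r = mlog r + ln (1 + r + r ^+ 2) / 2.
Proof. by rewrite /path_pos Re_zpath opprB opprK addrC. Qed.

Lemma path_pos_ge r : 0 <= r < 1 -> mlog r <= path_pos r.
Proof. by move=> r01; rewrite lerNr; exact: Re_zpath_le. Qed.

Lemma path_pos_homo (s t : R) : 0 <= s -> t < 1 -> s < t -> path_pos s < path_pos t.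
Proof.
move=> s0 t1 st; rewrite !path_posE; have t0 : 0 < t by apply: le_lt_trans st.
apply: ltr_leD.
  by rewrite ltrN2 ltr_ln ?posrE; lra.
rewrite ler_pM2r// ler_ln ?posrE.
- by apply: lerD; [rewrite lerD2l ltW|rewrite lerXn2r ?nnegrE// ltW].
- by rewrite -addrA ltr_pwDl// addr_ge0// sqr_ge0.
- by rewrite -addrA ltr_pwDl// addr_ge0 ?sqr_ge0// ltW.
Qed.

Lemma is_derive_path_pos r : 0 <= r < 1 -> is_derive r 1 path_pos (Re (dlogv r)).
Proof.
move=> r01; have [h _] := derc_zpath r01.
by apply: (is_derive_eq (is_deriveN h)); case: (dlogv r) => a b /=; rewrite opprK.
Qed.

Lemma path_pos0 : path_pos 0 = 0.
Proof. by rewrite path_posE /mlog !subr0 expr0n /= !addr0 ln1 mul0r addr0 oppr0. Qed.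

Lemma exhausts_path_pos : exhausts `]0, +oo[%classic
  (path_pos \o (fun n => n.+3%:R^-1)) (path_pos \o (fun n => 1 - n.+3%:R^-1 : R)).
Proof.
have [h1 h2 _] := @exhausts_unit R.
have i0 n : 0 < n.+3%:R^-1 :> R by rewrite invr_gt0 ltr0n.
have i1 n : 1 - n.+3%:R^-1 < 1 :> R by rewrite gtrBl.
have h3 n : n.+3%:R^-1 < 1 :> R by rewrite (lt_trans (h1 n)).
have h4 n : 0 < 1 - n.+3%:R^-1 :> R by rewrite subr_gt0.
have w s t : 0 <= s -> t < 1 -> s <= t -> path_pos s <= path_pos t.
  by move=> s0 t1; rewrite le_eqVlt => /predU1P[->//|st]; rewrite ltW// path_pos_homo.
apply: exhausts_pos => /=.
- move=> n; apply/andP; split; last by apply: path_pos_homo => //; exact: ltW.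
  by rewrite -path_pos0; apply: path_pos_homo.
- by move=> n; have [h h'] := h2 n; split; apply: w => //; exact: ltW.
- rewrite -[X in _ --> X]path_pos0; apply: (@cvg_comp _ _ _ _ path_pos _ _ _ invS3_cvg).
  apply: is_derive_continuous (is_derive_path_pos _).
  by rewrite lexx ltr01.
- apply: (@ger_cvgy _ _ _ _ (fun n => ln n.+3%:R)); last exact: ln_natS3_cvg.
  apply: nearW => n; rewrite -mlog_unit; apply: path_pos_ge.
  by rewrite i1 ltW.
Qed.

Lemma beta_half_substitution x :
  (\int[mu]_(t in `]0%R, +oo[) (beta_kernel x t)%:E =
   \int[mu]_(r in `]0%R, 1%R[) (beta_kernel x (Re (zpath r)) * Re (dlogv r))%:E)%E.
Proof.
have sub r : `]0, 1[%classic r -> 0 <= r < 1.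
  by rewrite /= in_itv /= => /andP[/ltW -> ->].
have d1 r : `]0, 1[%classic r -> is_derive r 1 path_pos (Re (dlogv r)).
  by move=> /sub; exact: is_derive_path_pos.
have oD : open (`]0, 1[%classic : set R) by exact: interval_open.
have oD' : open (`]0, +oo[%classic : set R) by exact: interval_open.
rewrite (@ge0_substitution R `]0, 1[%classic _ _ `]0, +oo[%classic path_pos
  (fun r => Re (dlogv r)) (beta_kernel x) oD exhausts_unit oD'
  exhausts_path_pos d1).
- by apply: eq_integral => r _; rewrite /path_pos beta_kernelN.
- by move=> r /set_mem /sub r01; exact: cvgc_Re_continuous (dlogv_continuous r01).
- move=> s t; rewrite /= !in_itv /= => /andP[s0 s1] /andP[t0 t1].
  by apply: path_pos_homo => //; exact: ltW.
- by move=> r /sub; exact: Re_dlogv_ge0.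
- by move=> r _; exact: beta_kernel_continuous.
- by move=> r _; exact: expR_ge0.
Qed.

(** The integrands on the real axis and on the path differ by the derivative of [vertical_int],
    which tends to 0 at both ends of []0, 1[]. *)
Lemma inv_central_binom_fint x : 0 < x -> 1 / central_binom x = x * fint 0 x.
Proof.
move=> x0; apply: EFin_inj; rewrite inv_central_binom_beta// beta_half_substitution EFinM.
congr (_ * _)%E.
pose k r := beta_kernel x (Re (zpath r)) * Re (dlogv r).
have sub r : `]0, 1[%classic r -> 0 <= r < 1.
  by rewrite /= in_itv /= => /andP[/ltW -> ->].
have oD : open (`]0, 1[%classic : set R) by exact: interval_open.
have mD : measurable (`]0, 1[%classic : set R) by exact: measurable_itv.
have ck : {in `]0, 1[%classic, continuous k}.
  move=> r /set_mem /sub r01; apply: cvgM.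
    apply: (@continuous_comp _ _ _ (fun r => Re (zpath r)) (beta_kernel x)).
      have [] := derc_continuous (derc_zpath r01); exact.
    exact: beta_kernel_continuous.
  exact: cvgc_Re_continuous (dlogv_continuous r01).
have ik : mu.-integrable `]0, 1[ (EFin \o k).
  apply: (dominated_integrable oD mD ck _ (mlog_weight_integrableZ 2 x0)) => r /sub r01.
  rewrite normrM mulrA (mulrC 2) -mulrA; apply: ler_pM => //.
    rewrite ger0_norm ?expR_ge0// ler_expR mulNr -mulrN.
    apply: (@le_trans _ _ (x * Re (zpath r))).
      by rewrite gerBl !mulr_ge0 ?softplus_ge0// ltW.
    by rewrite ler_pM2l//; exact: Re_zpath_le.
  by apply: le_trans (ler_normc_Re _) (dlogv_le r01).
have ie := eint_integrable 0 x0.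
have cE r : `]0, 1[%classic r -> Re (bexp x (zpath r) * dlogv r) = Re (eint 0 x r).
  by move=> r01; rewrite bexp_zpath ?/eint ?expr0 ?mul1r//; rewrite /= in_itv in r01.
have hd r : `]0, 1[%classic r -> is_derive r 1 (vertical_int x) (k r - Re (eint 0 x r)).
  move=> r01; rewrite -cE//; apply: is_derive_vertical_int => //.
have h : \int[mu]_(r in `]0, 1[) (k r - Re (eint 0 x r)) = 0 - 0.
  apply: (improper_FTC oD exhausts_unit _ hd).
  - move=> r r01; apply: cvgB; first exact: ck.
    apply: cvgc_Re_continuous; apply: eint_continuous.
    by move/set_mem : r01; rewrite /= in_itv.
  - exact: integrable_sub.
  - have [M hM] := vertical_int_near0 x0; apply/norm_cvg0P.
    apply: (@squeeze_cvgr _ _ _ _ (fun=> 0) (fun n => M * n.+3%:R^-1)).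
    + apply: nearW => n; rewrite normr_ge0 hM// invr_ge0 ler0n /=.
      by rewrite div1r lef_pV2 ?posrE ?ltr0n// ler_nat.
    + exact: cvg_cst.
    + by rewrite -(mulr0 M); apply: cvgMr; exact: invS3_cvg.
  - have [M hM] := vertical_int_near1 x0; apply/norm_cvg0P.
    apply: (@squeeze_cvgr _ _ _ _ (fun=> 0) (fun n => M * expR (- x * mlog (1 - n.+3%:R^-1)))).
    + apply: nearW => n; rewrite normr_ge0 hM//.
      by rewrite subr_ge0 gtrBl invr_gt0 ltr0n invf_le1 ?ltr0n// ler1n.
    + exact: cvg_cst.
    + by rewrite -[X in _ --> X](mulr0 M); apply: cvgMr; exact: expmlog_cvg1.
move: h; rewrite RintegralB// subrr => /eqP; rewrite subr_eq0 => /eqP h.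
rewrite /fint -h /Rintegral fineK//; exact: integrable_fin_num.
Qed.

End representation.

(** * Summation *)

Section summation.
Context {R : realType}.
Local Notation mu := (@lebesgue_measure R).
Implicit Types (x r t : R) (i p n : nat) (F : R -> R[i]).

Lemma polylogs_continuous w F r : polylogs w F -> 0 < r < 1 -> cvgc (nbhs r) F (F r).
Proof.
move=> h r01; elim: h => {w F} [w|w F G _ hF _ hG|v b c W _ hW|w F G FG _ h].
- exact: cvgc_cst.
- exact: cvgcD.
- apply: cvgcM.
    have r0 : 0 < r by case/andP: r01.
    exact: (derc_continuous (dercZ c (dercX b (derc_ln r0)))).
  case: W hW => [|a W] hW; last exact: (derc_continuous (derc_iint hW r01)).
  rewrite iint_nil//; apply: near_eq_cvgc (cvgc_cst 1).
  by near=> t; rewrite iint_nil//; near: t; exact: near_oo.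
- rewrite -FG//; apply: near_eq_cvgc h.
  by near=> t; apply: FG; near: t; exact: near_oo.
Unshelve. all: by end_near. Qed.

Lemma sum_geometric_ln_le n r : 0 < r < 1 ->
  \sum_(0 <= k < n) (1 - r) ^+ k.+1 / k.+1%:R <= - ln r.
Proof.
move=> /andP[r0 r1].
pose F t : R[i] := \sum_(0 <= k < n) (t%:C ^+ k.+1 / k.+1%:R).
have dF t : derc F t (\sum_(0 <= k < n) t%:C ^+ k).
  apply: derc_sum => k _.
  have h := dercZ k.+1%:R^-1 (dercX k.+1 (derc_real (is_derive_id t (1 : R)))).
  rewrite /F; under [X in derc X]eq_fun do rewrite mulrC.
  by apply: derc_eq h; rewrite mulr1 mulKf// pnatr_eq0.
have s0 : 0 <= 1 - r by rewrite subr_ge0 ltW.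
have := @derc_mean_value R F _ (@mlog R) (fun t => (1 - t)^-1) 0 (1 - r) s0 (fun t _ => dF t).
have -> : F 0 = 0.
  by rewrite /F big1// => k _; rewrite (_ : 0%:C = 0 :> R[i])// expr0n mul0r.
have -> : mlog (1 - r) - mlog 0 = - ln r :> R.
  by rewrite /mlog subr0 ln1 oppr0 subr0 opprB addrCA subrr addr0.
rewrite subr0 => h; apply: le_trans (h _ _).
- have -> : F (1 - r) = (\sum_(0 <= k < n) (1 - r) ^+ k.+1 / k.+1%:R)%:C.
    rewrite rmorph_sum /=; apply: eq_bigr => k _.
    by rewrite rmorphM rmorphXn fmorphV rmorph_nat.
  by rewrite normc_real ler_norm.
- by move=> t /andP[t0 t1]; apply: is_derive_mlog; lra.
- move=> t /andP[t0 t1]; apply: le_trans (ler_normc_sum _ _ _) _.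
  under eq_bigr do rewrite normcX normc_real ger0_norm//.
  by apply: sum_geometric_le; rewrite t0; lra.
Qed.

(** With [u = - (ln r) / 2] the right-hand side is [2 (e^u - e^(- u))]. The bound is integrable at
    0, and its zero at 1 cancels the pole of [dlogv]. *)
Lemma ln_le_invsqrt r : 0 < r < 1 -> - ln r <= 2 * ((1 - r) * expR (- (ln r / 2))).
Proof.
move=> /andP[r0 r1]; pose u := - (ln r / 2).
have u0 : 0 <= u.
  by rewrite oppr_ge0 pmulr_lle0// ln_le0// ltW.
have -> : - ln r = 2 * u by rewrite /u; field.
rewrite -/u ler_pM2l// mulrBl mul1r.
have -> : r * expR u = expR (- u).
  by rewrite -{1}[r]lnK ?posrE// -expRD; congr expR; rewrite /u; field.
have := expR_ge1Dx u; have : expR (- u) <= 1 by rewrite -expR0 ler_expR oppr_le0.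
by lra.
Qed.

(** This is [1 / sqrt (r (1 - r)) <= 1 / sqrt r + 1 / sqrt (1 - r)]: with [a = sqrt r] and
    [b = sqrt (1 - r)], [a^2 + b^2 = 1] implies [a + b >= 1]. *)
Lemma invsqrtM_le r : 0 < r < 1 ->
  expR (- (ln r / 2)) * expR (1 / 2 * mlog r) <=
  expR (- (ln r / 2)) + expR (- (1 / 2) * mlog r) / (1 - r).
Proof.
move=> /andP[r0 r1]; have s0 : 0 < 1 - r by rewrite subr_gt0.
have -> : expR (- (1 / 2) * mlog r) / (1 - r) = expR (1 / 2 * mlog r).
  by rewrite -expR_mlog// -expRD; congr expR; field.
pose a := expR (ln r / 2); pose b := expR (- (1 / 2 * mlog r)).
have a0 : 0 < a by exact: expR_gt0.
have b0 : 0 < b by exact: expR_gt0.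
have ab : a * a + b * b = 1.
  rewrite -!expRD -splitr lnK ?posrE//.
  have -> : - (1 / 2 * mlog r) - 1 / 2 * mlog r = - mlog r by field.
  by rewrite expRN expR_mlog// invrK addrC subrK.
have -> : expR (- (ln r / 2)) = a^-1 by rewrite expRN.
have -> : expR (1 / 2 * mlog r) = b^-1 by rewrite -[LHS]invrK -expRN.
have -> : a^-1 + b^-1 = (a + b) * (a^-1 * b^-1) by field; rewrite !gt_eqF.
rewrite -[leLHS]mul1r ler_wpM2r ?mulr_ge0 ?invr_ge0 ?ltW//.
by nra.
Qed.

Lemma invsqrt_integrable :
  mu.-integrable `]0, 1[ (EFin \o (fun r => expR (- (ln r / 2)))).
Proof.
have dH r : `]0, 1[%classic r ->
    is_derive r 1 (fun t => 2 * expR (2^-1 * ln t)) (expR (- (ln r / 2))).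
  rewrite /= in_itv /= => /andP[r0 r1].
  have h := is_deriveZ (2 : R) (is_derive_expR_comp (is_deriveZ (2^-1 : R) (is_derive1_ln r0))).
  apply: (is_derive_eq h); rewrite /GRing.scale /=.
  rewrite mulrA mulrA divff// mul1r -{1}[r]lnK ?posrE// -expRN -expRD.
  by congr expR; rewrite /GRing.scale /=; field.
apply: (@ge0_improper_integrable _ `]0, 1[%classic _ _ _ _ 0 2 _ exhausts_unit _ dH).
- exact: interval_open.
- move=> r /set_mem; rewrite /= in_itv /= => /andP[r0 r1].
  have h := is_derive_expR_comp (is_deriveN (is_deriveZ (2^-1 : R) (is_derive1_ln r0))).
  have := is_derive_continuous h.
  by rewrite (_ : (fun u => expR _) = (fun u => expR (- (ln u / 2))))//; apply/funext => u; rewrite /GRing.scale /= mulrC.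
- by move=> r _; exact: expR_ge0.
- have h := (cvg_at_rightP _ _ _).1 (@expR_half_ln_cvg R) (fun n => n.+3%:R^-1).
  rewrite -[X in _ --> X](mulr0 2); apply: cvgMr.
  under eq_fun do rewrite mulrC; apply: h; split; last exact: invS3_cvg.
  by move=> n; rewrite invr_gt0 ltr0n.
- rewrite -[X in _ --> X]mulr1; apply: cvgMr.
  have h1 : 1 - n.+3%:R^-1 @[n --> \oo] --> (1 - 0 : R).
    by apply: cvgB; [exact: cvg_cst|exact: invS3_cvg].
  rewrite subr0 in h1.
  have h2 : 2^-1 * ln (1 - n.+3%:R^-1) @[n --> \oo] --> 2^-1 * ln (1 : R).
    by apply: cvgMr; apply: (cvg_comp _ _ h1); apply: continuous_ln; exact: ltr01.
  have := cvg_comp _ _ h2 (@continuous_expR R _).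
  by rewrite ln1 mulr0 expR0.
Qed.

(** The derivative is bounded by a multiple of [(1 - t)^(- 1/2)], so [F] is Cauchy at 1. This
    supplies the limit that [polylogs_limit] asks for. *)
Lemma derc_cvg_left F (d : R -> R[i]) (K : R) :
  (forall t, 1 / 2 <= t < 1 -> derc F t (d t)) ->
  (forall t, 1 / 2 <= t < 1 -> normc (d t) <= K * (expR (- (1 / 2) * mlog t) / (1 - t))) ->
  exists z, cvgc (1 : R)^'- F z.
Proof.
move=> dF dK.
have K0 : 0 <= K.
  have h : 1 / 2 <= (1 / 2 : R) < 1 by apply/andP; split; lra.
  have := le_trans (normc_ge0 _) (dK _ h).
  by rewrite pmulr_lge0// divr_gt0 ?expR_gt0//; lra.
pose H t := - 2 * K * expR (- (1 / 2) * mlog t).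
have osc s t : 1 / 2 <= s -> s <= t -> t < 1 -> normc (F t - F s) <= - H s.
  move=> s0 st t1; apply: (@le_trans _ _ (H t - H s)); last first.
    have : H t <= 0 by rewrite /H mulr_le0_ge0 ?expR_ge0//; lra.
    by lra.
  have sub u : s <= u <= t -> 1 / 2 <= u < 1.
    by move=> /andP[su ut]; rewrite (le_trans s0 su) (le_lt_trans ut t1).
  have dH u : s <= u <= t -> is_derive u 1 H (K * (expR (- (1 / 2) * mlog u) / (1 - u))).
    move=> /sub /andP[_ u1].
    apply: (is_derive_eq (is_deriveZ (- 2 * K) (is_derive_expmlog (- (1 / 2)) u1))).
    by rewrite /GRing.scale /=; move: (expR _) ((1 - u)^-1) => a b; field.
  exact: (derc_mean_value st (fun u h => dF u (sub u h)) dH (fun u h => dK u (sub u h))).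
have H0 : - H t @[t --> (1 : R)^'-] --> (0 : R).
  apply/cvg_at_leftP => u [u1 ucvg].
  have h : expR (- (1 / 2) * mlog (u n)) @[n --> \oo] --> (0 : R).
    have h1 : 1 - u n @[n --> \oo] --> (1 - 1 : R).
      by apply: cvgB => //; exact: cvg_cst.
    rewrite subrr in h1.
    have := (cvg_at_rightP _ _ _).1 (@expR_half_ln_cvg R) (fun n => 1 - u n).
    have h2 n : 0 < 1 - u n by rewrite subr_gt0.
    move=> /(_ (conj h2 h1)); apply: cvg_trans; apply: near_eq_cvg; apply: nearW => n.
    by congr expR; rewrite /mlog; field.
  rewrite -oppr0; apply: cvgN; rewrite -[X in _ --> X](mulr0 (- 2 * K)).
  by apply: cvgMr.
have cauchyF (f : R -> R) : (forall s t, `|f t - f s| <= normc (F t - F s)) ->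
    cvg (f t @[t --> (1 : R)^'-]).
  move=> fF; apply: cauchy_cvg; apply: cauchy_exP => e e0.
  have /cvgr_lt/(_ e e0) := H0 => hs.
  near (1 : R)^'- => s.
  have s0 : 1 / 2 <= s by near: s; apply: nbhs_left_ge; lra.
  have se : - H s < e by near: s.
  exists (f s); change (\forall t \near (1 : R)^'-, ball (f s) e (f t)).
  near=> t; rewrite /ball /= distrC.
  apply: le_lt_trans (fF _ _) _; apply: le_lt_trans se; apply: osc => //.
    by near: t; apply: nbhs_left_ge; near: s; exact: nbhs_left_lt.
have cRe : cvg (Re (F t) @[t --> (1 : R)^'-]).
  by apply: cauchyF => s t; apply: le_trans (ler_normc_Re _); rewrite ReD; case: (F s).
have cIm : cvg (Im (F t) @[t --> (1 : R)^'-]).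
  by apply: cauchyF => s t; apply: le_trans (ler_normc_Im _); rewrite ImD; case: (F s).
by exists (lim (Re (F t) @[t --> (1 : R)^'-]) +i* lim (Im (F t) @[t --> (1 : R)^'-])).
Unshelve. all: by end_near. Qed.

Definition lint p i r : R[i] := liy p r * ell r ^+ i * dlogv r.

Lemma lint_le p i : exists2 C, 0 <= C & forall r, 1 / 2 <= r < 1 ->
  normc (lint p i r) <= C * (expR (- (1 / 2) * mlog r) / (1 - r)).
Proof.
have [C C0 hC] := @ellX_le R i (1 / 2) ltac:(lra).
exists (4 * C) => [|r /andP[r0 r1]]; first by rewrite mulr_ge0.
have r01 : 0 < r < 1 by rewrite r1 andbT; lra.
have r01' : 0 <= r < 1 by rewrite r1 andbT; lra.
have s0 : 0 < 1 - r by rewrite subr_gt0.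
have h1 := hC r r01.
have h2 : normc (liy p r) <= 2 * (1 - r).
  apply: le_trans (liy_le p r01) _; rewrite mulrC ler_pM2r//.
  by rewrite -[leRHS]invrK lef_pV2 ?posrE ?invr_gt0//; lra.
have h3 := dlogv_le r01'.
rewrite /lint (normcM _ (dlogv r)) (normcM (liy p r)) normcX.
apply: (@le_trans _ _ (2 * (1 - r) * (C * expR (1 / 2 * mlog r)) * (2 / (1 - r)))).
  by do ![apply: ler_pM; rewrite ?mulr_ge0 ?exprn_ge0 ?normc_ge0//].
have -> : expR (- (1 / 2) * mlog r) / (1 - r) = expR (1 / 2 * mlog r).
  by rewrite -expR_mlog// -expRD; congr expR; field.
rewrite le_eqVlt; apply/orP; left; apply/eqP.
by move: (expR _) => a; field; rewrite gt_eqF.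
Qed.

Lemma lint_continuous p i r : 0 < r < 1 -> cvgc (nbhs r) (lint p.+1 i) (lint p.+1 i r).
Proof.
move=> r01; have r01' : 0 <= r < 1 by case/andP: r01 => /ltW -> ->.
apply: cvgcM; last exact: dlogv_continuous.
apply: cvgcM; first exact: polylogs_continuous (polylogs_liy p) r01.
exact: (derc_continuous (dercX i (derc_ell r01))).
Qed.

Lemma cexp_natM_ell k r : 0 < r < 1 -> cexp ((k.+1%:R : R)%:C * ell r) = yfun r ^+ k.+1.
Proof. by move=> r01; rewrite rmorph_nat cexpMn cexp_ell. Qed.

Definition lpart p i n r : R[i] := (\sum_(0 <= k < n) liy_term p k r) * ell r ^+ i * dlogv r.

(** A bound uniform in [n], for dominated convergence. As [|y| <= 1 - r], the partial sums are
    compared with those of the series of [- ln r]; the singularities at 0 and 1 are then separated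
    by [invsqrtM_le]. *)
Lemma lpart_le p i : exists2 C, 0 <= C & forall n r, 0 < r < 1 ->
  normc (lpart p.+1 i n r) <= C * (expR (- (ln r / 2)) + expR (- (1 / 2) * mlog r) / (1 - r)).
Proof.
have [C C0 hC] := @ellX_le R i (1 / 2) ltac:(lra).
exists (4 * C) => [|n r r01]; first by rewrite mulr_ge0.
have /andP[r0 r1] := r01.
have r01' : 0 <= r < 1 by rewrite r1 andbT ltW.
have s0 : 0 < 1 - r by rewrite subr_gt0.
have h1 := hC r r01.
have h2 : normc (\sum_(0 <= k < n) liy_term p.+1 k r) <= 2 * ((1 - r) * expR (- (ln r / 2))).
  apply: le_trans (ln_le_invsqrt r01); apply: le_trans (sum_geometric_ln_le n r01).
  apply: le_trans (ler_normc_sum _ _ _) _; apply: ler_sum => k _.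
  have -> : liy_term p.+1 k r = yfun r ^+ k.+1 * k.+1%:R^-1 * (k.+1%:R ^+ p)^-1.
    by rewrite /liy_term (exprS k.+1%:R) invfM mulrA.
  rewrite normcM (normcM (yfun r ^+ _)) normcX (normcV k.+1%:R) normc_natr.
  rewrite -[leRHS]mulr1; apply: ler_pM; rewrite ?mulr_ge0 ?exprn_ge0 ?normc_ge0 ?invr_ge0//.
    rewrite ler_wpM2r ?invr_ge0//; apply: lerXn2r; rewrite ?nnegrE ?normc_ge0 ?(ltW s0)//.
    exact: normc_yfun_le.
  exact: normc_invXn.
have h3 := dlogv_le r01'.
rewrite /lpart (normcM _ (dlogv r)) (normcM _ (ell r ^+ i)) normcX.
apply: (@le_trans _ _ (2 * ((1 - r) * expR (- (ln r / 2))) * (C * expR (1 / 2 * mlog r)) * (2 / (1 - r)))).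
  by do ![apply: ler_pM; rewrite ?mulr_ge0 ?exprn_ge0 ?normc_ge0//].
apply: (@le_trans _ _ (4 * C * (expR (- (ln r / 2)) * expR (1 / 2 * mlog r)))).
  rewrite le_eqVlt; apply/orP; left; apply/eqP.
  by move: (expR _) (expR _) => a a'; field; rewrite gt_eqF.
by rewrite ler_wpM2l ?invsqrtM_le// mulr_ge0.
Qed.

Lemma lpart_cvg p i r : 0 < r < 1 ->
  cvgc \oo (fun n => lpart p i n r) (lint p i r).
Proof.
move=> r01; apply: cvgcM; last exact: cvgc_cst.
by apply: cvgcM; [exact: liy_cvg|exact: cvgc_cst].
Qed.

Lemma lpart_integrable p i n :
  mu.-integrable `]0, 1[ (EFin \o (fun r => Re (lpart p.+1 i n r))) /\
  \int[mu]_(r in `]0, 1[) Re (lpart p.+1 i n r) =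
  \sum_(0 <= k < n) (k.+1%:R ^+ p.+1)^-1 * fint i k.+1%:R.
Proof.
have mD : measurable (`]0, 1[%classic : set R) by exact: measurable_itv.
pose e n r := \sum_(0 <= k < n) (k.+1%:R ^+ p.+1)^-1 * Re (eint i k.+1%:R r).
have eE r : `]0, 1[%classic r -> Re (lpart p.+1 i n r) = e n r.
  rewrite /= in_itv /= => r01; rewrite /lpart /e !mulr_suml Re_sum.
  apply: eq_bigr => k _; rewrite /eint cexp_natM_ell//.
  rewrite /liy_term (_ : (k.+1%:R ^+ p.+1)^-1 = ((k.+1%:R ^+ p.+1)^-1)%:C :> R[i]); last first.
    by rewrite fmorphV rmorphXn /= rmorph_nat.
  move: (_^-1 : R) (yfun r ^+ k.+1) (ell r ^+ i) (dlogv r) => c y l d.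
  rewrite (_ : y * c%:C * l * d = c%:C * (l * y * d)); last by ring.
  by case: (l * y * d) => u v /=; ring.
suff [h1 h2] : mu.-integrable `]0, 1[ (EFin \o e n) /\
    \int[mu]_(r in `]0, 1[) e n r = \sum_(0 <= k < n) (k.+1%:R ^+ p.+1)^-1 * fint i k.+1%:R.
  split; last by rewrite -h2; apply: eq_Rintegral => r /set_mem; exact: eE.
  by apply: eq_integrable h1 => // r /set_mem r01; rewrite /= eE.
have ik k : mu.-integrable `]0, 1[
    (EFin \o (fun r => (k.+1%:R ^+ p.+1)^-1 * Re (eint i k.+1%:R r))).
  by apply: integrable_scale => //; apply: eint_integrable; rewrite ltr0n.
elim: n {eE} => [|n [IH1 IH2]].
  rewrite big_nil; split; last first.
    by rewrite /e; under eq_Rintegral do rewrite big_nil; rewrite Rintegral_cst ?mul0r.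
  apply: eq_integrable (integrable0 _ _) => // r _.
  by rewrite /e /= big_nil.
split.
  have h := @integrableD _ (measurableTypeR R) R mu _ mD _ _ IH1 (ik n).
  by apply: eq_integrable h => // r _; rewrite /e /= big_nat_recr.
rewrite big_nat_recr//= -IH2 /fint -RintegralZl//; last first.
  by apply: eint_integrable; rewrite ltr0n.
rewrite -RintegralD//; apply: eq_Rintegral => r _.
by rewrite /e big_nat_recr.
Qed.

Lemma fint_series p i : exists S : R, wvals (p.+1 + i).+1 S%:C /\
  series (fun k => (k.+1%:R ^+ p.+1)^-1 * fint i k.+1%:R) @ \oo --> S.
Proof.
have oD : open (`]0, 1[%classic : set R) by exact: interval_open.
have mD : measurable (`]0, 1[%classic : set R) by exact: measurable_itv.
have [G [Gpoly G0 dG]] := @polylogs_integral R p i.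
have [C C0 hC] := lint_le p.+1 i.
have [z Gz] : exists z, cvgc (1 : R)^'- G z.
  apply: (@derc_cvg_left G (lint p.+1 i) C) => r h; last exact: hC.
  by apply: dG; case/andP: h => h1 h2; apply/andP; split => //; lra.
have [M M0 hM] := lpart_le p i.
(* The sum is written as a difference to fit [integrable_sub]. *)
pose g r := M * (expR (- (ln r / 2)) - - (expR (- (1 / 2) * mlog r) / (1 - r))).
have ig : mu.-integrable `]0, 1[ (EFin \o g).
  apply: integrable_scale => //; apply: integrable_sub => //; first exact: invsqrt_integrable.
  have h : 0 < 1 / 2 :> R by lra.
  have := mlog_weight_integrableZ (- 1) h.
  by apply: eq_integrable => // r _; rewrite /= mulN1r.
have gM n r : `]0, 1[%classic r -> `|Re (lpart p.+1 i n r)| <= g r.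
  rewrite /= in_itv /= => r01; apply: le_trans (ler_normc_Re _) _.
  by rewrite /g opprK; exact: hM.
have cl : {in `]0, 1[%classic, continuous (fun r => Re (lint p.+1 i r))}.
  by move=> r /set_mem; rewrite /= in_itv /= => r01; exact: cvgc_Re_continuous (lint_continuous p i r01).
have cvl r : `]0, 1[%classic r ->
    Re (lpart p.+1 i n r) @[n --> \oo] --> Re (lint p.+1 i r).
  by rewrite /= in_itv /= => r01; have [] := lpart_cvg p.+1 i r01.
have il : mu.-integrable `]0, 1[ (EFin \o (fun r => Re (lint p.+1 i r))).
  apply: (dominated_integrable oD mD cl _ ig) => r r01.
  have h : `|Re (lpart p.+1 i n r)| @[n --> \oo] --> `|Re (lint p.+1 i r)|.
    by apply: cvg_norm; exact: cvl.
  by apply: (ler_cvg_to h (cvg_cst (g r))); apply: nearW => n; exact: gM.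
have lim : \int[mu]_(r in `]0, 1[) Re (lint p.+1 i r) = Re z - 0.
  have hd r : `]0, 1[%classic r ->
      is_derive r 1 (fun t => Re (G t)) (Re (lint p.+1 i r)).
    by rewrite /= in_itv /= => r01; have [] := dG r r01.
  apply: (improper_FTC oD exhausts_unit cl hd il).
  - have [h _] := G0; apply: ((cvg_at_rightP _ _ _).1 h); split; last exact: invS3_cvg.
    by move=> n; rewrite invr_gt0 ltr0n.
  - have [h _] := Gz; apply: ((cvg_at_leftP _ _ _).1 h); split.
      by move=> n; rewrite gtrBl invr_gt0 ltr0n.
    rewrite -[X in _ --> X]subr0; apply: cvgB; [exact: cvg_cst|exact: invS3_cvg].
exists (Re z); split.
  have hz := polylogs_limit Gpoly Gz.
  (* Taking real parts stays in the span, which is closed under conjugation. *)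
  have -> : (Re z)%:C = ratr (1 / 2) * (z + conjc z).
    by rewrite rmorphM rmorph1 fmorphV rmorph_nat; case: (z) => u v; apply: complexP => /=; field.
  by apply: wvalsZ; apply: wvalsD => //; exact: wvals_conj.
rewrite subr0 in lim.
have EL (f : R -> R) : mu.-integrable `]0, 1[ (EFin \o f) ->
    (\int[mu]_(r in `]0%R, 1%R[) (f r)%:E = (\int[mu]_(r in `]0, 1[) f r)%:E)%E.
  by move=> h; rewrite /Rintegral fineK//; exact: integrable_fin_num.
have : (\int[mu]_(r in `]0%R, 1%R[) (Re (lpart p.+1 i n r))%:E)%E @[n --> \oo] -->
    (\int[mu]_(r in `]0%R, 1%R[) (Re (lint p.+1 i r))%:E)%E.
  apply: (@dominated_cvg _ (measurableTypeR R) R mu _ mD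
    (fun n r => (Re (lpart p.+1 i n r))%:E) _ (EFin \o g)) => //.
  - by move=> n; have [/integrableP[]] := lpart_integrable p i n.
  - by move=> r r01; apply: cvg_EFin; [exact: nearW|exact: cvl].
rewrite EL// lim => /fine_cvg; apply: cvg_trans; apply: near_eq_cvg; apply: nearW => n /=.
by have [h1 h2] := lpart_integrable p i n; rewrite EL// h2.
Unshelve. all: by end_near. Qed.

End summation.

(** * Derivatives of the summand and summation over the positive integers *)

Section theorem.
Context {R : realType}.
Implicit Types (x : R) (w m i n k : nat) (F G : R -> R).

(* The functions [x^-m f^(i)(x)], with [f x = 1 / (x * central_binom x)],
   graded by [m + i]. *)
Inductive beta_comb : nat -> (R -> R) -> Prop :=
| beta_comb_term m i : (0 < m)%N -> beta_comb (m + i) (fun x => (x ^+ m)^-1 * fint i x)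
| beta_combD w F G : beta_comb w F -> beta_comb w G -> beta_comb w (fun x => F x + G x)
| beta_combZ w (c : int) F : beta_comb w F -> beta_comb w (fun x => c%:~R * F x)
| beta_comb_eq w F G : (forall x, 0 < x -> F x = G x) -> beta_comb w F -> beta_comb w G.

Lemma near_pos x : 0 < x -> \forall t \near x, 0 < t.
Proof. by move=> x0; exact: lt_nbhsr. Qed.

Lemma beta_comb_derive w F : beta_comb w F ->
  exists2 F', beta_comb w.+1 F' & forall x, 0 < x -> is_derive x 1 F (F' x).
Proof.
elim=> {w F} [m i m0|w F G _ [F' hF dF] _ [G' hG dG]|w c F _ [F' hF dF]|w F G FG _ [F' hF dF]].
- exists (fun x => (x ^+ m)^-1 * fint i.+1 x + (- m%:Z)%:~R * ((x ^+ m.+1)^-1 * fint i x)).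
    apply: beta_combD; first by rewrite -addnS; exact: beta_comb_term.
    by apply: beta_combZ; rewrite -addSn; exact: beta_comb_term.
  move=> x x0; have xm : x ^+ m != 0 by rewrite expf_neq0// gt_eqF.
  have h1 := is_deriveX m (is_derive_id x (1 : R)); rewrite exprfctE in h1.
  have h2 := @is_deriveV _ (fun t : R => t ^+ m) _ _ _ xm h1.
  have h3 := is_deriveM h2 (is_derive_fint i x0).
  apply: (is_derive_eq h3); rewrite /GRing.scale /= mulr1 rmorphN /= -pmulrn.
  case: m m0 xm {h1 h2 h3} => // m _ xm.
  rewrite -pred_Sn -[1 *- m.+1]/(- m.+1%:R) !exprS expr0 mulr1.
  have xm' : x ^+ m != 0 by rewrite expf_neq0// gt_eqF.
  move: (fint _ _) (fint _ _) (x ^+ m) (m.+1%:R : R) xm' => a b y c y0.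
  by field; rewrite y0 gt_eqF.
- exists (fun x => F' x + G' x); first exact: beta_combD.
  by move=> x x0; apply: is_deriveD; [exact: dF|exact: dG].
- exists (fun x => c%:~R * F' x); first exact: beta_combZ.
  by move=> x x0; exact: (is_derive_eq (is_deriveZ (c%:~R : R) (dF x x0))).
- exists F' => // x x0; apply: is_derive_near (dF x x0).
  by apply: filterS (near_pos x0) => t; exact: FG.
Qed.

Lemma beta_comb_derive1n w n F : beta_comb w F ->
  exists2 G, beta_comb (n + w) G & forall x, 0 < x -> derive1n n F x = G x.
Proof.
move=> hF; elim: n => [|n [G hG FG]]; first by exists F.
have [G' hG' dG] := beta_comb_derive hG; exists G' => // x x0.
rewrite derive1nS derive1E.
have h : is_derive x 1 (derive1n n F) (G' x).
  apply: is_derive_near (dG x x0).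
  by apply: filterS (near_pos x0) => t t0; rewrite FG.
by have [_ ->] := h.
Qed.

(** The sum of [k^(- m) fint i k] is the real part of the integral of [Li_m(y) ell^i dlogv]: the
    unit of weight beyond [m + i] is that of [dlogv]. *)
Lemma beta_comb_series w F : beta_comb w F -> exists S : R,
  wvals w.+1 S%:C /\ series (fun k => F k.+1%:R) @ \oo --> S.
Proof.
elim=> {w F} [[//|p] i _|w F G _ [S [vS cS]] _ [T [vT cT]]|w c F _ [S [vS cS]]|w F G FG _ [S [vS cS]]].
- exact: fint_series.
- exists (S + T); split; first by rewrite rmorphD; exact: wvalsD.
  have -> : series (fun k => F k.+1%:R + G k.+1%:R) =
      (fun n => series (fun k => F k.+1%:R) n + series (fun k => G k.+1%:R) n).
    by apply/funext => n; rewrite /series /= big_split.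
  exact: cvgD.
- exists (c%:~R * S); split.
    have -> : (c%:~R * S)%:C = ratr c%:~R * S%:C :> R[i] by rewrite rmorphM ratr_int rmorph_int.
    exact: wvalsZ.
  have -> : series (fun k => c%:~R * F k.+1%:R) = (fun n => c%:~R * series (fun k => F k.+1%:R) n).
    by apply/funext => n; rewrite /series /= mulr_sumr.
  exact: cvgMr.
- exists S; split => //.
  have <- : series (fun k => F k.+1%:R) = series (fun k => G k.+1%:R) => //.
  by congr series; apply/funext => k; rewrite FG// ltr0n.
Qed.

(** The summand is [x^(1 - s) f x], and [s >= 2] makes the exponent [s - 1] positive.
    Differentiation only increases it, so that only [Li_p] with [p >= 1] occurs in the sum. *)
Lemma scrA_term_comb s n : (2 <= s)%N ->
  exists2 G, beta_comb (n + s.-1) G & forall k, scrA_term R s n k = G k.+1%:R.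
Proof.
case: s => [|[|s]]// _.
have h : beta_comb s.+1 (fun x => 1 / (x ^+ s.+2 * central_binom x)).
  apply: (@beta_comb_eq _ (fun x => (x ^+ s.+1)^-1 * fint 0 x)); last first.
    by rewrite -[X in beta_comb X]addn0; exact: beta_comb_term.
  move=> x x0; have x0' : x != 0 by rewrite gt_eqF.
  have := inv_central_binom_fint x0; move: (central_binom x) => B.
  rewrite !div1r invfM => ->.
  by rewrite [x ^+ s.+2]exprSr invfM -mulrA mulKf.
have [G hG FG] := beta_comb_derive1n n h; exists G => // k.
by apply: FG; rewrite ltr0n.
Qed.

Lemma central_binom_nat n : central_binom n%:R = 'C(2 * n, n)%:R :> R.
Proof.
have e : 2 * n%:R + 1 = (2 * n).+1%:R :> R by rewrite -(natr1 (2 * n)) natrM.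
rewrite /central_binom e natr1 !Gamma_nat.
have h := @bin_fact (2 * n) n (leq_pmull n (isT : (0 < 2)%N)).
have f0 : n`!%:R != 0 :> R by rewrite pnatr_eq0 -lt0n fact_gt0.
rewrite (_ : (2 * n - n)%N = n) in h; last by rewrite mul2n -addnn addnK.
rewrite -h !natrM; field.
exact: f0.
Qed.

End theorem.

Theorem theorem1p2 (R : realType) (s : nat) (hs : (2 <= s)%N) :
  (forall n : nat,
     cvgn (series (scrA_term R s n)) /\
     frakZ R (n + s)%N 3%N (scrA R s n)%:C) /\
  scrA R s 0 = scrA_binom R s.
Proof.
split=> [n|].
  have [G hG tG] := @scrA_term_comb R s n hs.
  have [S [vS cS]] := beta_comb_series hG.
  have e : scrA_term R s n = (fun k => G k.+1%:R) by apply/funext.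
  rewrite /scrA e; split; first by apply/cvg_ex; exists S.
  rewrite (cvg_lim _ cS)//; apply: wvals_frakZ; first by rewrite addn_gt0 (ltnW hs) orbT.
  by move: vS; rewrite -addnS prednK// ltnW.
have -> : scrA R s 0 = limn (series (scrA_term R s 0)) by [].
rewrite /scrA_binom; congr (limn (series _)); apply/funext => k.
by rewrite /scrA_term /= central_binom_nat.
Qed.
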